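(* Let $A$ be a $\sigma$-unital $C_0(X)$-algebra with base map $\phi$. Let $x\in X_\phi$ and let $Z$ be a zero set of $X_\phi$ with $x\in Z$. Suppose that $J_x$ is not locally modular. Then there exist $y\in Z$, $c\in\tilde J_y$ and $\epsilon>0$ such that there is no open set $V\subseteq\mathrm{Prim}(A)$ with $H(y)\subseteq V$ and $\Vert c+\tilde P\Vert<\epsilon$ for all $P\in V$. In particular, $H_y$ is not strictly closed in $M(A)$.
   Context: For a C$^*$-algebra $A$, $\mathrm{Prim}(A)$ is the primitive ideal space with the hull-kernel topology and $M(A)$ is the multiplier algebra. $A$ is a $C_0(X)$-algebra with base map $\phi$ if $X$ is a locally compact Hausdorff space and $\phi:\mathrm{Prim}(A)\to X$ is continuous; $X_\phi$ denotes the image of $\phi$ with the subspace topology. For a closed two-sided ideal $J$ of $A$, $\tilde J=\{b\in M(A): ba,ab\in J \text{ for all } a\in A\}$. If $P\in\mathrm{Prim}(A)$ then $\tilde P\in\mathrm{Prim}(M(A))$, and $P\mapsto\tilde P$ is a homeomorphism onto a dense open subset of $\mathrm{Prim}(M(A))$. The map $\phi$ has a unique extension to a continuous map $\overline\phi:\mathrm{Prim}(M(A))\to\beta X$ (the Stone-Čech compactification) with $\overline\phi(\tilde P)=\phi(P)$ for all $P\in\mathrm{Prim}(A)$. For $x\in X_\phi$ put $J_x=\bigcap\{P\in\mathrm{Prim}(A):\phi(P)=x\}$ and $H_x=\bigcap\{Q\in\mathrm{Prim}(M(A)):\overline\phi(Q)=x\}$. ''Strictly closed'' means closed in the strict topology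 of $M(A)$. For $x\in X_\phi$ let $H(x)=\phi^{-1}(x)\subseteq\mathrm{Prim}(A)$, with boundary $\partial H(x)$ and interior $U(x)$ in $\mathrm{Prim}(A)$. $J_x$ is locally modular if for each $P\in\partial H(x)$ there is a relatively open neighbourhood $V$ of $P$ in $\mathrm{Prim}(A)\setminus U(x)$ such that $A/\ker V$ is unital, where $\ker V=\bigcap_{Q\in V}Q$. A zero set of $X_\phi$ is a set of the form $h^{-1}(0)$ with $h$ a continuous real-valued function on $X_\phi$. *)

(* Defs.v *)
From HB Require Import structures.
From mathcomp Require Import all_boot all_order all_algebra.
From mathcomp Require Import all_classical.
From mathcomp Require Import reals topology normedtype.
From mathcomp.real_closed Require Import complex.

Set Implicit Arguments.
Unset Strict Implicit.
Unset Printing Implicit Defensive.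
Import Order.TTheory GRing.Theory Num.Theory.
Import numFieldNormedType.Exports.
Local Open Scope classical_set_scope.
Local Open Scope ring_scope.
Local Open Scope complex_scope.

Reserved Notation "a ** b" (at level 40, left associativity).

(* The product is a bare function because an algebra need not have a unit, and
   the ring structures of the library require one. *)
HB.mixin Record isCStarAlgebra (R : realType) A & CompleteNormedModule R[i] A := {
  cmul : A -> A -> A;
  star : A -> A;
  cmulA : forall a b c, cmul a (cmul b c) = cmul (cmul a b) c;
  cmulPl : forall (k : R[i]) a b c, cmul (k *: a + b) c = k *: cmul a c + cmul b c;
  cmulPr : forall (k : R[i]) a b c, cmul c (k *: a + b) = k *: cmul c a + cmul c b;
  starP : forall (k : R[i]) a b, star (k *: a + b) = k^* *: star a + star b;
  starM : forall a b, star (cmul a b) = cmul (star b) (star a);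
  starK : forall a, star (star a) = a;
  cnormM : forall a b, `|cmul a b| <= `|a| * `|b|;
  cstar_identity : forall a, `|cmul (star a) a| = `|a| ^+ 2
}.

#[short(type="cstarAlgType")]
HB.structure Definition CStarAlgebra (R : realType) :=
  {A of CompleteNormedModule R[i] A & isCStarAlgebra R A}.

Notation "a ** b" := (cmul a b) : ring_scope.

(* The inner product is linear in its first argument. *)
HB.mixin Record isHilbert (R : realType) H & CompleteNormedModule R[i] H := {
  ip : H -> H -> R[i];
  ipPl : forall (k : R[i]) x y z, ip (k *: x + y) z = k * ip x z + ip y z;
  ipC : forall x y, ip y x = (ip x y)^*;
  ip_norm : forall x, ip x x = `|x| ^+ 2
}.

#[short(type="hilbertType")]
HB.structure Definition Hilbert (R : realType) :=
  {H of CompleteNormedModule R[i] H & isHilbert R H}.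

Section real_norm.
Context {R : realType} {V : normedModType R[i]}.
Implicit Types x y : V.

(* The norm of a normed module over R[i] takes its values in R[i]; rnorm is the
   same norm with values in R. *)
Definition rnorm x : R := complex.Re `|x|.

Lemma rnormE x : `|x| = (rnorm x)%:C.
Proof.
have := normr_ge0 x; rewrite /rnorm.
by case: (`|x|) => a b; rewrite lecE /= => /andP[/eqP -> _].
Qed.

Lemma rnorm_ge0 x : 0 <= rnorm x.
Proof. by rewrite -lecR -rnormE normr_ge0. Qed.

Lemma rnorm0 : rnorm (0 : V) = 0.
Proof. by rewrite /rnorm normr0. Qed.

Lemma rnorm_eq0 x : rnorm x = 0 -> x = 0.
Proof. by move=> x0; apply/eqP; rewrite -normr_eq0 rnormE x0. Qed.

Lemma rnormZ (k : R[i]) x : rnorm (k *: x) = complex.Re `|k| * rnorm x.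
Proof.
by rewrite {1}/rnorm normrZ rnormE normc_def -rmorphM.
Qed.

Lemma rnormN x : rnorm (- x) = rnorm x.
Proof. by rewrite /rnorm normrN. Qed.

Lemma rnormD x y : rnorm (x + y) <= rnorm x + rnorm y.
Proof. by have := ler_normD x y; rewrite !rnormE -rmorphD lecR. Qed.

End real_norm.

Section cstar_theory.
Context {R : realType} {A : cstarAlgType R}.
Implicit Types a b c : A.

Lemma cmul0l a : 0 ** a = 0.
Proof. by have := cmulPl (-1) 0 0 a; rewrite !scaleN1r oppr0 addr0 addNr. Qed.

Lemma cmul0r a : a ** 0 = 0.
Proof. by have := cmulPr (-1) 0 0 a; rewrite !scaleN1r oppr0 addr0 addNr. Qed.

Lemma cmulDl a b c : (a + b) ** c = a ** c + b ** c.
Proof. by have := cmulPl 1 a b c; rewrite !scale1r. Qed.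

Lemma cmulDr a b c : c ** (a + b) = c ** a + c ** b.
Proof. by have := cmulPr 1 a b c; rewrite !scale1r. Qed.

Lemma cmulZl (k : R[i]) a b : (k *: a) ** b = k *: (a ** b).
Proof. by have := cmulPl k a 0 b; rewrite !addr0 cmul0l addr0. Qed.

Lemma cmulZr (k : R[i]) a b : a ** (k *: b) = k *: (a ** b).
Proof. by have := cmulPr k b 0 a; rewrite !addr0 cmul0r addr0. Qed.

Lemma cmulNl a b : (- a) ** b = - (a ** b).
Proof. by rewrite -scaleN1r cmulZl scaleN1r. Qed.

Lemma cmulNr a b : a ** (- b) = - (a ** b).
Proof. by rewrite -scaleN1r cmulZr scaleN1r. Qed.

Lemma cmulBl a b c : (a - b) ** c = a ** c - b ** c.
Proof. by rewrite cmulDl cmulNl. Qed.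

Lemma cmulBr a b c : c ** (a - b) = c ** a - c ** b.
Proof. by rewrite cmulDr cmulNr. Qed.

Lemma star0 : star 0 = 0 :> A.
Proof.
by have := starP (-1) (0 : A) 0; rewrite rmorphN1 !scaleN1r oppr0 addr0 addNr.
Qed.

Lemma starD a b : star (a + b) = star a + star b.
Proof. by have := starP 1 a b; rewrite rmorph1 !scale1r. Qed.

Lemma starZ (k : R[i]) a : star (k *: a) = k^* *: star a.
Proof. by have := starP k a 0; rewrite !addr0 star0 addr0. Qed.

Lemma rnormM a b : rnorm (a ** b) <= rnorm a * rnorm b.
Proof. by have := cnormM a b; rewrite !rnormE -rmorphM lecR. Qed.

Lemma rnorm_star_mul a : rnorm (star a ** a) = rnorm a ^+ 2.
Proof. by have := cstar_identity a; rewrite !rnormE -rmorphXn => -[]. Qed.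

Lemma rnorm_star a : rnorm (star a) = rnorm a.
Proof.
suff le b : rnorm b <= rnorm (star b).
  by apply/eqP; rewrite eq_le le -{2}(starK a) le.
have [->|b0] := eqVneq b 0; first by rewrite star0.
have b_gt0 : 0 < rnorm b.
  by rewrite lt_def rnorm_ge0 andbT; apply: contra_neq b0 => /rnorm_eq0.
by rewrite -(ler_pM2r b_gt0) -expr2 -rnorm_star_mul rnormM.
Qed.

Lemma rnorm_mul_star a : rnorm (a ** star a) = rnorm a ^+ 2.
Proof. by rewrite -{1}(starK a) rnorm_star_mul rnorm_star. Qed.

Lemma cmul_inj_l x y : (forall a, a ** x = a ** y) -> x = y :> A.
Proof.
move=> h; apply/eqP; rewrite -subr_eq0; apply/eqP/rnorm_eq0/eqP.
by rewrite -sqrf_eq0 -rnorm_star_mul cmulBr h subrr rnorm0.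
Qed.

Lemma cmul_inj_r x y : (forall a, x ** a = y ** a) -> x = y :> A.
Proof.
move=> h; apply/eqP; rewrite -subr_eq0; apply/eqP/rnorm_eq0/eqP.
by rewrite -sqrf_eq0 -rnorm_mul_star cmulBl h subrr rnorm0.
Qed.

End cstar_theory.

Section operator_norm.
Context {R : realType} {V : normedModType R[i]}.
Implicit Types (L : V -> V) (x : V).

Definition bounded_op L := exists k : R, forall x, rnorm (L x) <= k * rnorm x.

Definition opnorm L : R := sup [set rnorm (L x) | x in [set x | rnorm x <= 1]].

Lemma opnorm_le L k : 0 <= k -> (forall x, rnorm (L x) <= k * rnorm x) ->
  opnorm L <= k.
Proof.
move=> k0 Lk; apply: ge_sup; first by exists (rnorm (L 0)), 0; rewrite //= rnorm0.
move=> _ [x x1 <-]; apply: (le_trans (Lk x)).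
by rewrite -[leRHS]mulr1 ler_wpM2l.
Qed.

Lemma opnorm_ub L x : bounded_op L -> rnorm x <= 1 -> rnorm (L x) <= opnorm L.
Proof.
move=> [k Lk] x1; apply: ub_le_sup; last by exists x.
exists `|k| => _ [y y1 <-]; apply: (le_trans (Lk y)).
apply: (le_trans (ler_wpM2r (rnorm_ge0 y) (ler_norm k))).
by rewrite -[leRHS]mulr1 ler_wpM2l.
Qed.

Lemma opnorm_ge0 L : bounded_op L -> 0 <= opnorm L.
Proof.
move=> bL; apply: (@le_trans _ _ (rnorm (L 0))); first exact: rnorm_ge0.
by apply: opnorm_ub => //; rewrite rnorm0.
Qed.

Lemma opnormP L x : linear L -> bounded_op L ->
  rnorm (L x) <= opnorm L * rnorm x.
Proof.
move=> lL bL.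
have LZ k y : L (k *: y) = k *: L y.
  have L0 : L 0 = 0 by have := lL (-1) 0 0; rewrite !scaleN1r oppr0 addr0 addNr.
  by have := lL k y 0; rewrite L0 !addr0.
have [->|x0] := eqVneq x 0; first by rewrite -(scale0r 0) LZ !scale0r rnorm0 mulr0.
have x_gt0 : 0 < rnorm x.
  by rewrite lt_def rnorm_ge0 andbT; apply: contra_neq x0 => /rnorm_eq0.
have e (y : V) : rnorm ((rnorm x)^-1%:C *: y) = (rnorm x)^-1 * rnorm y.
  rewrite rnormZ normc_def /= expr0n /= addr0 sqrtr_sqr.
  by rewrite ger0_norm // invr_ge0 ltW.
rewrite -ler_pdivrMr // mulrC -e -LZ; apply: opnorm_ub => //.
by rewrite e mulVf // gt_eqF.
Qed.

End operator_norm.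

(* A multiplier b is a double centralizer: lmul b a stands for b a and
   rmul b a for a b. The C*-algebra structure (pointwise linear operations,
   composition, operator norm) is built below. *)
Record multiplier (R : realType) (A : cstarAlgType R) := Multiplier {
  lmul : A -> A;
  rmul : A -> A;
  lmul_linear : linear lmul;
  rmul_linear : linear rmul;
  lmul_bounded : bounded_op lmul;
  rmul_bounded : bounded_op rmul;
  lmulM : forall a b, lmul (a ** b) = lmul a ** b;
  rmulM : forall a b, rmul (a ** b) = a ** rmul b;
  rmul_lmul : forall a b, rmul a ** b = a ** lmul b
}.

Section multiplier_algebra.
Variables (R : realType) (A : cstarAlgType R).
Local Notation M := (multiplier A).
Implicit Types (m n : M) (a b : A).

Lemma multiplier_eq m n : lmul m =1 lmul n -> m = n.
Proof.
move=> mn; have rr : rmul m =1 rmul n.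
  by move=> a; apply: cmul_inj_r => b; rewrite !rmul_lmul mn.
case: m n mn rr => [L1 R1 ? ? ? ? ? ? ?] [L2 R2 ? ? ? ? ? ? ?] /= /funext L12.
move=> /funext R12; subst; congr Multiplier; exact: Prop_irrelevance.
Qed.

(* Linearity and the module identities follow from rmul_lmul alone. *)
Section smart_constructor.
Variables (L S : A -> A).
Hypotheses (bL : bounded_op L) (bS : bounded_op S).
Hypothesis SL : forall a b, S a ** b = a ** L b.

Let lL : linear L.
Proof.
move=> k a b; apply: cmul_inj_l => c.
by rewrite -SL cmulDr cmulZr !SL -cmulZr -cmulDr.
Qed.

Let lS : linear S.
Proof.
move=> k a b; apply: cmul_inj_r => c.
by rewrite SL cmulDl cmulZl -!SL -cmulZl -cmulDl.
Qed.

Let LM a b : L (a ** b) = L a ** b.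
Proof. by apply: cmul_inj_l => c; rewrite -SL !cmulA SL. Qed.

Let SM a b : S (a ** b) = a ** S b.
Proof. by apply: cmul_inj_r => c; rewrite SL -!cmulA SL. Qed.

Definition mkMultiplier : M := Multiplier lL lS bL bS LM SM SL.
End smart_constructor.

Lemma lmulP m a : rnorm (lmul m a) <= opnorm (lmul m) * rnorm a.
Proof. exact: opnormP (lmul_linear m) (lmul_bounded m). Qed.

Lemma rmulP m a : rnorm (rmul m a) <= opnorm (rmul m) * rnorm a.
Proof. exact: opnormP (rmul_linear m) (rmul_bounded m). Qed.

Lemma opnorm_rmul m : opnorm (rmul m) = opnorm (lmul m).
Proof.
have cancel_sq (x y : R) : 0 <= x -> 0 <= y -> x ^+ 2 <= y * x -> x <= y.
  rewrite le_eqVlt => /predU1P[<- //|x0 _].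
  by rewrite expr2 ler_pM2r.
have l0 := opnorm_ge0 (lmul_bounded m); have r0 := opnorm_ge0 (rmul_bounded m).
apply/eqP; rewrite eq_le; apply/andP; split.
  apply: opnorm_le => // a; apply: cancel_sq; first exact: rnorm_ge0.
    by rewrite mulr_ge0 ?rnorm_ge0.
  rewrite -rnorm_mul_star rmul_lmul.
  apply: (le_trans (rnormM _ _)).
  rewrite [leLHS]mulrC mulrAC ler_wpM2r ?rnorm_ge0 //.
  by rewrite -(rnorm_star (rmul m a)) lmulP.
apply: opnorm_le => // a; apply: cancel_sq; first exact: rnorm_ge0.
  by rewrite mulr_ge0 ?rnorm_ge0.
rewrite -rnorm_star_mul -rmul_lmul.
apply: (le_trans (rnormM _ _)).
rewrite mulrAC ler_wpM2r ?rnorm_ge0 //.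
by rewrite -(rnorm_star (lmul m a)) rmulP.
Qed.

Let bounded_add L S : bounded_op L -> bounded_op S ->
  bounded_op (fun a : A => L a + S a).
Proof.
move=> [k Lk] [l Sl]; exists (k + l) => a.
by rewrite (le_trans (rnormD _ _)) // mulrDl lerD.
Qed.

Let bounded_scale (k : R[i]) L : bounded_op L ->
  bounded_op (fun a : A => k *: L a).
Proof.
move=> [l Ll]; exists (complex.Re `|k| * l) => a.
by rewrite rnormZ -mulrA ler_wpM2l // normc_def /= sqrtr_ge0.
Qed.

Let bounded_comp L S : bounded_op L -> bounded_op S ->
  bounded_op (fun a : A => L (S a)).
Proof.
move=> [k Lk] [l Sl]; exists (`|k| * l) => a.
apply: (le_trans (Lk _)); apply: (le_trans (ler_wpM2r (rnorm_ge0 _) (ler_norm k))).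
by rewrite -mulrA ler_wpM2l.
Qed.

Let bounded_star L : bounded_op L -> bounded_op (fun a : A => star (L (star a))).
Proof. by move=> [k Lk]; exists k => a; rewrite rnorm_star -(rnorm_star a). Qed.

Let bounded_zero : bounded_op (fun _ : A => 0 : A).
Proof. by exists 0 => a; rewrite rnorm0 mul0r. Qed.

Let zero_rl a b : 0 ** b = a ** 0 :> A.
Proof. by rewrite cmul0l cmul0r. Qed.

Let add_rl m n a b :
  (rmul m a + rmul n a) ** b = a ** (lmul m b + lmul n b).
Proof. by rewrite cmulDl cmulDr !rmul_lmul. Qed.

Let scale_rl (k : R[i]) m a b : (k *: rmul m a) ** b = a ** (k *: lmul m b).
Proof. by rewrite cmulZl cmulZr rmul_lmul. Qed.

Let mul_rl m n a b : rmul n (rmul m a) ** b = a ** lmul m (lmul n b).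
Proof. by rewrite !rmul_lmul. Qed.

Let star_rl m a b : star (lmul m (star a)) ** b = a ** star (rmul m (star b)).
Proof. by rewrite -{1}(starK b) -starM -rmul_lmul starM starK. Qed.

Definition multiplier_zero : M := mkMultiplier bounded_zero bounded_zero zero_rl.
Definition multiplier_add m n : M :=
  mkMultiplier (bounded_add (lmul_bounded m) (lmul_bounded n))
    (bounded_add (rmul_bounded m) (rmul_bounded n)) (add_rl m n).
Definition multiplier_scale (k : R[i]) m : M :=
  mkMultiplier (bounded_scale k (lmul_bounded m))
    (bounded_scale k (rmul_bounded m)) (scale_rl k m).
Definition multiplier_opp m : M := multiplier_scale (-1) m.
Definition multiplier_mul m n : M :=
  mkMultiplier (bounded_comp (lmul_bounded m) (lmul_bounded n))
    (bounded_comp (rmul_bounded n) (rmul_bounded m)) (mul_rl m n).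
Definition multiplier_star m : M :=
  mkMultiplier (bounded_star (rmul_bounded m)) (bounded_star (lmul_bounded m))
    (star_rl m).
Definition multiplier_norm m : R[i] := (opnorm (lmul m))%:C.

HB.instance Definition _ := gen_eqMixin M.
HB.instance Definition _ := gen_choiceMixin M.

Let addA : associative multiplier_add.
Proof. by move=> m n p; apply: multiplier_eq => a /=; rewrite addrA. Qed.
Let addC : commutative multiplier_add.
Proof. by move=> m n; apply: multiplier_eq => a /=; rewrite addrC. Qed.
Let add0 : left_id multiplier_zero multiplier_add.
Proof. by move=> m; apply: multiplier_eq => a /=; rewrite add0r. Qed.
Let addN : left_inverse multiplier_zero multiplier_opp multiplier_add.
Proof. by move=> m; apply: multiplier_eq => a /=; rewrite scaleN1r addNr. Qed.

HB.instance Definition _ := GRing.isZmodule.Build M addA addC add0 addN.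

Let scaleA (k l : R[i]) m :
  multiplier_scale k (multiplier_scale l m) = multiplier_scale (k * l) m.
Proof. by apply: multiplier_eq => a /=; rewrite scalerA. Qed.
Let scale1 : left_id 1 multiplier_scale.
Proof. by move=> m; apply: multiplier_eq => a /=; rewrite scale1r. Qed.
Let scaleDr : right_distributive multiplier_scale +%R.
Proof. by move=> k m n; apply: multiplier_eq => a /=; rewrite scalerDr. Qed.
Let scaleDl m : {morph multiplier_scale^~ m : k l / k + l}.
Proof. by move=> k l; apply: multiplier_eq => a /=; rewrite scalerDl. Qed.

HB.instance Definition _ := GRing.Zmodule_isLmodule.Build R[i] M
  scaleA scale1 scaleDr scaleDl.

Let normD m n :
  multiplier_norm (m + n) <= multiplier_norm m + multiplier_norm n.
Proof.
rewrite /multiplier_norm -rmorphD lecR; apply: opnorm_le => [|a].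
  by rewrite addr_ge0 // opnorm_ge0 //; exact: lmul_bounded.
by rewrite mulrDl (le_trans (rnormD _ _)) // lerD // lmulP.
Qed.

Let normZ (k : R[i]) m : multiplier_norm (k *: m) = `|k| * multiplier_norm m.
Proof.
have nk (l : R[i]) : `|l| = (complex.Re `|l|)%:C by rewrite normc_def.
have nk0 (l : R[i]) : 0 <= complex.Re `|l| by rewrite normc_def sqrtr_ge0.
have le (l : R[i]) n :
    opnorm (lmul (l *: n)) <= complex.Re `|l| * opnorm (lmul n).
  apply: opnorm_le => [|a].
    by rewrite mulr_ge0 // opnorm_ge0 //; exact: lmul_bounded.
  by rewrite /= rnormZ -mulrA ler_wpM2l // lmulP.
rewrite nk /multiplier_norm -rmorphM; congr (_%:C).
apply/eqP; rewrite eq_le le andTb.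
have [->|k0] := eqVneq k 0.
  rewrite normr0 mul0r.
  by rewrite opnorm_ge0 //; exact: lmul_bounded.
have := le k^-1 (k *: m); rewrite scalerA mulVf // scale1r => /(ler_wpM2l (nk0 k)).
move=> /le_trans; apply.
rewrite mulrA (_ : _ * complex.Re _ = 1) ?mul1r //.
have : `|k| * `|k^-1| = 1 by rewrite -normrM mulfV // normr1.
by rewrite (nk k) (nk k^-1) -rmorphM => /(congr1 (@complex.Re R)).
Qed.

Let norm0_eq0 m : multiplier_norm m = 0 -> m = 0.
Proof.
move=> [m0]; apply: multiplier_eq => a; apply: rnorm_eq0; apply/eqP.
by rewrite eq_le rnorm_ge0 andbT (le_trans (lmulP m a)) // m0 mul0r.
Qed.

HB.instance Definition _ := Lmodule_isNormed.Build R[i] M normD normZ norm0_eq0.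

End multiplier_algebra.

Section multiplier_complete.
Variables (R : realType) (A : cstarAlgType R).
Local Notation M := (multiplier A).
Implicit Types (m n : M) (a b : A).

Lemma multiplier_normE m : rnorm m = opnorm (lmul m).
Proof. by []. Qed.

Let lmul_near m n a e : `|m - n| < e%:C -> rnorm (lmul m a - lmul n a) <= e * rnorm a.
Proof.
rewrite rnormE ltcR => /ltW mn.
have := lmulP (m - n) a; rewrite /= scaleN1r => /le_trans; apply.
by rewrite ler_wpM2r ?rnorm_ge0.
Qed.

Let rmul_near m n a e : `|m - n| < e%:C -> rnorm (rmul m a - rmul n a) <= e * rnorm a.
Proof.
rewrite rnormE ltcR => /ltW mn.
have := rmulP (m - n) a; rewrite opnorm_rmul /= scaleN1r => /le_trans; apply.
by rewrite ler_wpM2r ?rnorm_ge0.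
Qed.

Let posC (e : R[i]) : 0 < e -> exists2 r : R, 0 < r & e = r%:C.
Proof.
by case: e => r s; rewrite ltcE /= => /andP[/eqP -> r0]; exists r.
Qed.

Let le_cvg (F : set_system M) (f : M -> A) (l x : A) (k : R) :
  ProperFilter F -> f @ F --> l ->
  (\forall m \near F, rnorm (f m - x) <= k) -> rnorm (l - x) <= k.
Proof.
move=> FF fl Fk; apply/ler_addgt0Pr => e e0.
have eC : 0 < e%:C by rewrite ltcR.
have /cvgrPdist_lt/(_ _ eC) fe := fl.
near F => m.
have h1 : rnorm (f m - x) <= k by near: m.
have h2 : rnorm (l - f m) < e by rewrite -ltcR -rnormE; near: m.
rewrite -(subrKA (f m)) (le_trans (rnormD _ _)) // [leRHS]addrC.
by rewrite lerD // ltW.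
Unshelve. all: by end_near. Qed.

Let complete (F : set_system M) : ProperFilter F -> cauchy F -> cvg F.
Proof.
move=> FF /cauchyP Fc.
have Fc' (e : R) : 0 < e -> exists m, F [set n | `|m - n| < e%:C].
  move=> e0; have eC : 0 < e%:C by rewrite ltcR.
  by have [m Fm] := Fc _ eC; exists m; rewrite -ball_normE in Fm.
have pw (f : M -> A) (k : R) : 0 <= k ->
    (forall m n e, `|m - n| < e%:C -> rnorm (f m - f n) <= e * k) ->
    exists l : A, f @ F --> l.
  move=> k0 fk; suff /cvg_ex : cvg (f @ F) by [].
  apply/cauchy_cvgP/cauchyP => _ /posC[e e0 ->].
  have [|m Fm] := Fc' (e / (k + 1)); first by rewrite divr_gt0 // ltr_wpDl.
  exists (f m); rewrite nbhs_simpl /=.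
  apply: (@filterS _ F _ _ _ _ Fm) => n /= /fk fmn.
  rewrite -ball_normE /= rnormE ltcR; apply: le_lt_trans fmn _.
  by rewrite mulrAC ltr_pdivrMr ?ltr_wpDl // ltr_pM2l // ltrDl.
have /choice[L FL] a : exists l : A, (fun m => lmul m a) @ F --> l.
  apply: (pw _ (rnorm a)) => [|m n e]; first exact: rnorm_ge0.
  exact: lmul_near.
have /choice[S FS] a : exists l : A, (fun m => rmul m a) @ F --> l.
  apply: (pw _ (rnorm a)) => [|m n e]; first exact: rnorm_ge0.
  exact: rmul_near.
have Lnear m e a : (\forall n \near F, `|m - n| < e%:C) ->
    rnorm (L a - lmul m a) <= e * rnorm a.
  move=> Fm; apply: le_cvg (FL a) _; apply: filterS Fm => n.
  by rewrite distrC; exact: lmul_near.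
have Snear m e a : (\forall n \near F, `|m - n| < e%:C) ->
    rnorm (S a - rmul m a) <= e * rnorm a.
  move=> Fm; apply: le_cvg (FS a) _; apply: filterS Fm => n.
  by rewrite distrC; exact: rmul_near.
have [m1 Fm1] := Fc' 1 ltr01.
have bL : bounded_op L.
  exists (1 + opnorm (lmul m1)) => a.
  rewrite -(subrK (lmul m1 a) (L a)) mulrDl (le_trans (rnormD _ _)) // lerD //.
    exact: Lnear.
  exact: lmulP.
have bS : bounded_op S.
  exists (1 + opnorm (rmul m1)) => a.
  rewrite -(subrK (rmul m1 a) (S a)) mulrDl (le_trans (rnormD _ _)) // lerD //.
    exact: Snear.
  exact: rmulP.
have SL a b : S a ** b = a ** L b.
  apply/eqP; rewrite -subr_eq0; apply/eqP/rnorm_eq0/eqP.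
  rewrite eq_le rnorm_ge0 andbT; apply/ler_addgt0Pr => e e0; rewrite add0r.
  pose k := rnorm a * rnorm b * 2 + 1.
  have k0 : 0 < k by rewrite ltr_wpDl // !mulr_ge0 ?rnorm_ge0.
  have [|m Fm] := Fc' (e / k); first by rewrite divr_gt0.
  rewrite -(subrKA (rmul m a ** b)) {2}rmul_lmul -cmulBl -cmulBr.
  apply: (le_trans (rnormD _ _)).
  apply: (le_trans (lerD (rnormM _ _) (rnormM _ _))).
  rewrite -(opprB (L b)) rnormN.
  apply: (@le_trans _ _ (e / k * rnorm a * rnorm b + rnorm a * (e / k * rnorm b))).
    apply: lerD; first by rewrite ler_wpM2r ?rnorm_ge0 // Snear.
    by rewrite ler_wpM2l ?rnorm_ge0 // Lnear.
  rewrite (_ : _ + _ = e / k * (rnorm a * rnorm b * 2)).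
    by rewrite mulrAC ler_pdivrMr // ler_wpM2l ?(ltW e0) // lerDl.
  by rewrite mulr_natr mulr2n mulrDr -mulrA; congr (_ + _); rewrite mulrCA.
apply/cvg_ex; exists (mkMultiplier bL bS SL).
apply/cvgrPdist_le => _ /posC[e e0 ->].
have [|m Fm] := Fc' (e / 2); first by rewrite divr_gt0.
near=> n.
rewrite rnormE lecR; apply: opnorm_le => [|a]; first exact: ltW.
rewrite /= scaleN1r -(subrKA (lmul m a)) (le_trans (rnormD _ _)) //.
rewrite (splitr e) mulrDl lerD //; first exact: Lnear.
by apply: lmul_near; near: n.
Unshelve. all: by end_near. Qed.

HB.instance Definition _ := Uniform_isComplete.Build M complete.

Let mulA : associative (@multiplier_mul R A).
Proof. by move=> m n p; exact: multiplier_eq. Qed.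
Let mulPl (k : R[i]) m n p :
  multiplier_mul (k *: m + n) p = k *: multiplier_mul m p + multiplier_mul n p.
Proof. exact: multiplier_eq. Qed.
Let mulPr (k : R[i]) m n p :
  multiplier_mul p (k *: m + n) = k *: multiplier_mul p m + multiplier_mul p n.
Proof. by apply: multiplier_eq => a /=; rewrite lmul_linear. Qed.
Let starP' (k : R[i]) m n :
  multiplier_star (k *: m + n) = k^* *: multiplier_star m + multiplier_star n.
Proof. by apply: multiplier_eq => a /=; rewrite starP. Qed.
Let starM' m n : multiplier_star (multiplier_mul m n) =
  multiplier_mul (multiplier_star n) (multiplier_star m).
Proof. by apply: multiplier_eq => a /=; rewrite starK. Qed.
Let starK' m : multiplier_star (multiplier_star m) = m.
Proof. by apply: multiplier_eq => a /=; rewrite !starK. Qed.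
Let normM m n : `|multiplier_mul m n| <= `|m| * `|n|.
Proof.
rewrite !rnormE -rmorphM lecR; apply: opnorm_le => [|a].
  by rewrite mulr_ge0 ?rnorm_ge0.
by rewrite -mulrA (le_trans (lmulP m (lmul n a))) //; exact: ler_wpM2l (rnorm_ge0 m) _ _ (lmulP n a).
Qed.
Let norm_star m : rnorm (multiplier_star m) = rnorm m.
Proof.
have le n : rnorm (multiplier_star n) <= rnorm n.
  apply: opnorm_le => [|a]; first exact: rnorm_ge0.
  by rewrite /= rnorm_star -(rnorm_star a) multiplier_normE -opnorm_rmul rmulP.
by apply/eqP; rewrite eq_le le -{1}(starK' m) le.
Qed.
Let cstarE m : `|multiplier_mul (multiplier_star m) m| = `|m| ^+ 2.
Proof.
apply/eqP; rewrite eq_le; apply/andP; split.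
  by rewrite (le_trans (normM _ _)) // [X in X * _]rnormE norm_star -rnormE expr2.
set n := multiplier_mul _ _.
have n0 : 0 <= rnorm n := rnorm_ge0 n.
rewrite !rnormE -rmorphXn lecR -[leRHS]sqr_sqrtr // ler_pXn2r ?nnegrE ?rnorm_ge0 ?sqrtr_ge0 //.
apply: opnorm_le => [|a]; first exact: sqrtr_ge0.
rewrite -(@ler_pXn2r _ 2) ?nnegrE ?mulr_ge0 ?rnorm_ge0 ?sqrtr_ge0 //.
rewrite exprMn sqr_sqrtr // -rnorm_star_mul.
have -> : star (lmul m a) ** lmul m a = star a ** lmul n a.
  by rewrite -[RHS]rmul_lmul /= starK rmul_lmul.
apply: (le_trans (rnormM _ _)); rewrite rnorm_star expr2 mulrA [leRHS]mulrC.
by rewrite ler_wpM2l ?rnorm_ge0 //; exact: lmulP.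
Qed.

HB.instance Definition _ := isCStarAlgebra.Build R M
  mulA mulPl mulPr starP' starM' starK' normM cstarE.

End multiplier_complete.

Section embedding.
Variables (R : realType) (A : cstarAlgType R).
Implicit Types (m : multiplier A) (a b : A).

Let bounded_l a : bounded_op (fun b => a ** b).
Proof. by exists (rnorm a) => b; exact: rnormM. Qed.

Let bounded_r a : bounded_op (fun b => b ** a).
Proof. by exists (rnorm a) => b; rewrite mulrC; exact: rnormM. Qed.

Let assoc_rl c a b : (a ** c) ** b = a ** (c ** b).
Proof. by rewrite cmulA. Qed.

Definition to_multiplier a : multiplier A :=
  mkMultiplier (bounded_l a) (bounded_r a) (assoc_rl a).

Lemma multiplier_mull m a : m ** to_multiplier a = to_multiplier (lmul m a).
Proof. by apply: multiplier_eq => b /=; rewrite lmulM. Qed.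

Lemma multiplier_mulr m a : to_multiplier a ** m = to_multiplier (rmul m a).
Proof. by apply: multiplier_eq => b /=; rewrite rmul_lmul. Qed.

End embedding.

Section primitive_ideals.
Variables (R : realType) (A : cstarAlgType R).

Record representation (H : hilbertType R) (pi : A -> H -> H) : Prop := {
  rep_linear : forall a, linear (pi a);
  rep_continuous : forall a, continuous (pi a);
  rep_linear_alg : forall (k : R[i]) a b x,
    pi (k *: a + b) x = k *: pi a x + pi b x;
  rep_mul : forall a b x, pi (a ** b) x = pi a (pi b x);
  rep_star : forall a x y, ip (pi a x) y = ip x (pi (star a) y)
}.

Definition invariant_subspace (H : hilbertType R) (pi : A -> H -> H)
    (W : set H) :=
  [/\ W 0, forall (k : R[i]) x y, W x -> W y -> W (k *: x + y)
    & forall a x, W x -> W (pi a x)].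

Definition irreducible_rep (H : hilbertType R) (pi : A -> H -> H) :=
  [/\ representation pi, exists a x, pi a x != 0
    & forall W : set H, closed W -> invariant_subspace pi W ->
        W = [set 0] \/ W = setT].

Definition primitive (P : set A) := exists (H : hilbertType R) (pi : A -> H -> H),
  irreducible_rep pi /\ P = [set a | forall x, pi a x = 0].

Record prim := Prim { prim_set :> set A; prim_primitive : primitive prim_set }.

HB.instance Definition _ := gen_eqMixin prim.
HB.instance Definition _ := gen_choiceMixin prim.

Definition ker (V : set prim) : set A := \bigcap_(P in V) prim_set P.

(* Hull-kernel topology: F is closed when it contains every primitive ideal P
   such that ker F `<=` P. *)
Definition hk_open (U : set prim) :=
  forall P : prim, ker (~` U) `<=` prim_set P -> (~` U) P.

Implicit Types P : prim.

Let prim_neqT P : exists a, ~ prim_set P a.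
Proof.
case: P => P /= [H [pi [[rpi [a [x pax]] _] ->]]].
by exists a => /= /(_ x) /eqP; apply/negP.
Qed.

Let prim_mulr P a b : prim_set P a -> prim_set P (a ** b).
Proof.
case: P => P /= [H [pi [[rpi _ _] ->]]] Pa x.
by rewrite (rep_mul rpi) Pa.
Qed.

Let rep0 (H : hilbertType R) (pi : A -> H -> H) a :
  representation pi -> pi a 0 = 0.
Proof.
move=> rpi; have := rep_linear rpi a (-1) 0 0.
by rewrite !scaleN1r oppr0 addr0 addNr.
Qed.

Let prim_mull P a b : prim_set P b -> prim_set P (a ** b).
Proof.
case: P => P /= [H [pi [[rpi _ _] ->]]] Pb x.
by rewrite (rep_mul rpi) Pb rep0.
Qed.

Let ip0 (H : hilbertType R) (x : H) : ip x 0 = 0.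
Proof.
rewrite ipC; have := ipPl (-1) (0 : H) 0 x.
by rewrite scaleN1r oppr0 addr0 mulN1r addNr => ->; rewrite rmorph0.
Qed.

Let rep_starI (H : hilbertType R) (pi : A -> H -> H) a : representation pi ->
  (forall x, pi (star a) (pi a x) = 0) -> forall x, pi a x = 0.
Proof.
move=> rpi aa x; apply/eqP; rewrite -normr_eq0 -sqrf_eq0 -ip_norm.
by rewrite (rep_star rpi) aa ip0.
Qed.

Let prim_prime P a b :
  (forall c, prim_set P (a ** c ** b)) -> prim_set P a \/ prim_set P b.
Proof.
case: P => P /= [H [pi [[rpi _ irr] ->]]] ab.
pose W := \bigcap_(c in [set: A]) (pi (a ** c) @^-1` [set 0]).
have Wcl : closed W.
  apply: closed_bigI => c _; apply: closed_comp.
    by move=> x _; exact: rep_continuous.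
  by apply: accessible_closed_set1; exact/hausdorff_accessible/norm_hausdorff.
have Winv : invariant_subspace pi W.
  split=> [c _|k x y Wx Wy c _|d x Wx c _] /=; first exact: rep0.
    by rewrite (rep_linear rpi) (Wx c I) (Wy c I) scaler0 addr0.
  by rewrite -(rep_mul rpi) -cmulA; exact: (Wx (c ** d) I).
have [W0|WT] := irr W Wcl Winv; last first.
  left; apply: (rep_starI rpi) => y.
  suff h x : pi (star a) x = 0 by rewrite h.
  apply: (rep_starI rpi) x => x; rewrite starK -(rep_mul rpi).
  have Wx : W x by rewrite WT.
  exact: (Wx (star a) I).
right=> x; suff : W (pi b x) by rewrite W0.

by move=> c _ /=; rewrite -(rep_mul rpi); exact: ab.
Qed.

Let hk_openT : hk_open setT.
Proof.
move=> P; rewrite setCT /ker bigcap_set0 => AP.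
by have [a] := prim_neqT P; case; exact: AP.
Qed.

Let not_sub (S : set A) P : ~ (S `<=` prim_set P) -> exists2 a, S a & ~ prim_set P a.
Proof.
move=> SP; apply: contrapT => nex; apply: SP => a Sa.
by apply: contrapT => nPa; apply: nex; exists a.
Qed.

Let hk_openI : setI_closed hk_open.
Proof.
move=> U V oU oV P UV [UP VP].
have [a aU aP] := not_sub (fun h => oU P h UP).
have [b bV bP] := not_sub (fun h => oV P h VP).
suff ab : prim_set P a \/ prim_set P b by case: ab.
apply: prim_prime => c; apply: UV => Q; rewrite setCI => -[nU|nV].
  by do 2 apply: prim_mulr; exact: aU nU.
by apply: prim_mull; exact: bV.
Qed.

Let hk_open_bigU (I : Type) (f : I -> set prim) :
  (forall i, hk_open (f i)) -> hk_open (\bigcup_i f i).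
Proof.
move=> of_ P fP [i _ fiP]; apply: (of_ i P) fiP => a ai; apply: fP => Q nQ.
by apply: ai => fiQ; apply: nQ; exists i.
Qed.

HB.instance Definition _ :=
  isOpenTopological.Build prim hk_openT hk_openI hk_open_bigU.

Lemma prim_closedE (F : set prim) :
  closed F <-> forall P, ker F `<=` prim_set P -> F P.
Proof.
rewrite -openC -{2 3}(setCK F); exact: iff_refl.
Qed.

End primitive_ideals.
Section definitions.
Context {R : realType} {A : cstarAlgType R}.
Implicit Types (a b e : A) (P : prim A).

Definition cpositive a := exists b, a = star b ** b.

(* A sequential, increasing approximate unit of positive contractions. *)
Definition approximate_unit (u : nat -> A) :=
  [/\ forall n, cpositive (u n) /\ `|u n| <= 1,
      forall n, cpositive (u n.+1 - u n),
      forall a, u n ** a @[n --> \oo] --> a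
    & forall a, a ** u n @[n --> \oo] --> a].

Definition tilde (J : set A) : set (multiplier A) :=
  [set m | forall a, J (lmul m a) /\ J (rmul m a)].

(* The norm of the class of a in the quotient by I. *)
Definition quotient_norm (I : set A) a : R := inf [set rnorm (a + b) | b in I].

(* The quotient of A by I has the class of e as a unit. *)
Definition quotient_unital (I : set A) :=
  exists e, forall a, I (e ** a - a) /\ I (a ** e - a).

(* The strict topology is the initial topology for the maps m |-> m a and
   m |-> a m into A with its norm topology, a ranging over A. *)
Definition strict_map (m : multiplier A) :
    prod_topology (fun _ : A => (A * A)%type) :=
  fun a => (lmul m a, rmul m a).

Definition strictly_closed (S : set (multiplier A)) :=
  @closed (initial_topology strict_map) S.

(* J_y for f the base map of A, H_y for f its extension to prim (multiplier A). *)
Definition fiber_ideal (Y : topologicalType) (f : prim A -> Y) (y : Y) : set A :=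
  ker (f @^-1` [set y]).

(* The relatively open neighbourhoods of P in the complement of H° are the sets
   W `\` H° with W open and P in W. *)
Definition locally_modular (X : topologicalType) (phi : prim A -> X) (x : X) :=
  let H := phi @^-1` [set x] in
  forall P, (closure H `\` H°) P ->
    exists W : set (prim A),
      [/\ open W, W P & quotient_unital (ker (W `\` H°))].

End definitions.

Definition sigma_unital (R : realType) (A : cstarAlgType R) :=
  exists u : nat -> A, approximate_unit u.

Section stone_cech.
Variables (R : realType) (X : topologicalType).

Definition unit_function := {f : X -> R | continuous f /\ forall x, 0 <= f x <= 1}.

Definition evaluation (x : X) : prod_topology (fun _ : unit_function => R) :=
  fun f => sval f x.

(* The closure of the image of X in the cube indexed by C(X, [0, 1]). *)
Definition stone_cech : topologicalType := set_type (closure (range evaluation)).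

Definition to_stone_cech (x : X) : stone_cech :=
  SigSub (mem_set (@subset_closure _ (range evaluation) _ (imageT evaluation x))).

(* Zero sets of the subspace S of X; h matters only on S. *)
Definition zero_set (S Z : set X) :=
  exists2 h : X -> R, {within S, continuous h} & Z = S `&` h @^-1` [set 0].

End stone_cech.

(* tilde P is primitive for every primitive P, so the second condition fixes
   phibar on the dense subset of the ideals tilde P. *)
Definition base_map_extension (R : realType) (A : cstarAlgType R)
    (X : topologicalType) (phi : prim A -> X)
    (phibar : prim (multiplier A) -> stone_cech R X) :=
  continuous phibar /\
  forall (P : prim A) (Q : prim (multiplier A)),
    prim_set Q = tilde (prim_set P) -> phibar Q = to_stone_cech R (phi P).

(* Main.v *)
(* Fix a boundary point P of the fibre over x near which the quotients have no
   unit, and an approximate unit u. In every neighbourhood of P and for every k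
   there is Q with phi Q <> x at which u k does not act as a unit, so a positive
   contraction e living near the fibre of phi Q produces an element
   c = (e (1 - u k))^* (e (1 - u k)) / 16 of definite norm at Q that is small on
   any prescribed elements if k is large. Iterating over shrinking neighbourhoods of x
   gives almost orthogonal elements c n, whose partial sums are bounded and
   converge strictly to a multiplier c, and ideals Q n with ||c + ~Q n|| bounded
   below.

   The Q n all lie in a set of primitive ideals on which a fixed element is
   bounded away from zero, so they have a cluster point Qoo; put y = phi Qoo,
   which lies in Z since the zero set was built into the neighbourhoods. Each c n
   lives over an open set that misses y, so c lies in ~J_y, while every
   neighbourhood of Qoo contains some Q n. The same cluster argument in M(A) gives
   a primitive ideal over y that does not contain c; as the c (u k) lie in H_y and
   converge strictly to c, H_y is not strictly closed.

   Cluster points come from states: an extreme point of the set of limits of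
   vector states is pure, and the kernel of its GNS representation is the required
   primitive ideal. *)
Require Import Defs.
From HB Require Import structures.
From mathcomp Require Import all_boot all_order all_algebra.
From mathcomp Require Import all_classical.
From mathcomp Require Import reals topology normedtype sequences.
From mathcomp.real_closed Require Import complex.
From mathcomp Require Import ring lra.

Set Implicit Arguments.
Unset Strict Implicit.
Unset Printing Implicit Defensive.
Import Order.TTheory GRing.Theory Num.Theory.
Import numFieldNormedType.Exports.
Local Open Scope classical_set_scope.
Local Open Scope complex_scope.
Local Open Scope ring_scope.

(** * Complex numbers and norms *)

(** A norm modulo an ideal does not pass to an arbitrary limit of ideals. Lower bounds are therefore
    carried by a vector [v] with [eps |v|^2 <= Re <b v, v>] in some representation: such a bound
    survives limits of vector states and bounds the quotient norm from below. No spectral theory is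
    used. One power series, for 1 - sqrt (1 - h), yields contractivity of representations and
    piecewise linear cutoffs G and F of w^2, w = u k, which replace spectral projections at the
    level 1/2. On the range of G one has w^2 >= 1/2 as a form; this is the element bounded away from
    zero that produces cluster points. On the range of 2 - F one has w^2 <= 1/2, so 1 - w keeps a
    definite norm there. If 2 - F vanished at all relevant ideals near P, then F/2 would be a unit
    of the quotient: this is where the failure of local modularity enters. The c n are only almost
    orthogonal, so the norms of their sums are controlled by repeated squaring with summable
    errors. *)

Section zmodule_reflection.
Variable V : zmodType.

Inductive zexp := ZVar of nat | ZZero | ZOpp of zexp | ZAdd of zexp & zexp.

Fixpoint zeval (e : seq V) t : V :=
  match t with
  | ZVar i => e`_i
  | ZZero => 0
  | ZOpp s => - zeval e s
  | ZAdd s s' => zeval e s + zeval e s'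
  end.

Fixpoint zcoef t (i : nat) : int :=
  match t with
  | ZVar j => (i == j)%:Z
  | ZZero => 0
  | ZOpp s => - zcoef s i
  | ZAdd s s' => zcoef s i + zcoef s' i
  end.

Fixpoint zbounded n t :=
  match t with
  | ZVar j => (j < n)%N
  | ZZero => true
  | ZOpp s => zbounded n s
  | ZAdd s s' => zbounded n s && zbounded n s'
  end.

Lemma zevalE e t : zbounded (size e) t ->
  zeval e t = \sum_(i < size e) e`_i *~ zcoef t i.
Proof.
elim: t => [j|_|s IH|s IH s' IH'] /=.
- move=> je; rewrite (bigD1 (Ordinal je)) //= eqxx mulr1z big1 ?addr0 //.
  by move=> i; rewrite -val_eqE /= => /negbTE ->; rewrite mulr0z.
- by rewrite big1 // => i _; rewrite mulr0z.
- by move=> /IH ->; rewrite -sumrN; apply: eq_bigr => i _; rewrite mulrNz.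
move=> /andP[/IH -> /IH' ->]; rewrite -big_split.
by apply: eq_bigr => i _; rewrite mulrzDr.
Qed.

Lemma zeval_eq e t t' :
  [&& zbounded (size e) t, zbounded (size e) t'
    & all (fun i => zcoef t i == zcoef t' i) (iota 0 (size e))] ->
  zeval e t = zeval e t'.
Proof.
move=> /and3P[te t'e /allP tt']; rewrite !zevalE //; apply: eq_bigr => i _.
by congr (_ *~ _); apply/eqP/tt'; rewrite mem_iota /=.
Qed.

End zmodule_reflection.

(** Atoms are compared up to unification, so that convertible forms of one term share an index. *)
Ltac zatom_index x l :=
  match l with
  | ?y :: _ =>
    let _ := match goal with _ => first [constr_eq x y | unify x y] end in
    constr:(0%N)
  | _ :: ?l' => let n := zatom_index x l' in constr:(n.+1)
  end.

Ltac zatoms t l :=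
  match t with
  | ?a + ?b => let l' := zatoms a l in zatoms b l'
  | - ?a => zatoms a l
  | 0 => l
  | ?x => match l with
          | _ => let n := zatom_index x l in l
          | _ => constr:(x :: l)
          end
  end.

Ltac zreify t l :=
  match t with
  | ?a + ?b => let a' := zreify a l in let b' := zreify b l in constr:(ZAdd a' b')
  | - ?a => let a' := zreify a l in constr:(ZOpp a')
  | 0 => constr:(ZZero)
  | ?x => let n := zatom_index x l in constr:(ZVar n)
  end.

(* Decides equalities of sums and differences in an abelian group. *)
Ltac zmodule :=
  match goal with
  | |- @eq ?T ?a ?b =>
    let l := zatoms a (@nil T) in let l' := zatoms b l in
    let ta := zreify a l' in let tb := zreify b l' in
    refine (@zeval_eq _ l' ta tb _); vm_compute; reflexivity
  end.

Section complex_numbers.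
Context {R : realType}.
Implicit Types (z w : R[i]) (r : R).

Definition cre z : R := complex.Re z.

Lemma creD z w : cre (z + w) = cre z + cre w.
Proof. by case: z w => [a b] [c d]. Qed.

Lemma creN z : cre (- z) = - cre z.
Proof. by case: z. Qed.

Lemma creB z w : cre (z - w) = cre z - cre w.
Proof. by rewrite creD creN. Qed.

Lemma cre_conj z : cre z^* = cre z.
Proof. by case: z. Qed.

Lemma creZ r z : cre (r%:C * z) = r * cre z.
Proof. by case: z => a b; rewrite /cre /= mul0r subr0. Qed.

Lemma creR r : cre r%:C = r.
Proof. by []. Qed.

Lemma cre0 : cre 0 = 0.
Proof. by []. Qed.

Lemma conjcR r : (r%:C : R[i])^* = r%:C.
Proof. by apply/eqP; rewrite eq_complex /= oppr0 !eqxx. Qed.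

Lemma conjcD z w : (z + w)^* = z^* + w^*.
Proof. exact: rmorphD. Qed.

Lemma conjcM z w : (z * w)^* = z^* * w^*.
Proof. exact: rmorphM. Qed.

Lemma conjcN z : (- z)^* = - z^*.
Proof. exact: rmorphN. Qed.

Lemma conjcKK z : (z^*)^* = z.
Proof. by case: z => a b; apply/eqP; rewrite eq_complex /= opprK !eqxx. Qed.

Lemma gt0_realC (e : R[i]) : 0 < e -> exists2 r : R, 0 < r & e = r%:C.
Proof.
by case: e => r s; rewrite ltcE /= => /andP[/eqP -> r0]; exists r.
Qed.

Lemma conjc_mul_norm z : z^* * z = (cre `|z| ^+ 2)%:C.
Proof.
case: z => a b; rewrite /cre normc_def /= sqr_sqrtr ?addr_ge0 ?sqr_ge0 //.
by apply/eqP; rewrite eq_complex /=; apply/andP; split; apply/eqP; ring.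
Qed.

Lemma cre_le_norm z : cre z <= cre `|z|.
Proof.
case: z => a b; rewrite /cre normc_def /=; apply: (le_trans (ler_norm a)).
by rewrite -sqrtr_sqr ler_sqrt ?lerDl ?addr_ge0 ?sqr_ge0.
Qed.

Lemma cre_norm_ge0 z : 0 <= cre `|z|.
Proof. by rewrite /cre normc_def sqrtr_ge0. Qed.

Lemma cre_normE z : `|z| = (cre `|z|)%:C.
Proof. by rewrite normc_def. Qed.

Lemma cre_norm_eq0 z : cre `|z| = 0 -> z = 0.
Proof. by move=> z0; apply/eqP; rewrite -normr_eq0 cre_normE z0. Qed.

Lemma cre_normM z w : cre `|z * w| = cre `|z| * cre `|w|.
Proof. by rewrite normrM cre_normE (cre_normE w) -rmorphM. Qed.

Lemma cre_normD z w : cre `|z + w| <= cre `|z| + cre `|w|.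
Proof.
by have := ler_normD z w; rewrite (cre_normE (z + w)) cre_normE (cre_normE w) -rmorphD lecR.
Qed.

Lemma cre_normN z : cre `|- z| = cre `|z|.
Proof. by rewrite normrN. Qed.

Lemma cre_normJ z : cre `|z^*| = cre `|z|.
Proof. by rewrite /cre !normc_def; case: z => a b /=; rewrite sqrrN. Qed.

Lemma cre_norm_real (r : R) : cre `|(r%:C : R[i])| = `|r|.
Proof. by rewrite /cre normc_def /= expr0n /= addr0 sqrtr_sqr. Qed.

(** The imaginary part of [z] is minus the real part of ['i * z], so identities between complex
    forms reduce to real functionals. *)
Lemma eqc_re z w : cre z = cre w -> cre ('i * z) = cre ('i * w) -> z = w.
Proof.
case: z w => [a b] [c d]; rewrite /cre /= => ->.
by rewrite !mul0r !mul1r !add0r => /oppr_inj ->.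
Qed.

End complex_numbers.

Section real_norm_topology.
Context {R : realType}.
Implicit Types V W : normedModType R[i].

Lemma rnormZr V (r : R) (x : V) : rnorm (r%:C *: x) = `|r| * rnorm x.
Proof. by rewrite rnormZ normc_def /= expr0n /= addr0 sqrtr_sqr. Qed.

Lemma rnormB V (x y : V) : rnorm (x - y) <= rnorm x + rnorm y.
Proof. by rewrite (le_trans (rnormD _ _)) // rnormN. Qed.

Lemma rnormBC V (x y : V) : rnorm (x - y) = rnorm (y - x).
Proof. by rewrite -rnormN opprB. Qed.

Lemma rnorm_gt0 V (x : V) : x != 0 -> 0 < rnorm x.
Proof.
by move=> x0; rewrite lt_def rnorm_ge0 andbT; apply: contra_neq x0 => /rnorm_eq0.
Qed.

Lemma rnorm_le0 V (x : V) : (forall e : R, 0 < e -> rnorm x <= e) -> x = 0.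
Proof.
move=> xe; apply: rnorm_eq0; apply/eqP; rewrite eq_le rnorm_ge0 andbT.
by apply/ler_addgt0Pr => e /xe; rewrite add0r.
Qed.

Lemma cvg_rnormP V T (F : set_system T) (FF : Filter F) (f : T -> V) (l : V) :
  f @ F --> l <-> forall e : R, 0 < e -> \forall t \near F, rnorm (l - f t) < e.
Proof.
split=> [/cvgrPdist_lt fl e e0|fl].
  have eC : 0 < e%:C by rewrite ltcR.
  by apply: filterS (fl _ eC) => t; rewrite rnormE ltcR.
apply/cvgrPdist_lt => _ /gt0_realC[e e0 ->].
by apply: filterS (fl _ e0) => t; rewrite rnormE ltcR.
Qed.

Lemma cvgn_rnormP V (u : nat -> V) (l : V) :
  u @ \oo --> l <->
  forall e : R, 0 < e -> exists N, forall n, (N <= n)%N -> rnorm (l - u n) < e.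
Proof.
split=> [/cvg_rnormP ul e /ul[N _ Nn]|ul]; first by exists N.
by apply/cvg_rnormP => e /ul[N Nn]; exists N.
Qed.

Lemma closed_rnormP V (W : set V) : closed W <->
  forall x, (forall e : R, 0 < e -> exists2 w, W w & rnorm (x - w) < e) -> W x.
Proof.
split=> [Wcl x xW|xW].
  apply: Wcl => U /nbhs_normP[_ /= /gt0_realC[e e0 ->] eU].
  have [w Ww xw] := xW e e0; exists w; split => //; apply: eU => /=.
  by rewrite rnormE ltcR.
move=> x xcl; apply: xW => e e0.
have eC : 0 < e%:C by rewrite ltcR.
have [|w [Ww xw]] := xcl (ball_ Num.norm x e%:C); first by apply/nbhs_normP; exists e%:C.
by exists w => //; move: xw; rewrite /ball_ /= rnormE ltcR.
Qed.

Lemma continuous_rnormP V W (f : V -> W) : continuous f <->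
  forall x (e : R), 0 < e ->
    exists2 d : R, 0 < d & forall y, rnorm (x - y) < d -> rnorm (f x - f y) < e.
Proof.
split=> [cf x e e0|cf x].
  have /cvg_rnormP/(_ e e0) := cf x.
  move=> /nbhs_normP[_ /= /gt0_realC[d d0 ->] dU]; exists d => // y xy.
  by apply: dU => /=; rewrite rnormE ltcR.
apply/cvg_rnormP => e e0; have [d d0 dU] := cf x e e0.
apply/nbhs_normP; exists d%:C => /=; first by rewrite ltcR.
by move=> y /=; rewrite rnormE ltcR; exact: dU.
Qed.

Lemma lin0 V W (f : V -> W) : linear f -> f 0 = 0.
Proof. by move=> lf; have := lf (-1) 0 0; rewrite !scaleN1r oppr0 addr0 addNr. Qed.

Lemma linB V W (f : V -> W) x y : linear f -> f (x - y) = f x - f y.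
Proof. by move=> lf; have := lf (-1) y x; rewrite !scaleN1r ![- _ + _]addrC. Qed.

Lemma linD V W (f : V -> W) x y : linear f -> f (x + y) = f x + f y.
Proof. by move=> lf; have := lf 1 x y; rewrite !scale1r. Qed.

Lemma linZ V W (f : V -> W) k x : linear f -> f (k *: x) = k *: f x.
Proof. by move=> lf; have := lf k x 0; rewrite (lin0 lf) !addr0. Qed.

Lemma bounded_continuous V W (f : V -> W) (k : R) : linear f ->
  (forall x, rnorm (f x) <= k * rnorm x) -> continuous f.
Proof.
move=> lf fk; apply/continuous_rnormP => x e e0.
have k0 : 0 < `|k| + 1 by rewrite ltr_wpDl.
exists (e / (`|k| + 1)); first by rewrite divr_gt0.
move=> y xy; rewrite -linB //; apply: le_lt_trans (fk _) _.
apply: le_lt_trans (_ : (`|k| + 1) * rnorm (x - y) < _).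
  by rewrite ler_wpM2r ?rnorm_ge0 // (le_trans (ler_norm k)) // lerDl.
by rewrite mulrC -ltr_pdivlMr.
Qed.

Lemma cauchyn_rnorm (V : completeNormedModType R[i]) (u : nat -> V) :
  (forall e : R, 0 < e -> exists N, forall n m, (N <= n)%N -> (N <= m)%N ->
    rnorm (u n - u m) < e) -> exists l : V, u @ \oo --> l.
Proof.
move=> uc; suff /cvg_ex : cvgn u by [].
apply/cauchy_cvgP/cauchyP => _ /gt0_realC[e e0 ->].
have [N Nu] := uc e e0; exists (u N); exists N => // n /= Nn.
by rewrite -ball_normE /= rnormE ltcR Nu.
Qed.

Lemma cvgn_rnorm_le V (u : nat -> V) (l x : V) (k : R) (N : nat) :
  u @ \oo --> l -> (forall n, (N <= n)%N -> rnorm (u n - x) <= k) ->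
  rnorm (l - x) <= k.
Proof.
move=> /cvgn_rnormP ul uk; apply/ler_addgt0Pr => e /ul[M Mu].
rewrite -(subrKA (u (maxn M N))) (le_trans (rnormD _ _)) // addrC lerD //.
  by rewrite uk ?leq_maxr.
by rewrite ltW // Mu ?leq_maxl.
Qed.

End real_norm_topology.

(** * Square roots and cutoffs in a C*-algebra *)

Section cstar_calculus.
Context {R : realType} {A : cstarAlgType R}.
Implicit Types a b c h k w y : A.

Lemma starN a : star (- a) = - star a.
Proof. by rewrite -scaleN1r starZ rmorphN rmorph1 scaleN1r. Qed.

Lemma starB a b : star (a - b) = star a - star b.
Proof. by rewrite starD starN. Qed.

Lemma rnormMB a b c d :
  rnorm (a ** b - c ** d) <= rnorm a * rnorm (b - d) + rnorm (a - c) * rnorm d.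
Proof.
rewrite -(subrKA (a ** d)) (le_trans (rnormD _ _)) //.
by rewrite -cmulBr -cmulBl lerD ?rnormM.
Qed.

(* The fixed-point iteration for 1 - sqrt (1 - h): its terms are polynomials in h
   whose nonnegative coefficients increase with n and have sum at most 1, whence
   the convergence for |h| <= 1. *)
Fixpoint sqrt_approx h n : A :=
  if n is n'.+1 then
    (2^-1)%:C *: (h + sqrt_approx h n' ** sqrt_approx h n') else 0.

(** The same iteration for the scalar 1. It dominates the norms and the increments of
    [sqrt_approx h] when [h] is a contraction. *)
Fixpoint sqrt_bound n : R :=
  if n is n'.+1 then (1 + sqrt_bound n' ^+ 2) / 2 else 0.

Lemma sqrt_bound_ge0 n : 0 <= sqrt_bound n.
Proof. by case: n => //= n; rewrite divr_ge0 // addr_ge0 // sqr_ge0. Qed.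

Lemma sqrt_bound_le1 n : sqrt_bound n <= 1.
Proof. by elim: n => //= n IH; have := sqrt_bound_ge0 n; nra. Qed.

(** The increment is [(1 - sqrt_bound n) ^+ 2 / 2]. *)
Lemma sqrt_bound_incr n : sqrt_bound n <= sqrt_bound n.+1.
Proof. by rewrite /=; have := sqr_ge0 (1 - sqrt_bound n); nra. Qed.

Lemma sqrt_bound_mono : {homo sqrt_bound : n m / (n <= m)%N >-> n <= m}.
Proof. by apply: homo_leq => //; [exact: le_trans|exact: sqrt_bound_incr]. Qed.

Lemma sqrt_bound_cauchy (e : R) : 0 < e -> exists N, forall n m,
  (N <= n)%N -> (N <= m)%N -> sqrt_bound m - sqrt_bound n < e.
Proof.
move=> e0; have ub : has_ubound (range sqrt_bound).
  by exists 1 => _ [n _ <-]; exact: sqrt_bound_le1.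
have hs : has_sup (range sqrt_bound) by split => //; exists 0, 0%N.
have [_ [N _ <-] Nl] := sup_adherent e0 hs.
exists N => n m Nn Nm; rewrite ltrBlDr; apply: (@le_lt_trans _ _ (sup (range sqrt_bound))).
  by apply: ub_le_sup => //; exists m.
by move: Nl; rewrite ltrBlDr => /lt_le_trans; apply; rewrite addrC lerD2l sqrt_bound_mono.
Qed.

Lemma rnorm_sqrt_approx h n : rnorm h <= 1 -> rnorm (sqrt_approx h n) <= sqrt_bound n.
Proof.
move=> h1; elim: n => [|n IH]; first by rewrite /= rnorm0.
rewrite /= rnormZr ger0_norm ?invr_ge0 // mulrC ler_wpM2r ?invr_ge0 //.
rewrite (le_trans (rnormD _ _)) // lerD // (le_trans (rnormM _ _)) //.
by rewrite expr2 ler_pM ?rnorm_ge0.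
Qed.

Lemma rnorm_sqrt_approx_incr h n : rnorm h <= 1 ->
  rnorm (sqrt_approx h n.+1 - sqrt_approx h n) <= sqrt_bound n.+1 - sqrt_bound n.
Proof.
move=> h1; elim: n => [|n IH].
  by rewrite !subr0; exact: rnorm_sqrt_approx.
rewrite [sqrt_approx h n.+2]/= [X in _ - X]/= -scalerBr rnormZr.
rewrite ger0_norm ?invr_ge0 // addrAC opprD addNKr -/(sqrt_approx h n.+1).
set b := sqrt_approx h n.+1 in IH *; set b' := sqrt_approx h n in IH *.
have -> : - (b' ** b') + b ** b = b ** b - b' ** b' by rewrite addrC.
rewrite mulrC ler_pdivrMr // (le_trans (rnormMB _ _ _ _)) //.
have bn := rnorm_sqrt_approx n.+1 h1; have bn' := rnorm_sqrt_approx n h1.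
rewrite -/b in bn; rewrite -/b' in bn'.
apply: (@le_trans _ _ ((sqrt_bound n.+1 + sqrt_bound n) *
    (sqrt_bound n.+1 - sqrt_bound n))).
  rewrite mulrDl lerD //; first by rewrite ler_pM ?rnorm_ge0.
  by rewrite mulrC ler_pM ?rnorm_ge0.
by rewrite [sqrt_bound n.+2]/=; set x := (1 + sqrt_bound n ^+ 2) / 2; rewrite /x /=; lra.
Qed.

Lemma sqrt_approx_cauchy h n m : rnorm h <= 1 -> (n <= m)%N ->
  rnorm (sqrt_approx h m - sqrt_approx h n) <= sqrt_bound m - sqrt_bound n.
Proof.
move=> h1; elim: m => [|m IH].
  by rewrite leqn0 => /eqP ->; rewrite !subrr rnorm0.
rewrite leq_eqVlt ltnS => /predU1P[<-|/IH nm]; first by rewrite !subrr rnorm0.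
rewrite -(subrKA (sqrt_approx h m)) (le_trans (rnormD _ _)) //.
by rewrite (le_trans (lerD (rnorm_sqrt_approx_incr m h1) nm)) // addrA subrK.
Qed.

Lemma sqrt_approx_star h n : star h = h -> star (sqrt_approx h n) = sqrt_approx h n.
Proof.
move=> hs; elim: n => [|n IH] /=; first exact: star0.
by rewrite starZ starD starM IH hs conjcR.
Qed.

Lemma sqrt_approx_comm h c n : c ** h = h ** c ->
  c ** sqrt_approx h n = sqrt_approx h n ** c.
Proof.
move=> ch; elim: n => [|n IH] /=; first by rewrite cmul0l cmul0r.
by rewrite cmulZr cmulZl cmulDr cmulDl ch cmulA IH -cmulA IH cmulA.
Qed.

(** In the unitization [w] is 1 - sqrt (1 - h): the second clause reads (1 - w)^2 = 1 - h.
    Self-adjointness and commutation hold for every iterate and pass to the limit. *)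
Lemma one_sub_sqrt h : rnorm h <= 1 -> exists w,
  [/\ rnorm w <= 1, w + w = h + w ** w, star h = h -> star w = w
    & forall c, c ** h = h ** c -> c ** w = w ** c].
Proof.
move=> h1; have [w wl] : exists w : A, sqrt_approx h @ \oo --> w.
  apply: cauchyn_rnorm => e e0; have [N Ne] := sqrt_bound_cauchy e0.
  exists N => n m Nn Nm; case/orP: (leq_total n m) => nm.
    by rewrite rnormBC (le_lt_trans (sqrt_approx_cauchy h1 nm)) // Ne.
  by rewrite (le_lt_trans (sqrt_approx_cauchy h1 nm)) // Ne.
have wle n : rnorm (sqrt_approx h n) <= 1.
  by rewrite (le_trans (rnorm_sqrt_approx n h1)) // sqrt_bound_le1.
have w1 : rnorm w <= 1.
  by rewrite -[w]subr0; apply: (cvgn_rnorm_le wl (N := 0)) => n _; rewrite subr0.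
have wN (e : R) : 0 < e -> exists n,
    rnorm (w - sqrt_approx h n) <= e /\ rnorm (w - sqrt_approx h n.+1) <= e.
  move=> /((cvgn_rnormP _ _).1 wl)[N NW]; exists N.
  by split; rewrite ltW // NW.
exists w; split=> // [|hs|c ch].
- apply/eqP; rewrite -subr_eq0; apply/eqP/rnorm_le0 => e e0.
  have [|n [wn wn1]] := wN (e / 4); first by rewrite divr_gt0.
  have -> : w + w - (h + w ** w) =
      2%:R *: (w - sqrt_approx h n.+1) +
      (sqrt_approx h n ** sqrt_approx h n - w ** w).
    rewrite /= scalerBr scalerA (_ : 2%:R * _ = 1); last first.
      by rewrite -(rmorph_nat (real_complex R)) -rmorphM mulfV // pnatr_eq0.
    by rewrite scale1r scaler_nat mulr2n; zmodule.
  rewrite (le_trans (rnormD _ _)) // -(rmorph_nat (real_complex R)) rnormZr.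
  rewrite normr_nat.
  have := rnormMB (sqrt_approx h n) (sqrt_approx h n) w w.
  rewrite rnormBC in wn *; move: (wle n) wn wn1 w1 => p1 p2 p3 p4 p5.
  have := rnorm_ge0 (sqrt_approx h n - w); have := rnorm_ge0 w.
  have := rnorm_ge0 (sqrt_approx h n); nra.
- apply/eqP; rewrite -subr_eq0; apply/eqP/rnorm_le0 => e e0.
  have [|n [wn _]] := wN (e / 2); first by rewrite divr_gt0.
  rewrite -(subrKA (sqrt_approx h n)) (le_trans (rnormD _ _)) //.
  rewrite -{1}(sqrt_approx_star n hs) -starB rnorm_star.
  by rewrite [X in _ + X]rnormBC; lra.
apply/eqP; rewrite -subr_eq0; apply/eqP/rnorm_le0 => e e0.
have k0 : 0 < 2 * (rnorm c + 1) by rewrite mulr_gt0 // ltr_wpDl ?rnorm_ge0.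
have [|n [wn _]] := wN (e / (2 * (rnorm c + 1))); first by rewrite divr_gt0.
rewrite -(subrKA (c ** sqrt_approx h n)) {2}sqrt_approx_comm // -cmulBr -cmulBl.
rewrite (le_trans (rnormD _ _)) //.
rewrite (le_trans (lerD (rnormM _ _) (rnormM _ _))) // [X in _ + X * _]rnormBC.
move: wn; rewrite ler_pdivlMr // => wn.
have := rnorm_ge0 c; have := rnorm_ge0 (w - sqrt_approx h n); nra.
Qed.

(* In the unitization, 1 - g is an isometry. *)
Lemma rnorm_isometry g a : star g ** g = g + star g -> rnorm (g ** a - a) = rnorm a.
Proof.
move=> gg; have /(congr1 (@rnorm _ _)) :
    star (g ** a - a) ** (g ** a - a) = star a ** a.
  rewrite starB starM cmulBl !cmulBr.
  rewrite -cmulA [star g ** (g ** a)]cmulA gg cmulDl cmulDr.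
  by rewrite -[star a ** star g ** a]cmulA addrK opprB addrC subrK.
by rewrite !rnorm_star_mul => /eqP; rewrite eqrXn2 ?rnorm_ge0 // => /eqP.
Qed.

(** In the unitization the last hypothesis says (1 - m)^2 + y^2 = 1, so 1 - (m + i y) is unitary; 1
    - m and y are, up to sign, its real and imaginary parts, hence contractions. *)
Lemma rnorm_unitary_parts (m y a : A) : star m = m -> star y = y -> m ** y = y ** m ->
  m ** m + y ** y = m + m ->
  rnorm (m ** a - a) <= rnorm a /\ rnorm (y ** a) <= rnorm a.
Proof.
move=> sm sy my myE; pose g := m + 'i *: y; pose g' := m - 'i *: y.
have sg : star g = g'.
  rewrite /g /g' starD starZ sm sy; congr (_ + _); rewrite -scaleNr; congr (_ *: _).
  by apply/eqP; rewrite eq_complex /= oppr0 !eqxx.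
have sg' : star g' = g by rewrite -sg starK.
have gg : g + g' = m + m by rewrite /g /g' addrACA subrr addr0.
have ii : 'i * 'i = -1 :> R[i] by rewrite -expr2 sqr_i.
have g'g : g' ** g = m + m.
  rewrite /g /g' cmulBl !cmulDr !cmulZl !cmulZr scalerA ii my -myE.
  by rewrite opprD scaleN1r opprK addrA addrK.
have gg' : g ** g' = m + m.
  rewrite /g /g' cmulDl !cmulBr !cmulZl !cmulZr scalerA ii my -myE.
  by rewrite scaleN1r opprK addrA subrK.
have n1 : rnorm (g ** a - a) = rnorm a by apply: rnorm_isometry; rewrite sg g'g gg.
have n2 : rnorm (g' ** a - a) = rnorm a.
  by apply: rnorm_isometry; rewrite sg' gg' -gg addrC.
have two (x : A) : x + x = 2%:R%:C *: x by rewrite rmorph_nat scaler_nat mulr2n.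
split.
  have : rnorm (2%:R%:C *: (m ** a - a)) <= rnorm a + rnorm a.
    rewrite -{1}n1 -n2 -two addrACA -opprD -cmulDl -gg cmulDl opprD addrACA.
    exact: rnormD.
  by rewrite rnormZr normr_nat; lra.
have : rnorm ('i *: (2%:R%:C *: (y ** a))) <= rnorm a + rnorm a.
  rewrite -{1}n1 -n2 -two scalerDr -cmulZl.
  have -> : ('i *: y) ** a + ('i *: y) ** a = (g ** a - a) - (g' ** a - a).
    rewrite opprB addrA subrK -cmulBl -cmulDl /g /g'; congr (_ ** _).
    zmodule.
  exact: rnormB.
rewrite rnormZ rnormZr normr_nat normc_def /= expr0n /= add0r expr1n sqrtr1.
by lra.
Qed.

(** If c = 1 - sqrt (1 - k^2), then 1 - k^2 = (1 - c)^2, and 1 - c is a contraction because (1 -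
    c)^2 + k^2 = 1. *)
Lemma rnorm_sub_sqr k a : star k = k -> rnorm k <= 1 ->
  rnorm (a - k ** k ** a) <= rnorm a.
Proof.
move=> sk k1; have kk1 : rnorm (k ** k) <= 1.
  by rewrite (le_trans (rnormM _ _)) // mulr_ile1 ?rnorm_ge0.
have [c [_ cE cs ck]] := one_sub_sqrt kk1.
have {}cs : star c = c by apply: cs; rewrite starM sk.
have {}ck : c ** k = k ** c by rewrite ck // cmulA.
have ccE : c ** c + k ** k = c + c by rewrite cE addrC.
have le b := (rnorm_unitary_parts b cs sk ck ccE).1.
suff -> : a - k ** k ** a = c ** (c ** a - a) - (c ** a - a).
  by rewrite (le_trans (le _)) // le.
have -> : k ** k = c + c - c ** c by rewrite cE addrK.
by rewrite cmulBr cmulBl cmulDl cmulA; zmodule.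
Qed.

(* With v = k ** k, the elements are G = 2 (2v - 1)^+ and F = 2 min (2v, 1). *)
Lemma cutoff k : star k = k -> rnorm k <= 1 -> exists G F,
  [/\ star F = F, G + F = k ** k + k ** k + (k ** k + k ** k),
      rnorm (F - G) <= 2, G ** F = G + G & F ** G = G + G].
Proof.
move=> sk k1; set v := k ** k; have v1 : rnorm v <= 1.
  by rewrite (le_trans (rnormM _ _)) // mulr_ile1 ?rnorm_ge0.
have sv : star v = v by rewrite starM sk.
have [c [_ cE cs ck]] := one_sub_sqrt v1.
have {}cs := cs sv; have {}ck : c ** k = k ** c by rewrite ck // /v cmulA.
(* Here 1 - c = sqrt (1 - v), so y = 2 k sqrt (1 - v) and y^2 = 4 v (1 - v) = 1 - (2 v - 1)^2. *)
pose y0 := k - k ** c; pose y := y0 + y0.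
have y0y0 : y0 ** y0 = v - v ** v.
  have vcc : v ** c + v ** c = v ** v + v ** (c ** c).
    by rewrite -!cmulDr cE.
  rewrite /y0 cmulBl !cmulBr -/v.
  have -> : k ** c ** k = v ** c by rewrite -cmulA ck cmulA.
  have -> : k ** (k ** c) = v ** c by rewrite cmulA.
  have -> : k ** c ** (k ** c) = v ** (c ** c).
    by rewrite cmulA -(cmulA k c k) ck !cmulA.
  rewrite (_ : _ - _ = v - (v ** c + v ** c) + v ** (c ** c)); last zmodule.
  by rewrite vcc; zmodule.
have sy : star y = y by rewrite /y /y0 starD starB starM cs sk ck.
have vk : v ** k = k ** v by rewrite /v cmulA.
have vc : v ** c = c ** v by rewrite /v cmulA ck -!cmulA ck.
have vy0 : v ** y0 = y0 ** v.
  by rewrite /y0 cmulBr cmulBl cmulA vk -cmulA vc cmulA.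
have vy : v ** y = y ** v by rewrite /y cmulDr cmulDl vy0.
have yy : y ** y = (v - v ** v) + (v - v ** v) + ((v - v ** v) + (v - v ** v)).
  by rewrite /y cmulDl cmulDr y0y0.
pose m := v + v.
have mm : m ** m = v ** v + v ** v + (v ** v + v ** v).
  by rewrite /m cmulDl cmulDr.
have mmyy : m ** m + y ** y = m + m.
  by rewrite mm yy addrACA (addrACA (v ** v)) !(addrC (v ** v)) !subrK.
have my : m ** y = y ** m by rewrite /m cmulDr cmulDl vy.
have y1 : rnorm (y ** y) <= 1.
  have sm : star m = m by rewrite /m starD sv.
  have := (rnorm_unitary_parts y sm sy my mmyy).2.
  have -> : rnorm (y ** y) = rnorm y ^+ 2 by rewrite -{1}sy rnorm_star_mul.
  rewrite expr2 => yle.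
  have [->|y0'] := eqVneq y 0; first by rewrite rnorm0 mulr0.
  have ypos := rnorm_gt0 y0'.
  have : rnorm y <= 1 by rewrite -(ler_pM2r ypos) mul1r.
  by move=> ?; rewrite mulr_ile1 ?rnorm_ge0.
(* Now w = 1 - sqrt (1 - y^2) = 1 - |2 v - 1|, so [m - w] and [m + w] are G and F; the norm bound
   holds since F - G = 2 w. *)
have [w [w1 wE ws wc]] := one_sub_sqrt y1.
have {}ws : star w = w by apply: ws; rewrite starM sy.
have {}wv : m ** w = w ** m by rewrite wc // cmulA my -cmulA my cmulA.
have key : m ** m - w ** w = (m - w) + (m - w).
  by rewrite addrACA -opprD wE -mmyy opprD addrA addrK.
exists (m - w), (m + w); split.
- by rewrite starD /m starD sv ws.
- by rewrite addrACA addNr addr0.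
- rewrite opprB addrC addrA subrK (le_trans (rnormD _ _)) //; lra.
- clear -wv key; clearbody m; rewrite -key cmulBl !cmulDr wv. zmodule.
by rewrite -key cmulDl !cmulBr wv; zmodule.
Qed.

End cstar_calculus.

(** * Hilbert spaces *)

Section real_lemmas.
Context {R : realType}.

Definition invn (n : nat) : R := n.+1%:R^-1.

Lemma invn_gt0 n : 0 < invn n.
Proof. by rewrite invr_gt0 ltr0n. Qed.

Lemma invn_small (e : R) : 0 < e ->
  exists N, forall n, (N <= n)%N -> invn n < e.
Proof.
move=> e0; exists (Num.bound e^-1) => n Nn.
have ei0 : 0 <= e^-1 by rewrite invr_ge0 ltW.
rewrite /invn -[e]invrK ltf_pV2 ?posrE ?invr_gt0 ?ltr0n //.
apply: lt_le_trans (archi_boundP ei0) _.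
by rewrite ler_nat (leq_trans Nn).
Qed.

(** The expression is |x - t <x, y> y|^2 with a = |x|^2, b = |y|^2, s = |<x, y>|^2. The value t =
    1/b gives the bound; when b = 0 a large t excludes s > 0. *)
Lemma quadratic_le (a b s : R) : 0 <= a -> 0 <= b -> 0 <= s ->
  (forall t, 0 <= a - 2 * t * s + t ^+ 2 * s * b) -> s <= a * b.
Proof.
move=> a0 b0 s0 h; have [b0'|bn0] := eqVneq b 0.
  rewrite b0' mulr0 leNgt; apply/negP => s_gt0; have := h ((a + 1) / (2 * s)).
  rewrite b0' mulr0 addr0 (_ : 2 * _ * s = a + 1); last first.
    by field; rewrite gt_eqF.
  lra.
have bpos : 0 < b by rewrite lt_def bn0.
have := h b^-1; rewrite (_ : _ + _ = a - s / b); last by field.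
by rewrite subr_ge0 ler_pdivrMr.
Qed.

Lemma closed_cvgn (V : normedModType R[i]) (W : set V) (u : nat -> V) (l : V) :
  closed W -> u @ \oo --> l -> (forall n, W (u n)) -> W l.
Proof.
move=> /closed_rnormP Wcl /cvgn_rnormP ul Wu; apply: Wcl => e /ul[N Nu].
by exists (u N) => //; exact: Nu.
Qed.

End real_lemmas.

(** The form may degenerate, as the form of a state does. Positivity is asked of the real part
    because [sipC] makes the diagonal real. *)
Record semi_ip (R : realType) (E : lmodType R[i]) := SemiIp {
  sip :> E -> E -> R[i];
  sipPl : forall (k : R[i]) x y z, sip (k *: x + y) z = k * sip x z + sip y z;
  sipC : forall x y, sip y x = (sip x y)^*;
  sip_ge0 : forall x, 0 <= cre (sip x x)
}.

Section semi_inner_product.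
Context {R : realType} {E : lmodType R[i]} (B : semi_ip E).
Implicit Types (x y z : E) (k : R[i]).

Lemma sipDl x y z : B (x + y) z = B x z + B y z.
Proof. by have := sipPl B 1 x y z; rewrite scale1r mul1r. Qed.

Lemma sip0l z : B 0 z = 0.
Proof. by apply: (addrI (B 0 z)); rewrite -sipDl !addr0. Qed.

Lemma sipZl k x z : B (k *: x) z = k * B x z.
Proof. by have := sipPl B k x 0 z; rewrite sip0l !addr0. Qed.

Lemma sipNl x z : B (- x) z = - B x z.
Proof. by rewrite -scaleN1r sipZl mulN1r. Qed.

Lemma sipBl x y z : B (x - y) z = B x z - B y z.
Proof. by rewrite sipDl sipNl. Qed.

Lemma sip0r z : B z 0 = 0.
Proof. by rewrite sipC sip0l rmorph0. Qed.

Lemma sipDr x y z : B z (x + y) = B z x + B z y.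
Proof. by rewrite sipC sipDl conjcD -!sipC. Qed.

Lemma sipZr k x z : B z (k *: x) = k^* * B z x.
Proof. by rewrite sipC sipZl conjcM -sipC. Qed.

Lemma sipNr x z : B z (- x) = - B z x.
Proof. by rewrite sipC sipNl conjcN -sipC. Qed.

Lemma sipBr x y z : B z (x - y) = B z x - B z y.
Proof. by rewrite sipDr sipNr. Qed.

Definition snorm x : R := Num.sqrt (cre (B x x)).

Lemma snorm_ge0 x : 0 <= snorm x.
Proof. exact: sqrtr_ge0. Qed.

Lemma sqr_snorm x : snorm x ^+ 2 = cre (B x x).
Proof. by rewrite sqr_sqrtr ?sip_ge0. Qed.

Lemma sip_snorm x : B x x = (snorm x ^+ 2)%:C.
Proof.
rewrite sqr_snorm; have := sipC B x x; case: (B x x) => a b [] h.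
by congr Complex; lra.
Qed.

Lemma cre_sipC x y : cre (B y x) = cre (B x y).
Proof. by rewrite sipC cre_conj. Qed.

Lemma sqr_snormZB x y (t : R) : let c := B x y in
  snorm (x - (t%:C * c) *: y) ^+ 2 =
    snorm x ^+ 2 - 2 * t * cre `|c| ^+ 2 + t ^+ 2 * cre `|c| ^+ 2 * snorm y ^+ 2.
Proof.
move=> c; rewrite sqr_snorm sipBl !sipBr !sipZl !sipZr conjcM conjcR.
rewrite (sipC B x y) -/c.
have -> : t%:C * c^* * c = (t * cre `|c| ^+ 2)%:C.
  by rewrite -mulrA conjc_mul_norm -rmorphM.
have -> : t%:C * c * c^* = (t * cre `|c| ^+ 2)%:C.
  by rewrite -mulrA (mulrC c) conjc_mul_norm -rmorphM.
rewrite (mulrA _ _ (B y y)) (mulrACA t%:C) (mulrC c) conjc_mul_norm !sip_snorm.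
by rewrite -!rmorphM !creB !creR; ring.
Qed.

Lemma cauchy_schwarz x y : cre `|B x y| <= snorm x * snorm y.
Proof.
rewrite -(@ler_pXn2r _ 2) ?nnegrE ?mulr_ge0 ?snorm_ge0 ?cre_norm_ge0 //.
rewrite exprMn; apply: quadratic_le; rewrite ?sqr_ge0 // => t.
by rewrite -sqr_snormZB sqr_ge0.
Qed.

Lemma cre_sip_le x y : cre (B x y) <= snorm x * snorm y.
Proof. exact: le_trans (cre_le_norm _) (cauchy_schwarz _ _). Qed.

Lemma sqr_snormD x y :
  snorm (x + y) ^+ 2 = snorm x ^+ 2 + 2 * cre (B x y) + snorm y ^+ 2.
Proof. by rewrite !sqr_snorm sipDl !sipDr !creD (cre_sipC x y); ring. Qed.

End semi_inner_product.

Section hilbert_space.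
Context {R : realType} {H : hilbertType R}.
Implicit Types x y z w : H.

Lemma cre_ip_norm x : cre (ip x x) = rnorm x ^+ 2.
Proof. by rewrite ip_norm rnormE -rmorphXn. Qed.

Let ip_ge0 x : 0 <= cre (ip x x).
Proof. by rewrite cre_ip_norm sqr_ge0. Qed.

Definition hilbert_ip : semi_ip H := SemiIp (@ipPl R H) (@ipC R H) ip_ge0.

Lemma hilbert_ipE x y : hilbert_ip x y = ip x y.
Proof. by []. Qed.

Lemma snorm_hilbert x : snorm hilbert_ip x = rnorm x.
Proof.
by apply/eqP; rewrite -(@eqrXn2 _ 2) ?snorm_ge0 ?rnorm_ge0 // sqr_snorm cre_ip_norm.
Qed.

Lemma ip_rnorm x : ip x x = (rnorm x ^+ 2)%:C.
Proof. by rewrite -snorm_hilbert -sip_snorm. Qed.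

Lemma cre_ip_le x y : cre (ip x y) <= rnorm x * rnorm y.
Proof. by rewrite -!snorm_hilbert; exact: (cre_sip_le hilbert_ip x y). Qed.

Lemma ip_bound x y : cre `|ip x y| <= rnorm x * rnorm y.
Proof. by rewrite -!snorm_hilbert; exact: (cauchy_schwarz hilbert_ip x y). Qed.

Lemma sqr_rnormD x y :
  rnorm (x + y) ^+ 2 = rnorm x ^+ 2 + 2 * cre (ip x y) + rnorm y ^+ 2.
Proof. by rewrite -!snorm_hilbert; exact: (sqr_snormD hilbert_ip x y). Qed.

Lemma sqr_rnormB x y :
  rnorm (x - y) ^+ 2 = rnorm x ^+ 2 - 2 * cre (ip x y) + rnorm y ^+ 2.
Proof.
by rewrite sqr_rnormD rnormN -hilbert_ipE sipNr creN mulrN hilbert_ipE.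
Qed.

Lemma ip_Bl x y z : ip (x - y) z = ip x z - ip y z.
Proof. exact: (sipBl hilbert_ip). Qed.

Lemma ip_Br x y z : ip z (x - y) = ip z x - ip z y.
Proof. exact: (sipBr hilbert_ip). Qed.

Lemma ip_Dl x y z : ip (x + y) z = ip x z + ip y z.
Proof. exact: (sipDl hilbert_ip). Qed.

Lemma ip_Dr x y z : ip z (x + y) = ip z x + ip z y.
Proof. exact: (sipDr hilbert_ip). Qed.

Lemma ip_Zl (k : R[i]) x z : ip (k *: x) z = k * ip x z.
Proof. exact: (sipZl hilbert_ip). Qed.

Lemma ip_Zr (k : R[i]) x z : ip z (k *: x) = k^* * ip z x.
Proof. exact: (sipZr hilbert_ip). Qed.

Lemma ip_C x y : ip y x = (ip x y)^*.
Proof. exact: (sipC hilbert_ip). Qed.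

Lemma cre_ip_C x y : cre (ip y x) = cre (ip x y).
Proof. exact: (cre_sipC hilbert_ip). Qed.

Lemma ip_0l x : ip 0 x = 0.
Proof. exact: (sip0l hilbert_ip). Qed.

Lemma ip_0r x : ip x 0 = 0.
Proof. exact: (sip0r hilbert_ip). Qed.

Lemma parallelogram x y :
  rnorm (x + y) ^+ 2 + rnorm (x - y) ^+ 2 = 2 * (rnorm x ^+ 2 + rnorm y ^+ 2).
Proof. by rewrite sqr_rnormD sqr_rnormB; ring. Qed.

Lemma ip_eq0 x : (forall y, ip x y = 0) -> x = 0.
Proof.
move=> /(_ x); rewrite ip_rnorm => /(congr1 cre); rewrite creR => /eqP.
by rewrite sqrf_eq0 => /eqP /rnorm_eq0.
Qed.

Definition subspace (W : set H) :=
  W 0 /\ forall (k : R[i]) x y, W x -> W y -> W (k *: x + y).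

Lemma subspaceZ W k x : subspace W -> W x -> W (k *: x).
Proof. by move=> [W0 WZ] Wx; rewrite -[_ *: _]addr0; exact: WZ. Qed.

Lemma subspaceD W x y : subspace W -> W x -> W y -> W (x + y).
Proof. by move=> [W0 WZ] Wx Wy; rewrite -[x]scale1r; exact: WZ. Qed.

Lemma orthogonal_projection (W : set H) x : closed W -> subspace W ->
  exists2 p, W p & forall w, W w -> ip (x - p) w = 0.
Proof.
move=> Wcl sW; have [W0 WZ] := sW; pose D := [set rnorm (x - w) ^+ 2 | w in W].
have D0 : D !=set0 by exists (rnorm (x - 0) ^+ 2), 0.
have Dlb : lbound D 0 by move=> _ [w _ <-]; exact: sqr_ge0.
have hD : has_inf D by split => //; exists 0.
pose d := inf D; have dle w : W w -> d <= rnorm (x - w) ^+ 2.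
  by move=> Ww; apply: ge_inf; [exists 0|exists w].
have d0 : 0 <= d by exact: lb_le_inf.
have /choice[w wP] n : exists w, W w /\ rnorm (x - w) ^+ 2 < d + invn n.
  have [_ [w Ww <-] wd] := inf_adherent (invn_gt0 n) hD.
  by exists w.
(* The midpoint of [w n] and [w m] lies in [W], so its squared distance to [x] is at least [d]; the
   parallelogram identity then makes the minimizing sequence Cauchy. *)
have wc n m : rnorm (w n - w m) ^+ 2 <= 2 * (invn n + invn m).
  have := parallelogram (x - w n) (x - w m).
  have -> : x - w n - (x - w m) = w m - w n by zmodule.
  have -> : x - w n + (x - w m) = 2%:C *: (x - 2^-1%:C *: (w n + w m)).
    rewrite scalerBr scalerA -rmorphM mulfV ?pnatr_eq0 // rmorph1 scale1r rmorph_nat.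
    by rewrite scaler_nat mulr2n; zmodule.
  rewrite rnormBC rnormZr exprMn normr_nat.
  have := dle _ (subspaceZ 2^-1%:C sW (subspaceD sW (wP n).1 (wP m).1)).
  have [_] := wP n; have [_] := wP m; lra.
have [p wp] : exists p : H, w @ \oo --> p.
  apply: cauchyn_rnorm => e e0; have [|N Ne] := @invn_small R (e ^+ 2 / 4).
    by rewrite divr_gt0 // exprn_gt0.
  exists N => n m Nn Nm; rewrite -(@ltr_pXn2r _ 2) ?nnegrE ?rnorm_ge0 // ?ltW //.
  have := wc n m; have := Ne _ Nn; have := Ne _ Nm; lra.
have Wp : W p.
  by apply: (closed_cvgn Wcl wp) => n; exact: (wP n).1.
have pd : rnorm (x - p) ^+ 2 <= d.
  apply/ler_addgt0Pr => e e0; have [N Ne] := invn_small e0.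
  have de0 : 0 <= d + e by rewrite addr_ge0 // ltW.
  rewrite -[leRHS]sqr_sqrtr // ler_pXn2r ?nnegrE ?rnorm_ge0 ?sqrtr_ge0 //.
  rewrite rnormBC; apply: (cvgn_rnorm_le wp (N := N)) => n Nn.
  rewrite -(@ler_pXn2r _ 2) ?nnegrE ?rnorm_ge0 ?sqrtr_ge0 // sqr_sqrtr //.
  by rewrite rnormBC; have [_] := wP n; have := Ne _ Nn; lra.
exists p => // v Wv; set c := ip (x - p) v.
(* Minimality of [p] along p + t c v is the hypothesis of [quadratic_le] with a = 0, whose
   conclusion is |c|^2 <= 0. *)
have /eqP : cre `|c| ^+ 2 = 0.
  apply/eqP; rewrite eq_le sqr_ge0 andbT -(mul0r (rnorm v ^+ 2)).
  apply: quadratic_le; rewrite ?sqr_ge0 // => t.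
  have := sqr_snormZB hilbert_ip (x - p) v t; rewrite /= -/c !snorm_hilbert => cE.
  have := dle _ (subspaceD sW Wp (subspaceZ (t%:C * c) sW Wv)).
  by rewrite opprD addrA cE; lra.
by rewrite sqrf_eq0 => /eqP /cre_norm_eq0.
Qed.

End hilbert_space.

Section nested_intervals.
Context {R : realType}.

(** The intervals of radius [K * invn n] about [a n] meet pairwise, so the supremum of their left
    ends lies in all of them. *)
Lemma cauchy_invn_real (a : nat -> R) (K : R) :
  (forall n m, `|a n - a m| <= K * (invn n + invn m)) ->
  exists l, forall n, `|l - a n| <= K * invn n.
Proof.
move=> aK; pose L := range (fun n => a n - K * invn n).
have ub m : ubound L (a m + K * invn m).
  move=> _ [n _ <-]; have := aK n m; rewrite ler_norml => /andP[]; nra.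
exists (sup L) => n; rewrite ler_distl; apply/andP; split.
  by apply: ub_le_sup; [exists (a n + K * invn n)|exists n].
apply: ge_sup; last exact: ub.
by exists (a 0%N - K * invn 0), 0%N.
Qed.

Lemma cauchy_invn (z : nat -> R[i]) (K : R) :
  (forall n m, cre `|z n - z m| <= K * (invn n + invn m)) ->
  exists l, forall n, cre `|l - z n| <= 2 * K * invn n.
Proof.
have re_le (w : R[i]) : `|complex.Re w| <= cre `|w|.
  rewrite /cre normc_def /= -sqrtr_sqr ler_sqrt ?lerDl ?sqr_ge0 //.
  by rewrite addr_ge0 ?sqr_ge0.
have im_le (w : R[i]) : `|complex.Im w| <= cre `|w|.
  rewrite /cre normc_def /= -sqrtr_sqr ler_sqrt ?lerDr ?sqr_ge0 //.
  by rewrite addr_ge0 ?sqr_ge0.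
have le_re_im (w : R[i]) : cre `|w| <= `|complex.Re w| + `|complex.Im w|.
  rewrite /cre normc_def /= -(@ler_pXn2r _ 2) ?nnegrE ?sqrtr_ge0 ?addr_ge0 //.
  rewrite sqr_sqrtr ?addr_ge0 ?sqr_ge0 // sqrrD !real_normK ?num_real //.
  by rewrite lerD2r lerDl mulrn_wge0 // mulr_ge0.
move=> zK; have [|a aP] := @cauchy_invn_real (fun n => complex.Re (z n)) K.
  move=> n m; apply: le_trans (zK n m); apply: le_trans (re_le _).
  by case: (z n) (z m) => [? ?] [? ?].
have [|b bP] := @cauchy_invn_real (fun n => complex.Im (z n)) K.
  move=> n m; apply: le_trans (zK n m); apply: le_trans (im_le _).
  by case: (z n) (z m) => [? ?] [? ?].
exists (Complex a b) => n; apply: (le_trans (le_re_im _)).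
by have := aP n; have := bP n; case: (z n) => c d /=; lra.
Qed.

Lemma le_invn (x y C : R) : 0 <= C -> (forall n, x <= y + C * invn n) -> x <= y.
Proof.
move=> C0 h; apply/ler_addgt0Pr => e e0; have C1 : 0 < C + 1 by rewrite ltr_wpDl.
have [|N /(_ N (leqnn N)) Ne] := @invn_small R (e / (C + 1)).
  by rewrite divr_gt0.
apply: (le_trans (h N)); rewrite lerD2l.
move: Ne; rewrite ltr_pdivlMr // => Ne; have := @invn_gt0 R N; nra.
Qed.

End nested_intervals.

(** * Completion of a semi-inner product space *)

Section completion.
Variables (R : realType) (E : lmodType R[i]) (B : semi_ip E).
Implicit Types (x y z : E) (k : R[i]).

(* The completion of E is realized inside the functions on E, a vector x being
   the function y |-> B x y: its elements are the functionals that are limits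
   of vectors for the dual norm. *)
Record completion := Completion {
  cfun :> E -> R[i];
  cfunP : forall e : R, 0 < e ->
    exists x, forall y, cre `|cfun y - B x y| <= e * snorm B y
}.
Implicit Types (p q r : completion).

Lemma completion_eq p q : p =1 q -> p = q.
Proof.
case: p q => [f fP] [g gP] /= /funext fg; subst; congr Completion.
exact: Prop_irrelevance.
Qed.

Lemma embed_subproof x (e : R) : 0 < e ->
  exists x', forall y, cre `|B x y - B x' y| <= e * snorm B y.
Proof.
move=> e0; exists x => y; rewrite subrr normr0 cre0 mulr_ge0 ?snorm_ge0 //.
exact: ltW.
Qed.

Definition embed x : completion := Completion (embed_subproof x).

Lemma completion_scaleD_subproof k p q (e : R) : 0 < e ->
  exists x, forall y, cre `|k * p y + q y - B x y| <= e * snorm B y.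
Proof.
move=> e0; have k0 := cre_norm_ge0 k.
have k1 : 0 < 2 * (cre `|k| + 1) by rewrite mulr_gt0 // ltr_wpDl.
have [|x px] := cfunP p (e := e / (2 * (cre `|k| + 1))); first by rewrite divr_gt0.
have [|x' qx] := cfunP q (e := e / 2); first by rewrite divr_gt0.
exists (k *: x + x') => y; rewrite sipPl.
rewrite (_ : _ - _ = k * (p y - B x y) + (q y - B x' y)); last by ring.
apply: (le_trans (cre_normD _ _)); rewrite cre_normM.
apply: (@le_trans _ _ (cre `|k| * (e / (2 * (cre `|k| + 1)) * snorm B y) +
    e / 2 * snorm B y)); first by rewrite lerD // ler_wpM2l.
rewrite mulrA -mulrDl ler_wpM2r ?snorm_ge0 // -lerBrDr.
by rewrite mulrA ler_pdivrMr //; lra.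
Qed.

Definition completion_scaleD k p q : completion :=
  Completion (completion_scaleD_subproof k p q).
Definition completion_zero := embed 0.
Definition completion_add p q := completion_scaleD 1 p q.
Definition completion_scale k p := completion_scaleD k p completion_zero.
Definition completion_opp p := completion_scale (-1) p.

HB.instance Definition _ := gen_eqMixin completion.
HB.instance Definition _ := gen_choiceMixin completion.

Let addA : associative completion_add.
Proof. by move=> p q r; apply: completion_eq => y /=; ring. Qed.
Let addC : commutative completion_add.
Proof. by move=> p q; apply: completion_eq => y /=; ring. Qed.
Let add0 : left_id completion_zero completion_add.
Proof. by move=> p; apply: completion_eq => y /=; rewrite sip0l; ring. Qed.
Let addN : left_inverse completion_zero completion_opp completion_add.
Proof. by move=> p; apply: completion_eq => y /=; rewrite sip0l; ring. Qed.

HB.instance Definition _ := GRing.isZmodule.Build completion addA addC add0 addN.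

Let scaleA k k' p :
  completion_scale k (completion_scale k' p) = completion_scale (k * k') p.
Proof. by apply: completion_eq => y /=; rewrite sip0l; ring. Qed.
Let scale1 : left_id 1 completion_scale.
Proof. by move=> p; apply: completion_eq => y /=; rewrite sip0l; ring. Qed.
Let scaleDr : right_distributive completion_scale +%R.
Proof. by move=> k p q; apply: completion_eq => y /=; rewrite sip0l; ring. Qed.
Let scaleDl p : {morph completion_scale^~ p : k k' / k + k'}.
Proof. by move=> k k'; apply: completion_eq => y /=; rewrite sip0l; ring. Qed.

HB.instance Definition _ := GRing.Zmodule_isLmodule.Build R[i] completion
  scaleA scale1 scaleDr scaleDl.

Lemma cfunD p q y : (p + q) y = p y + q y.
Proof. by rewrite /= mul1r. Qed.

Lemma cfunZ k p y : (k *: p) y = k * p y.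
Proof. by rewrite /= sip0l addr0. Qed.

Lemma cfunB p q y : (p - q) y = p y - q y.
Proof. by rewrite cfunD -scaleN1r cfunZ mulN1r. Qed.

Definition completion_norm p : R :=
  inf [set c | 0 <= c /\ forall y, cre `|p y| <= c * snorm B y].

Lemma cfun_bounded p :
  exists c : R, 0 <= c /\ forall y, cre `|p y| <= c * snorm B y.
Proof.
have [x xP] := cfunP p ltr01; exists (1 + snorm B x).
split=> [|y]; first by rewrite addr_ge0 // snorm_ge0.
rewrite -[p y](subrK (B x y)) (le_trans (cre_normD _ _)) // mulrDl lerD //.
exact: cauchy_schwarz.
Qed.

Lemma completion_norm_le p (c : R) : 0 <= c ->
  (forall y, cre `|p y| <= c * snorm B y) -> completion_norm p <= c.
Proof. by move=> c0 pc; apply: ge_inf; [exists 0 => ? []|split]. Qed.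

Lemma completion_norm_ge0 p : 0 <= completion_norm p.
Proof.
by apply: lb_le_inf => [|c []//]; have [c cP] := cfun_bounded p; exists c.
Qed.

Lemma completion_normP p y : cre `|p y| <= completion_norm p * snorm B y.
Proof.
have [y0|y0] := eqVneq (snorm B y) 0.
  by have [c [_ /(_ y)]] := cfun_bounded p; rewrite y0 !mulr0.
have ypos : 0 < snorm B y by rewrite lt_def y0 snorm_ge0.
rewrite -ler_pdivrMr //; apply: lb_le_inf => [|c [_ /(_ y)]].
  by have [c cP] := cfun_bounded p; exists c.
by rewrite ler_pdivrMr.
Qed.

Lemma completion_norm_embed x : completion_norm (embed x) = snorm B x.
Proof.
apply/eqP; rewrite eq_le; apply/andP; split.
  by apply: completion_norm_le => [|y]; [exact: snorm_ge0|exact: cauchy_schwarz].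
have [->|x0] := eqVneq (snorm B x) 0; first exact: completion_norm_ge0.
have xpos : 0 < snorm B x by rewrite lt_def x0 snorm_ge0.
rewrite -(ler_pM2r xpos); apply: le_trans (completion_normP (embed x) x).
by rewrite -[embed x x]/(B x x) sip_snorm cre_norm_real ger0_norm ?sqr_ge0 // expr2.
Qed.

Definition completion_normC p : R[i] := (completion_norm p)%:C.

Let normD p q :
  completion_normC (p + q) <= completion_normC p + completion_normC q.
Proof.
rewrite /completion_normC -rmorphD lecR; apply: completion_norm_le => [|y].
  by rewrite addr_ge0 ?completion_norm_ge0.
rewrite cfunD (le_trans (cre_normD _ _)) // mulrDl.
by rewrite lerD ?completion_normP.
Qed.

Let normZ_le k p : completion_norm (k *: p) <= cre `|k| * completion_norm p.
Proof.
apply: completion_norm_le => [|y].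
  by rewrite mulr_ge0 ?completion_norm_ge0 ?cre_norm_ge0.
by rewrite cfunZ cre_normM -mulrA ler_wpM2l ?cre_norm_ge0 // completion_normP.
Qed.

Let normZ k p : completion_normC (k *: p) = `|k| * completion_normC p.
Proof.
rewrite cre_normE /completion_normC -rmorphM; congr (_%:C).
apply/eqP; rewrite eq_le normZ_le andTb.
have [->|k0] := eqVneq k 0.
  by rewrite normr0 cre0 mul0r completion_norm_ge0.
have := normZ_le k^-1 (k *: p); rewrite scalerA mulVf // scale1r.
move=> /(ler_wpM2l (cre_norm_ge0 k)) /le_trans; apply.
by rewrite mulrA -cre_normM mulfV // normr1 mul1r.
Qed.

Let norm0_eq0 p : completion_normC p = 0 -> p = 0.
Proof.
move=> /complexI p0; apply: completion_eq => y; rewrite [RHS]sip0l.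
apply: cre_norm_eq0; apply/eqP; rewrite eq_le cre_norm_ge0 andbT.
by have := completion_normP p y; rewrite p0 mul0r.
Qed.

HB.instance Definition _ := Lmodule_isNormed.Build R[i] completion
  normD normZ norm0_eq0.

Lemma rnorm_embed x : rnorm (embed x) = snorm B x.
Proof. exact: completion_norm_embed. Qed.

Lemma cfun_le p y : cre `|p y| <= rnorm p * snorm B y.
Proof. exact: completion_normP. Qed.

Lemma embed_linear k x y : embed (k *: x + y) = k *: embed x + embed y.
Proof. by apply: completion_eq => z; rewrite cfunD cfunZ /= sipPl. Qed.

Lemma embedB x y : embed (x - y) = embed x - embed y.
Proof. by apply: completion_eq => z; rewrite cfunB /= sipBl. Qed.

Lemma embed_dense p (e : R) : 0 < e -> exists x, rnorm (p - embed x) <= e.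
Proof.
move=> e0; have [x px] := cfunP p e0; exists x.
by apply: completion_norm_le => [|y]; [exact: ltW|rewrite cfunB].
Qed.

Lemma embed_approx p : exists u : nat -> E,
  forall n, rnorm (p - embed (u n)) <= invn n.
Proof.
have /choice[u uP] n : exists x, rnorm (p - embed x) <= invn n.
  exact: embed_dense (invn_gt0 n).
by exists u.
Qed.

(** Vectors [u n] that approximate the filter are Cauchy for [snorm]; the limit is the pointwise
    limit of the functionals [B (u n)], with error at most [4 * invn n] in the dual norm. *)
Let complete (F : set_system completion) : ProperFilter F -> cauchy F -> cvg F.
Proof.
move=> FF /cauchyP Fc.
have /choice[u uF] n : exists x, F [set p | rnorm (p - embed x) <= 2 * invn n].
  have nC : 0 < (invn n)%:C :> R[i] by rewrite ltcR invn_gt0.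
  have [p pF] := Fc _ nC; rewrite -ball_normE in pF.
  have [x px] := embed_dense p (invn_gt0 n); exists x.
  apply: filterS pF => q /=; rewrite rnormE ltcR => pq.
  rewrite -(subrKA p) (le_trans (rnormD _ _)) // rnormBC; lra.
have uu n m : snorm B (u n - u m) <= 2 * (invn n + invn m).
  rewrite -rnorm_embed embedB.
  have [p [pn pm]] := filter_ex (filterI (uF n) (uF m)).
  rewrite -(subrKA p) (le_trans (rnormD _ _)) // rnormBC.
  by move: pn pm => /=; lra.
have /choice[f fP] y : exists l, forall n,
    cre `|l - B (u n) y| <= 2 * (2 * snorm B y) * invn n.
  apply: cauchy_invn => n m; rewrite -sipBl (le_trans (cauchy_schwarz _ _ _)) //.
  by rewrite mulrAC ler_wpM2r ?snorm_ge0.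
have fB n y : cre `|f y - B (u n) y| <= 4 * invn n * snorm B y.
  by rewrite (le_trans (fP y n)) //; lra.
have fc (e : R) : 0 < e ->
    exists x, forall y, cre `|f y - B x y| <= e * snorm B y.
  move=> e0; have [|N /(_ N (leqnn N)) Ne] := @invn_small R (e / 4).
    by rewrite divr_gt0.
  exists (u N) => y; rewrite (le_trans (fB N y)) // ler_wpM2r ?snorm_ge0 //.
  by lra.
apply/cvg_ex; exists (Completion fc).
apply/cvgrPdist_lt => _ /gt0_realC[e e0 ->].
have [|N /(_ N (leqnn N)) Ne] := @invn_small R (e / 8); first by rewrite divr_gt0.
apply: filterS (uF N) => p /= pN; rewrite rnormE ltcR.
rewrite -(subrKA (embed (u N))) (le_lt_trans (rnormD _ _)) //.
have : rnorm (Completion fc - embed (u N)) <= 4 * invn N.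
  apply: completion_norm_le => [|y]; last by rewrite cfunB /= fB.
  by rewrite mulr_ge0 // ltW // invn_gt0.
by rewrite (rnormBC (embed _)); have := @invn_gt0 R N; lra.
Qed.

HB.instance Definition _ := Uniform_isComplete.Build completion complete.

(** An element of the completion is a bare function, so additivity has to be inherited from [B]
    through approximating vectors. *)
Lemma cfunBr p x y : p (x - y) = p x - p y.
Proof.
apply/eqP; rewrite -subr_eq0; apply/eqP/cre_norm_eq0/eqP.
rewrite eq_le cre_norm_ge0 andbT.
have [u uP] := embed_approx p; pose C := snorm B (x - y) + snorm B x + snorm B y.
apply: (@le_invn _ _ _ C) => [|n]; first by rewrite !addr_ge0 ?snorm_ge0.
rewrite add0r mulrC (_ : _ - _ = (p - embed (u n)) (x - y) -
    (p - embed (u n)) x + (p - embed (u n)) y); last first.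
  by rewrite !cfunB /= sipBr; ring.
have le z : cre `|(p - embed (u n)) z| <= invn n * snorm B z.
  by rewrite (le_trans (cfun_le _ _)) // ler_wpM2r ?snorm_ge0.
rewrite (le_trans (cre_normD _ _)) // /C mulrDr lerD //.
by rewrite (le_trans (cre_normD _ _)) // cre_normN mulrDr lerD.
Qed.

(** The pairing of [p] with [q] is the limit of [p x] as [x] tends to [q]; the estimate determines
    its value. *)
Lemma completion_ip_ex p q : exists l,
  forall x, cre `|l - p x| <= rnorm p * rnorm (q - embed x).
Proof.
have [u uP] := embed_approx q; have p0 := rnorm_ge0 p.
have un n : 0 <= invn n :> R by rewrite ltW // invn_gt0.
have [|l lP] := @cauchy_invn _ (fun n => p (u n)) (rnorm p).
  move=> n m; rewrite -cfunBr (le_trans (cfun_le _ _)) // ler_wpM2l //.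
  rewrite -rnorm_embed embedB -(subrKA q) (le_trans (rnormD _ _)) // rnormBC.
  exact: lerD.
exists l => x; apply: (@le_invn _ _ _ (3 * rnorm p)) => [|n].
  by rewrite mulr_ge0.
rewrite -(subrKA (p (u n))) (le_trans (cre_normD _ _)) //.
have h1 : cre `|p (u n) - p x| <= rnorm p * snorm B (u n - x).
  by rewrite -cfunBr cfun_le.
have h2 : snorm B (u n - x) <= invn n + rnorm (q - embed x).
  rewrite -rnorm_embed embedB -(subrKA q) (le_trans (rnormD _ _)) //.
  by rewrite rnormBC lerD2r.
have := lP n; nra.
Qed.

Definition completion_ip p q : R[i] := projT1 (cid (completion_ip_ex p q)).

Lemma completion_ipP p q x :
  cre `|completion_ip p q - p x| <= rnorm p * rnorm (q - embed x).
Proof. by rewrite /completion_ip; case: cid => l /=. Qed.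

(** Testing only vectors within distance 1 of [q] turns an estimate quadratic in that distance into
    a linear one, as the pairing of [p] with itself requires. *)
Lemma completion_ip_unique p q (l : R[i]) (C : R) :
  (forall x, rnorm (q - embed x) <= 1 ->
    cre `|l - p x| <= C * rnorm (q - embed x)) -> completion_ip p q = l.
Proof.
move=> lC; apply/eqP; rewrite -subr_eq0; apply/eqP/cre_norm_eq0/eqP.
rewrite eq_le cre_norm_ge0 andbT; have [u uP] := embed_approx q.
apply: (@le_invn _ _ _ (rnorm p + `|C|)) => [|n].
  by rewrite addr_ge0 ?rnorm_ge0.
have n1 : invn n <= 1 :> R by rewrite invf_le1 ?ltr0n // ler1n.
rewrite add0r -(subrKA (p (u n))) (le_trans (cre_normD _ _)) // mulrDl lerD //.
  by rewrite (le_trans (completion_ipP _ _ _)) // ler_wpM2l ?rnorm_ge0.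
rewrite -cre_normN opprB (le_trans (lC _ (le_trans (uP n) n1))) //.
apply: (@le_trans _ _ (`|C| * rnorm (q - embed (u n)))).
  by rewrite ler_wpM2r ?rnorm_ge0 // ler_norm.
by rewrite ler_wpM2l.
Qed.

Lemma completion_ip_embed p x : completion_ip p (embed x) = p x.
Proof.
apply/eqP; rewrite -subr_eq0; apply/eqP/cre_norm_eq0/eqP.
rewrite eq_le cre_norm_ge0 andbT.
by have := completion_ipP p (embed x) x; rewrite subrr rnorm0 mulr0.
Qed.

Let ipPl k p q r :
  completion_ip (k *: p + q) r = k * completion_ip p r + completion_ip q r.
Proof.
apply: (@completion_ip_unique _ _ _ (cre `|k| * rnorm p + rnorm q)) => x _.
rewrite cfunD cfunZ (_ : _ - _ = k * (completion_ip p r - p x) +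
  (completion_ip q r - q x)); last by ring.
rewrite (le_trans (cre_normD _ _)) // mulrDl lerD ?completion_ipP //.
by rewrite cre_normM -mulrA ler_wpM2l ?cre_norm_ge0 ?completion_ipP.
Qed.

Let ipC p q : completion_ip q p = (completion_ip p q)^*.
Proof.
apply: (@completion_ip_unique _ _ _ (rnorm q)) => x _.
have [u uP] := embed_approx q.
apply: (@le_invn _ _ _ (rnorm p + snorm B x + rnorm (p - embed x))) => [|n].
  by rewrite !addr_ge0 ?rnorm_ge0 ?snorm_ge0.
have h1 : cre `|(completion_ip p q - p (u n))^*| <= rnorm p * invn n.
  rewrite cre_normJ (le_trans (completion_ipP _ _ _)) //.
  by rewrite ler_wpM2l ?rnorm_ge0.
have h2 : cre `|(p (u n) - B x (u n))^*| <=
    rnorm (p - embed x) * (rnorm q + invn n).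
  rewrite cre_normJ -[B x _]/(embed x _) -cfunB (le_trans (cfun_le _ _)) //.
  rewrite ler_wpM2l ?rnorm_ge0 // -rnorm_embed -(subrK q (embed _)).
  by rewrite (le_trans (rnormD _ _)) // addrC lerD2l rnormBC.
have h3 : cre `|q x - B (u n) x| <= snorm B x * invn n.
  rewrite -[B _ x]/(embed _ x) -cfunB (le_trans (cfun_le _ _)) // mulrC.
  by rewrite ler_wpM2l ?snorm_ge0.
rewrite (_ : _ - _ = (completion_ip p q - p (u n))^* +
  (p (u n) - B x (u n))^* - (q x - B (u n) x)); last first.
  by rewrite (sipC B (u n) x) !(conjcD, conjcN, conjcKK); ring.
rewrite (le_trans (cre_normD _ _)) // cre_normN.
by have := cre_normD (completion_ip p q - p (u n))^* (p (u n) - B x (u n))^*; nra.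
Qed.

Let ip_norm p : completion_ip p p = `|p| ^+ 2.
Proof.
rewrite rnormE -rmorphXn; apply: (@completion_ip_unique _ _ _ (3 * rnorm p + 2)).
move=> x px; have h1 : cre `|p x - B x x| <= rnorm (p - embed x) * snorm B x.
  by rewrite -[B x x]/(embed x x) -cfunB cfun_le.
have h2 : snorm B x <= rnorm p + rnorm (p - embed x).
  rewrite -rnorm_embed -{1}(subrK p (embed x)) (le_trans (rnormD _ _)) // addrC.
  by rewrite lerD2l rnormBC.
have h3 : rnorm p <= snorm B x + rnorm (p - embed x).
  rewrite -rnorm_embed -{1}(subrK (embed x) p) (le_trans (rnormD _ _)) //.
  by rewrite addrC.
have h4 : cre `|(rnorm p ^+ 2)%:C - B x x| <=
    rnorm (p - embed x) * (rnorm p + snorm B x).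
  rewrite sip_snorm -rmorphB cre_norm_real ler_norml.
  have := rnorm_ge0 p; have := snorm_ge0 B x; have := rnorm_ge0 (p - embed x).
  by move=> a b c; apply/andP; split; nra.
rewrite (_ : _ - p x = ((rnorm p ^+ 2)%:C - B x x) - (p x - B x x)); last by ring.
rewrite (le_trans (cre_normD _ _)) // cre_normN.
have := rnorm_ge0 p; have := snorm_ge0 B x; have := rnorm_ge0 (p - embed x).
by nra.
Qed.

HB.instance Definition _ := isHilbert.Build R completion ipPl ipC ip_norm.

End completion.

(** * Extreme functionals *)

Section extreme_functionals.
Context {R : realType} {V : lmodType R[i]}.
Implicit Types (p q f g : V -> R) (x y v : V).

Definition sublinear p :=
  (forall x y, p (x + y) <= p x + p y) /\
  (forall (r : R) x, 0 <= r -> p (r%:C *: x) = r * p x).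

Definition real_linear q :=
  (forall x y, q (x + y) = q x + q y) /\
  (forall (r : R) x, q (r%:C *: x) = r * q x).

Lemma real_linear0 q : real_linear q -> q 0 = 0.
Proof. by move=> [qD _]; apply: (addrI (q 0)); rewrite -qD !addr0. Qed.

Lemma real_linearN q x : real_linear q -> q (- x) = - q x.
Proof.
move=> ql; have [qD _] := ql.
by apply: (addrI (q x)); rewrite -qD !subrr real_linear0.
Qed.

Lemma sublinear0 p : sublinear p -> p 0 = 0.
Proof. by move=> [_ /(_ 0 0 (lexx 0))]; rewrite scaler0 mul0r. Qed.

Lemma sublinearN p x : sublinear p -> - p (- x) <= p x.
Proof.
move=> ps; have [pD _] := ps; have := pD x (- x).
by rewrite subrr sublinear0 // => ?; lra.
Qed.

Definition dominated p q := forall x, q x <= p x.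

Lemma dominated_ge p q x : sublinear q -> dominated p q -> - p (- x) <= q x.
Proof. by move=> qs qp; have := sublinearN x qs; have := qp (- x); lra. Qed.

(* The support function of the face where a functional dominated by p takes
   its largest value p v at v. *)
Definition face_support p v x : R :=
  inf [set p (x + t%:C *: v) - t * p v | t in [set t | 0 <= t]].

Lemma face_support_has_inf p v x : sublinear p ->
  has_inf [set p (x + t%:C *: v) - t * p v | t in [set t | 0 <= t]].
Proof.
move=> ps; have [pD pZ] := ps; split.
  by exists (p (x + 0%:C *: v) - 0 * p v), 0 => //=.
exists (- p (- x)) => _ [t /= t0 <-]; rewrite -(pZ _ _ t0).
by have := pD (- x) (x + t%:C *: v); rewrite addKr; lra.
Qed.

Lemma face_support_le p v x (t : R) : sublinear p -> 0 <= t ->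
  face_support p v x <= p (x + t%:C *: v) - t * p v.
Proof.
by move=> ps t0; apply: ge_inf; [have [] := face_support_has_inf v x ps|exists t].
Qed.

Lemma face_support_ge p v x (c : R) : sublinear p ->
  (forall t, 0 <= t -> c <= p (x + t%:C *: v) - t * p v) ->
  c <= face_support p v x.
Proof.
move=> ps ct; apply: lb_le_inf => [|_ [t /= t0 <-]]; last exact: ct.
by have [] := face_support_has_inf v x ps.
Qed.

Lemma face_support_dominated p v : sublinear p -> dominated p (face_support p v).
Proof.
move=> ps x; have := face_support_le v x ps (lexx 0).
by rewrite scale0r addr0 mul0r subr0.
Qed.

Lemma face_supportN p v : sublinear p -> face_support p v (- v) <= - p v.
Proof.
move=> ps; have := face_support_le v (- v) ps ler01.
by rewrite scale1r addNr sublinear0 // mul1r sub0r.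
Qed.

Lemma face_support_sublinear p v : sublinear p -> sublinear (face_support p v).
Proof.
move=> ps; have [pD pZ] := ps; split=> [x y|r x r0].
  rewrite -lerBlDl; apply: face_support_ge => // s s0.
  rewrite lerBlDl -lerBlDr; apply: face_support_ge => // t t0.
  rewrite lerBlDr; apply: (le_trans (face_support_le v _ ps (addr_ge0 t0 s0))).
  rewrite rmorphD scalerDl addrACA mulrDl.
  by have := pD (x + t%:C *: v) (y + s%:C *: v); lra.
have le (s : R) y : 0 < s -> face_support p v (s%:C *: y) <= s * face_support p v y.
  move=> s0; rewrite -ler_pdivrMl //; apply: face_support_ge => // t t0.
  rewrite ler_pdivrMl // mulrBr mulrA -(pZ _ _ (ltW s0)) scalerDr scalerA.
  by rewrite -rmorphM; apply: face_support_le; rewrite ?mulr_ge0 // ltW.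
move: r0; rewrite le_eqVlt => /predU1P[<-|r0].
  rewrite scale0r mul0r; apply/eqP; rewrite eq_le; apply/andP; split.
    by rewrite -[leRHS](sublinear0 ps) face_support_dominated.
  by apply: face_support_ge => // t t0; rewrite add0r pZ // subrr.
apply/eqP; rewrite eq_le le // andTb -ler_pdivlMl //.
have r0' : 0 < r^-1 by rewrite invr_gt0.
have := le _ (r%:C *: x) r0'; rewrite scalerA -rmorphM mulVf ?gt_eqF //.
by rewrite rmorph1 scale1r.
Qed.

(** In terms of support functions: the functionals dominated by [q] form a face of those dominated
    by [p]. *)
Definition face p q := forall f g, real_linear f -> real_linear g ->
  dominated p f -> dominated p g -> (forall x, f x + g x <= 2 * q x) ->
  dominated q f /\ dominated q g.

Lemma face_face_support p q v : sublinear q -> dominated p q -> face p q ->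
  face p (face_support q v).
Proof.
move=> qs qp qf f g fl gl fp gp fg.
have sq := face_support_dominated v qs.
have [|fq gq] := qf f g fl gl fp gp.
  by move=> x; apply: (le_trans (fg x)); rewrite ler_wpM2l.
(* At [- v] the hypothesis gives f v + g v >= 2 q v, while [f] and [g] are at most [q]; so both
   equal [q v] at [v]. *)
have := fg (- v); rewrite (real_linearN _ fl) (real_linearN _ gl) => fgv.
have := face_supportN v qs; have := fq v; have := gq v => gv fv sv.
have [[fD fZ] [gD gZ]] := (fl, gl).
split=> x; apply: face_support_ge => // t t0.
  have -> : q v = f v by lra.
  by have := fq (x + t%:C *: v); rewrite fD fZ; lra.
have -> : q v = g v by lra.
by have := gq (x + t%:C *: v); rewrite gD gZ; lra.
Qed.

(** The pointwise infimum is finite because every member is at least [- p (- x)]; its subadditivity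
    uses the smaller of two members of the chain. *)
Lemma chain_inf (A : set (V -> R)) p : A !=set0 ->
  (forall q q', A q -> A q' -> dominated q q' \/ dominated q' q) ->
  (forall q, A q -> [/\ sublinear q, dominated p q & face p q]) ->
  exists m, [/\ sublinear m, dominated p m, face p m &
    forall q, A q -> dominated q m].
Proof.
move=> [q0 Aq0] tot AP; pose m x := inf [set q x | q in A].
have hi x : has_inf [set q x | q in A].
  split; first by exists (q0 x), q0.
  exists (- p (- x)) => _ [q Aq <-]; have [qs qp _] := AP q Aq.
  exact: dominated_ge.
have mle q x : A q -> m x <= q x by move=> Aq; apply: ge_inf; [have [] := hi x|exists q].
have mge (x : V) (c : R) : (forall q, A q -> c <= q x) -> c <= m x.
  move=> cq; apply: lb_le_inf => [|_ [q Aq <-]]; last exact: cq.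
  by have [] := hi x.
exists m; split=> [||f g fl gl fp gp fg|q Aq x]; last exact: mle.
- split=> [x y|r x].
    rewrite -lerBlDl; apply: (mge _ _) => q Aq; rewrite lerBlDl -lerBlDr.
    apply: mge => q' Aq'; rewrite lerBlDr.
    have [le|le] := tot q q' Aq Aq'.
      have [[q'D _] _ _] := AP q' Aq'.
      by have := mle _ (x + y) Aq'; have := q'D x y; have := le y; lra.
    have [[qD _] _ _] := AP q Aq.
    by have := mle _ (x + y) Aq; have := qD x y; have := le x; lra.
  rewrite le_eqVlt => /predU1P[<-|r0].
    rewrite scale0r mul0r; apply/eqP; rewrite eq_le; apply/andP; split.
      by have [q0s _ _] := AP q0 Aq0; rewrite -[leRHS](sublinear0 q0s) mle.
    by apply: mge => q Aq; rewrite sublinear0 //; have [] := AP q Aq.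
  apply/eqP; rewrite eq_le; apply/andP; split.
    rewrite -ler_pdivrMl //; apply: mge => q Aq; rewrite ler_pdivrMl //.
    have [[_ qZ] _ _] := AP q Aq.
    by rewrite -(qZ _ _ (ltW r0)); exact: mle.
  apply: mge => q Aq; have [[_ qZ] _ _] := AP q Aq.
  by rewrite (qZ _ _ (ltW r0)) ler_pM2l //; exact: mle.
- by move=> x; apply: (le_trans (mle q0 x Aq0)); have [_ + _] := AP q0 Aq0.
have fgq q : A q -> dominated q f /\ dominated q g.
  move=> Aq; have [_ _ qf] := AP q Aq; apply: qf => // x.
  by apply: (le_trans (fg x)); rewrite ler_wpM2l //; exact: mle.
by split=> x; apply: mge => q /fgq[].
Qed.

(* Hahn-Banach and Krein-Milman at once: a minimal sublinear functional among
   the support functions of faces is linear, hence an extreme point. *)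
Lemma extreme_functional p v : sublinear p -> exists q,
  [/\ real_linear q, dominated p q, q v = p v &
    forall f g, real_linear f -> real_linear g -> dominated p f ->
      dominated p g -> (forall x, f x + g x = 2 * q x) -> f =1 q].
Proof.
move=> ps; pose p1 := face_support p v.
pose P q := [/\ sublinear q, dominated p q, face p q & dominated p1 q].
pose T := {q : V -> R | P q}.
have P1 : P p1.
  split; [exact: face_support_sublinear|exact: face_support_dominated| |by move=> ?].
  by apply: face_face_support => // f g.
(* The order is reversed, so a maximal element is a minimal support function. All of them lie below
   [p1], which forces [q v = p v]. *)
pose Rl (a b : T) := `[< dominated (sval a) (sval b) >].
have [|||[q [qs qp qf qp1]] qmin] := @ZL_preorder T (exist _ p1 P1) Rl.
- by move=> a; apply/asboolP => x.
- move=> b a c /asboolP ab /asboolP bc; apply/asboolP => x.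
  exact: le_trans (bc x) (ab x).
- move=> A tot; have [[a0 Aa0]|A0] := pselect (A !=set0); last first.
    by exists (exist _ p1 P1) => s As; exfalso; apply: A0; exists s.
  have [|||m [ms mp mf mA]] := @chain_inf [set sval a | a in A] p.
  + by exists (sval a0), a0.
  + move=> _ _ [a Aa <-] [b Ab <-]; have := tot a b Aa Ab.
    by case=> /asboolP; [left|right].
  + by move=> _ [[a [aP aP' aP'' aP3]] Aa <-].
  have Pm : P m.
    split=> // x; have := mA _ (ex_intro2 _ _ _ Aa0 erefl) x => /le_trans; apply.
    by case: a0 {Aa0} => a [].
  by exists (exist _ m Pm) => s As; apply/asboolP; apply: mA; exists s.
(* Face supports of [q] are admissible again, so minimality puts [q] below each of them. With
   [w = x] at the point [- x] this reads q (- x) <= - q x, whence linearity. *)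
have qmin' w x : q x <= face_support q w x.
  have Pw : P (face_support q w).
    have qw := face_support_dominated w qs.
    split=> [|y||y]; first exact: face_support_sublinear.
    - exact: le_trans (qw y) (qp y).
    - exact: face_face_support.
    - exact: le_trans (qw y) (qp1 y).
  have /asboolP := qmin (exist _ _ Pw) (asboolT (face_support_dominated w qs)).
  by apply.
have qN x : q (- x) = - q x.
  apply/eqP; rewrite eq_le; apply/andP; split.
    exact: le_trans (qmin' x (- x)) (face_supportN x qs).
  by have := sublinearN (- x) qs; rewrite opprK; lra.
have [qD qZ] := qs; have ql : real_linear q.
  split=> [x y|r x].
    apply/eqP; rewrite eq_le qD andTb.
    by have := qD (x + y) (- y); rewrite addrK qN; lra.
  have [r0|/ltW r0] := leP 0 r; first exact: qZ.
  have := qZ (- r) x; rewrite oppr_ge0 => /(_ r0).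
  by rewrite rmorphN scaleNr qN mulNr => /oppr_inj.
exists q; split=> //.
  apply/eqP; rewrite eq_le qp andTb.
  have := le_trans (qp1 (- v)) (face_supportN v ps).
  by rewrite qN lerN2.
move=> f g fl gl fp gp fg x.
have [|fq _] := qf f g fl gl fp gp; first by move=> y; rewrite fg.
apply/eqP; rewrite eq_le fq andTb.
by have := fq (- x); rewrite qN real_linearN // lerN2.
Qed.

End extreme_functionals.

(** * Representations and primitive ideals *)

Section representations.
Context {R : realType} {A : cstarAlgType R} {H : hilbertType R}.
Variables (pi : A -> H -> H) (rpi : representation pi).
Implicit Types (a b : A) (x y : H).

Lemma rep0l x : pi 0 x = 0.
Proof.
have := rep_linear_alg rpi (-1) 0 0 x.
by rewrite !scaleN1r oppr0 addr0 addNr.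
Qed.

Lemma rep0r a : pi a 0 = 0.
Proof. exact: lin0 (rep_linear rpi a). Qed.

Lemma repDl a b x : pi (a + b) x = pi a x + pi b x.
Proof. by have := rep_linear_alg rpi 1 a b x; rewrite !scale1r. Qed.

Lemma repZl (k : R[i]) a x : pi (k *: a) x = k *: pi a x.
Proof. by have := rep_linear_alg rpi k a 0 x; rewrite rep0l !addr0. Qed.

Lemma repNl a x : pi (- a) x = - pi a x.
Proof. by rewrite -scaleN1r repZl scaleN1r. Qed.

Lemma repBl a b x : pi (a - b) x = pi a x - pi b x.
Proof. by rewrite repDl repNl. Qed.

Lemma repBr a x y : pi a (x - y) = pi a x - pi a y.
Proof. exact: linB (rep_linear rpi a). Qed.

Lemma rep_cre_star a x : cre (ip (pi (star a ** a) x) x) = rnorm (pi a x) ^+ 2.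
Proof. by rewrite (rep_mul rpi) (rep_star rpi) starK cre_ip_norm. Qed.

(** For a contraction [b] write [star b ** b] as 2 w - w^2 with [w] self-adjoint; then |x|^2 - |pi b
    x|^2 = |x - pi w x|^2. *)
Lemma rep_contractive a x : rnorm (pi a x) <= rnorm a * rnorm x.
Proof.
have le1 b : rnorm b <= 1 -> rnorm (pi b x) <= rnorm x.
  move=> b1; have bb1 : rnorm (star b ** b) <= 1.
    by rewrite rnorm_star_mul expr_le1 ?rnorm_ge0.
  have [w [_ wE ws _]] := one_sub_sqrt bb1.
  have {}ws : star w = w by apply: ws; rewrite starM starK.
  rewrite -(@ler_pXn2r _ 2) ?nnegrE ?rnorm_ge0 // -rep_cre_star.
  have -> : star b ** b = w + w - w ** w by rewrite wE addrK.
  rewrite repBl repDl ip_Bl ip_Dl creB creD -{3}ws rep_cre_star.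
  have := sqr_ge0 (rnorm (x - pi w x)).
  by rewrite sqr_rnormB cre_ip_C; lra.
have [->|a0] := eqVneq a 0; first by rewrite rep0l !rnorm0 mul0r.
have apos := rnorm_gt0 a0; rewrite -ler_pdivrMl //.
have {1}-> : (rnorm a)^-1 = `|(rnorm a)^-1| by rewrite ger0_norm ?invr_ge0 ?rnorm_ge0.
rewrite -rnormZr -repZl; apply: le1.
by rewrite rnormZr ger0_norm ?invr_ge0 ?rnorm_ge0 // mulVf ?gt_eqF.
Qed.

Lemma rep_cvg (u : nat -> A) a x :
  u @ \oo --> a -> (fun n => pi (u n) x) @ \oo --> pi a x.
Proof.
move=> /cvgn_rnormP ua; apply/cvgn_rnormP => e e0.
have x1 : 0 < rnorm x + 1 by rewrite ltr_wpDl ?rnorm_ge0.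
have [|N Nu] := ua (e / (rnorm x + 1)); first by rewrite divr_gt0.
exists N => n /Nu; rewrite ltr_pdivlMr // => un.
rewrite -repBl (le_lt_trans (rep_contractive _ _)) //.
have := rnorm_ge0 (a - u n); nra.
Qed.

End representations.

Section kernels.
Context {R : realType} {A : cstarAlgType R}.
Implicit Types (a b : A) (P : prim A).

Lemma primP P : exists (H : hilbertType R) (pi : A -> H -> H),
  irreducible_rep pi /\ forall a, prim_set P a <-> forall x, pi a x = 0.
Proof.
by case: P => P [H [pi [irr PE]]] /=; exists H, pi; split => // a; rewrite PE.
Qed.

Lemma prim_closed P : closed (prim_set P).
Proof.
have [H [pi [[rpi _ _] PE]]] := primP P.
apply/closed_rnormP => a aP; apply/PE => x; apply: rnorm_le0 => e e0.
have x1 : 0 < rnorm x + 1 by rewrite ltr_wpDl ?rnorm_ge0.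
have [|b /PE Pb ab] := aP (e / (rnorm x + 1)); first by rewrite divr_gt0.
rewrite -[pi a x]subr0 -(Pb x) -(repBl rpi).
rewrite (le_trans (rep_contractive rpi _ _)) //.
move: ab; rewrite ltr_pdivlMr // => ab; have := rnorm_ge0 (a - b); nra.
Qed.

Lemma primM P a b : prim_set P a -> prim_set P (a ** b) /\ prim_set P (b ** a).
Proof.
have [H [pi [[rpi _ _] PE]]] := primP P => /PE Pa.
split; apply/PE => x; rewrite (rep_mul rpi) Pa //.
exact: rep0r.
Qed.

Lemma prim_star P a : prim_set P a -> prim_set P (star a).
Proof.
have [H [pi [[rpi _ _] PE]]] := primP P => /PE Pa.
by apply/PE => x; apply: ip_eq0 => y; rewrite (rep_star rpi) starK Pa ip_0r.
Qed.

Lemma prim_linear P (k : R[i]) a b :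
  prim_set P a -> prim_set P b -> prim_set P (k *: a + b).
Proof.
have [H [pi [[rpi _ _] PE]]] := primP P => /PE Pa /PE Pb.
by apply/PE => x; rewrite (rep_linear_alg rpi) Pa Pb scaler0 addr0.
Qed.

Lemma prim0 P : prim_set P 0.
Proof. by have [H [pi [[rpi _ _] PE]]] := primP P; apply/PE => x; exact: rep0l. Qed.

Lemma primD P a b : prim_set P a -> prim_set P b -> prim_set P (a + b).
Proof. by move=> Pa Pb; rewrite -[a]scale1r; exact: prim_linear. Qed.

Lemma primN P a : prim_set P a -> prim_set P (- a).
Proof.
by move=> Pa; rewrite -scaleN1r -[_ *: _]addr0; apply: prim_linear => //; exact: prim0.
Qed.

End kernels.

Section irreducible.
Context {R : realType} {A : cstarAlgType R} {H : hilbertType R}.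
Variables (pi : A -> H -> H).

Lemma irreducible_full (W : set H) x : irreducible_rep pi -> closed W ->
  invariant_subspace pi W -> W x -> x != 0 -> W = setT.
Proof.
move=> [_ _ irr] Wcl Winv Wx x0; have [W0|//] := irr W Wcl Winv.
by move: Wx; rewrite W0 /= => x0'; rewrite x0' eqxx in x0.
Qed.

Lemma irreducible_ind (W : set H) : irreducible_rep pi -> closed W ->
  subspace W -> (forall a x, W (pi a x)) -> W = setT.
Proof.
move=> irr Wcl [W0 WZ] Wpi; have [rpi [a [x pax]] _] := irr.
by apply: (irreducible_full (x := pi a x)) => //; split => // b y _; exact: Wpi.
Qed.

(** The vectors killed by the whole algebra form a closed invariant subspace, and it is proper
    because some [pi a z] is nonzero. *)
Lemma irreducible_nondegenerate x : irreducible_rep pi ->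
  (forall a, pi a x = 0) -> x = 0.
Proof.
move=> irr; have [rpi [a [z paz]] _] := irr.
pose W := [set y | forall b, pi b y = 0] => Wx.
apply/eqP; apply: contra_neqT paz => x0; suff WT : W = setT.
  by have : W z by rewrite WT.
apply: (irreducible_full (x := x)) => //.
  apply/closed_rnormP => y yW b; apply: rnorm_le0 => e e0.
  have b1 : 0 < rnorm b + 1 by rewrite ltr_wpDl ?rnorm_ge0.
  have [|w Ww yw] := yW (e / (rnorm b + 1)); first by rewrite divr_gt0.
  rewrite -[pi b y]subr0 -(Ww b) -(repBr rpi).
  rewrite (le_trans (rep_contractive rpi _ _)) //.
  move: yw; rewrite ltr_pdivlMr // => yw; have := rnorm_ge0 (y - w); nra.
split=> [b|k u v Wu Wv b|b u Wu c]; first exact: rep0r.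
  by rewrite (rep_linear rpi) Wu Wv scaler0 addr0.
by rewrite -(rep_mul rpi).
Qed.

End irreducible.

(** * Limits of vector states *)

Record bundled_rep (R : realType) (B : cstarAlgType R) := BundledRep {
  rep_space : hilbertType R;
  rep_map :> B -> rep_space -> rep_space;
  rep_mapP : representation rep_map
}.

Section unitization.
Context {R : realType} {B : cstarAlgType R}.

(** States are normalized at a unit, which [B] may lack. Only the algebraic structure is built;
    [ubound] dominates the operator norm in every representation and stands in for a norm. *)
Definition unitization : lmodType R[i] := (B * R[i])%type.
Implicit Types (x y z : unitization) (k : R[i]).

Definition umul x y : unitization :=
  (x.1 ** y.1 + x.2 *: y.1 + y.2 *: x.1, x.2 * y.2).
Definition ustar x : unitization := (star x.1, x.2^*).
Definition uone : unitization := (0, 1).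
Definition ubound x : R := rnorm x.1 + cre `|x.2|.

Lemma ubound_ge0 x : 0 <= ubound x.
Proof. by rewrite addr_ge0 ?rnorm_ge0 ?cre_norm_ge0. Qed.

Lemma umulA x y z : umul x (umul y z) = umul (umul x y) z.
Proof.
congr pair; last by rewrite /= mulrA.
rewrite /= !cmulDr !cmulDl !cmulZl !cmulZr !scalerDr !scalerA cmulA.
by rewrite [z.2 * x.2]mulrC [z.2 * y.2]mulrC; zmodule.
Qed.

Lemma umul_linr k x y z : umul z (k *: x + y) = k *: umul z x + umul z y.
Proof.
congr pair; rewrite /=; last by rewrite mulrDr mulrCA.
rewrite !cmulDr !cmulZr !scalerDr !scalerDl !scalerA [z.2 * k]mulrC.
by rewrite -[k *: x.2]/(k * x.2); zmodule.
Qed.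

Lemma umul_linl k x y z : umul (k *: x + y) z = k *: umul x z + umul y z.
Proof.
congr pair; rewrite /=; last by rewrite mulrDl -mulrA.
rewrite !cmulDl !cmulZl !scalerDr !scalerDl !scalerA [z.2 * k]mulrC.
by rewrite -[k *: x.2]/(k * x.2); zmodule.
Qed.

Lemma umulx1 x : umul x uone = x.
Proof.
by case: x => a k; congr pair; rewrite /= ?mulr1 // cmul0r scaler0 scale1r !add0r.
Qed.

Lemma ustarK x : ustar (ustar x) = x.
Proof. by case: x => a k; congr pair; rewrite /= ?starK ?conjcKK. Qed.

Lemma ustarM x y : ustar (umul x y) = umul (ustar y) (ustar x).
Proof.
congr pair; rewrite /=; last by rewrite conjcM mulrC.
by rewrite !starD starM !starZ addrAC.
Qed.

Lemma ustar_lin k x y : ustar (k *: x + y) = k^* *: ustar x + ustar y.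
Proof. by congr pair; rewrite /= ?starD ?starZ // conjcD conjcM. Qed.

Lemma ustar1 : ustar uone = uone.
Proof. by congr pair; rewrite /= ?star0 // rmorph1. Qed.

Variable s : bundled_rep B.
Let rs := rep_mapP s.

Definition uext x (v : rep_space s) : rep_space s := s x.1 v + x.2 *: v.

Lemma uext_lin k x y v : uext (k *: x + y) v = k *: uext x v + uext y v.
Proof.
rewrite /uext /= (rep_linear_alg rs) scalerDl scalerDr scalerA.
by rewrite -[k *: x.2]/(k * x.2); zmodule.
Qed.

Lemma uextN x v : uext (- x) v = - uext x v.
Proof. by rewrite /uext /= (repNl rs) scaleNr opprD. Qed.

Lemma uextZ k x v : uext (k *: x) v = k *: uext x v.
Proof.
by rewrite /uext /= (repZl rs) scalerDr scalerA.
Qed.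

Lemma uextD x y v : uext (x + y) v = uext x v + uext y v.
Proof. by have := uext_lin 1 x y v; rewrite !scale1r. Qed.

Lemma uext1 v : uext uone v = v.
Proof. by rewrite /uext /= (rep0l rs) scale1r add0r. Qed.

Lemma uextM x y v : uext (umul x y) v = uext x (uext y v).
Proof.
rewrite /uext /= !(repDl rs) !(repZl rs) (rep_mul rs) scalerDr scalerA.
by rewrite (linD _ _ (rep_linear rs _)) (linZ _ _ (rep_linear rs _)); zmodule.
Qed.

Lemma uext_star x v w : ip (uext x v) w = ip v (uext (ustar x) w).
Proof. by rewrite ip_Dl ip_Dr ip_Zl ip_Zr (rep_star rs) /= conjcKK. Qed.

Lemma uext_bound x v : rnorm (uext x v) <= ubound x * rnorm v.
Proof.
rewrite (le_trans (rnormD _ _)) // mulrDl lerD ?(rep_contractive rs) //.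
by rewrite rnormZ.
Qed.

Definition uform x v : R := cre (ip (uext x v) v).

Lemma uform_bound x v : uform x v <= ubound x * rnorm v ^+ 2.
Proof.
rewrite (le_trans (cre_ip_le _ _)) // expr2 mulrA.
by rewrite ler_wpM2r ?rnorm_ge0 // uext_bound.
Qed.

Lemma uformD x y v : uform (x + y) v = uform x v + uform y v.
Proof. by rewrite /uform uextD ip_Dl creD. Qed.

Lemma uformN x v : uform (- x) v = - uform x v.
Proof. by rewrite /uform uextN -scaleN1r ip_Zl mulN1r creN. Qed.

Lemma uformZ (r : R) x v : uform (r%:C *: x) v = r * uform x v.
Proof. by rewrite /uform uextZ ip_Zl creZ. Qed.

Lemma uform1 v : uform uone v = rnorm v ^+ 2.
Proof. by rewrite /uform uext1 cre_ip_norm. Qed.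

Lemma uform_star x v : uform (ustar x) v = uform x v.
Proof. by rewrite /uform uext_star ustarK cre_ip_C. Qed.

Lemma uform_conj x y v : uform (umul (ustar y) (umul x y)) v = uform x (uext y v).
Proof. by rewrite /uform uextM uext_star ustarK uextM. Qed.

Lemma uform_square x v : uform (umul (ustar x) x) v = rnorm (uext x v) ^+ 2.
Proof. by rewrite /uform uextM uext_star ustarK cre_ip_norm. Qed.

End unitization.

Section asymptotic_states.
Context {R : realType} {B : cstarAlgType R}.
Variables (I : Type) (F : set_system I) (FF : ProperFilter F).
Variable s : I -> bundled_rep B.
Hypothesis sN0 : forall i, exists v : rep_space (s i), v != 0.
Local Notation E := (@unitization R B).
Implicit Types (x y z : E).

Definition asymptotic_bound x (t : R) := exists2 S, F S &
  forall i, S i -> forall v : rep_space (s i), uform x v <= t * rnorm v ^+ 2.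

(* The limit superior along F of the numerical ranges: the states it dominates
   are the limits of convex combinations of vector states of the s i. *)
Definition asymptotic_norm x : R := inf [set t | asymptotic_bound x t].
Local Notation p := asymptotic_norm.

Lemma asymptotic_bound_ubound x : asymptotic_bound x (ubound x).
Proof. by exists setT => [|i _ v]; [exact: filterT|exact: uform_bound]. Qed.

Lemma asymptotic_bound_ge x (t c : R) : asymptotic_bound x t ->
  (forall i, exists2 v : rep_space (s i), v != 0 & c * rnorm v ^+ 2 <= uform x v) ->
  c <= t.
Proof.
move=> [S FS St] cx; have [i Si] := filter_ex FS; have [v v0 cv] := cx i.
rewrite -(@ler_pM2r _ (rnorm v ^+ 2)) ?exprn_gt0 ?rnorm_gt0 //.
exact: le_trans cv (St i Si v).
Qed.

Lemma asymptotic_has_inf x : has_inf [set t | asymptotic_bound x t].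
Proof.
split; first by exists (ubound x); exact: asymptotic_bound_ubound.
exists (- ubound (- x)) => t /= xt; apply: (asymptotic_bound_ge xt) => i.
have [v v0] := sN0 i; exists v => //.
by have := uform_bound (- x) v; rewrite uformN; lra.
Qed.

Lemma asymptotic_norm_le x t : asymptotic_bound x t -> p x <= t.
Proof. by move=> xt; apply: ge_inf => //; have [] := asymptotic_has_inf x. Qed.

Lemma asymptotic_norm_ge x c : (forall t, asymptotic_bound x t -> c <= t) -> c <= p x.
Proof.
move=> ct; apply: lb_le_inf => [|t]; last exact: ct.
by have [] := asymptotic_has_inf x.
Qed.

Lemma asymptotic_norm_lt x t : p x < t -> asymptotic_bound x t.
Proof.
move=> /(inf_lt (asymptotic_has_inf x).1)[t' /= [S FS St'] t't].
exists S => // i Si v; apply: (le_trans (St' i Si v)).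
by rewrite ler_wpM2r ?sqr_ge0 // ltW.
Qed.

Lemma asymptotic_norm_le0 x :
  (forall i (v : rep_space (s i)), uform x v <= 0) -> p x <= 0.
Proof.
move=> x0; apply: asymptotic_norm_le; exists setT => [|i _ v]; first exact: filterT.
by rewrite mul0r.
Qed.

Lemma asymptotic_norm1 (r : R) : p (r%:C *: uone) <= r.
Proof.
apply: asymptotic_norm_le; exists setT => [|i _ v]; first exact: filterT.
by rewrite uformZ uform1.
Qed.

Lemma asymptotic_norm_sublinear : sublinear p.
Proof.
have bZ (r t : R) x : 0 < r -> asymptotic_bound x t ->
    asymptotic_bound (r%:C *: x) (r * t).
  move=> r0 [S FS St]; exists S => // i Si v.
  by rewrite uformZ -mulrA ler_wpM2l ?(ltW r0) // St.
have pZ (r : R) x : 0 < r -> p (r%:C *: x) <= r * p x.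
  move=> r0; rewrite -ler_pdivrMl //; apply: asymptotic_norm_ge => t xt.
  by rewrite ler_pdivrMl //; apply: asymptotic_norm_le; exact: bZ.
split=> [x y|r x].
  rewrite -lerBlDl; apply: asymptotic_norm_ge => t [S FS St].
  rewrite lerBlDl -lerBlDr; apply: asymptotic_norm_ge => t' [S' FS' St'].
  rewrite lerBlDr; apply: asymptotic_norm_le; exists (S `&` S'); first exact: filterI.
  move=> i [Si S'i] v; rewrite uformD mulrDl addrC.
  by have := St i Si v; have := St' i S'i v; lra.
rewrite le_eqVlt => /predU1P[<-|r0].
  rewrite scale0r mul0r; apply/eqP; rewrite eq_le; apply/andP; split.
    by have := asymptotic_norm1 0; rewrite scale0r.
  apply: asymptotic_norm_ge => t t0; apply: (asymptotic_bound_ge t0) => i.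
  have [v v0] := sN0 i; exists v => //; rewrite mul0r.
  by rewrite -(scale0r (0 : E)) (uformZ 0) mul0r.
apply/eqP; rewrite eq_le pZ // andTb -ler_pdivlMl //.
have r0' : 0 < r^-1 by rewrite invr_gt0.
have := pZ _ (r%:C *: x) r0'; rewrite scalerA -rmorphM mulVf ?gt_eqF //.
by rewrite rmorph1 scale1r.
Qed.

(** The condition [p (- z) <= 0] says that [z] is asymptotically positive. The element (p x) 1 - x
    is so, and a positive functional with value 1 at the unit is nonnegative on it. *)
Lemma asymptotic_dominated (g : E -> R) : real_linear g -> g uone = 1 ->
  (forall x, p (- x) <= 0 -> 0 <= g x) -> dominated p g.
Proof.
move=> gl g1 gpos x; have [gD gZ] := gl; have [pD _] := asymptotic_norm_sublinear.
have := gpos ((p x)%:C *: uone - x); rewrite gD gZ g1 (real_linearN _ gl) mulr1.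
rewrite subr_ge0; apply; rewrite opprB (le_trans (pD _ _)) //.
by have := asymptotic_norm1 (- p x); rewrite rmorphN scaleNr; lra.
Qed.

(** The form of y* x y at v is the form of x at y v, and |y v| is at most [ubound y] times |v|. *)
Lemma asymptotic_norm_conj x y : p (- x) <= 0 ->
  p (- umul (ustar y) (umul x y)) <= 0.
Proof.
move=> x0; apply/ler_addgt0Pr => e e0; rewrite add0r.
have y1 : 0 < ubound y ^+ 2 + 1 by rewrite ltr_wpDl ?sqr_ge0.
have [|S FS Sx] := @asymptotic_norm_lt (- x) (e / (ubound y ^+ 2 + 1)).
  by rewrite (le_lt_trans x0) // divr_gt0.
apply: asymptotic_norm_le; exists S => // i Si v.
have := Sx i Si (uext y v); rewrite !uformN uform_conj => /le_trans; apply.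
have /= yv := uext_bound y v.
have {}yv : rnorm (uext y v) ^+ 2 <= ubound y ^+ 2 * rnorm v ^+ 2.
  by rewrite -exprMn ler_pXn2r ?nnegrE ?mulr_ge0 ?rnorm_ge0 ?ubound_ge0.
rewrite mulrAC ler_pdivrMr // -mulrA ler_wpM2l ?(ltW e0) // (le_trans yv) //.
by rewrite mulrC ler_wpM2l ?sqr_ge0 // lerDl.
Qed.

End asymptotic_states.

(** * The GNS construction for a limit of vector states *)

Section gns.
Context {R : realType} {B : cstarAlgType R}.
Variables (I : Type) (F : set_system I) (FF : ProperFilter F).
Variable s : I -> bundled_rep B.
Hypothesis sN0 : forall i, exists v : rep_space (s i), v != 0.
Local Notation E := (@unitization R B).
Local Notation p := (asymptotic_norm F s).
Implicit Types (x y z : E) (k : R[i]).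

Variables (q : E -> R) (ql : real_linear q) (qp : dominated p q).

Let qD x y : q (x + y) = q x + q y.
Proof. by have [-> _] := ql. Qed.

Let qZ (r : R) x : q (r%:C *: x) = r * q x.
Proof. by have [_ ->] := ql. Qed.

Let qN x : q (- x) = - q x.
Proof. exact: real_linearN. Qed.

Lemma state_le0 x : (forall i (v : rep_space (s i)), uform x v <= 0) -> q x <= 0.
Proof. by move=> x0; apply: le_trans (qp x) _; exact: asymptotic_norm_le0. Qed.

Lemma state_eq x y :
  (forall i (v : rep_space (s i)), uform x v = uform y v) -> q x = q y.
Proof.
have le z w : (forall i (v : rep_space (s i)), uform z v = uform w v) -> q z <= q w.
  move=> zw; have : q (z - w) <= 0.
    by apply: state_le0 => i v; rewrite uformD uformN zw subrr.
  by rewrite qD qN subr_le0.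
by move=> xy; apply/eqP; rewrite eq_le !le.
Qed.

Lemma state1 : q uone = 1.
Proof.
apply/eqP; rewrite eq_le; apply/andP; split.
  apply: le_trans (qp _) _; rewrite -[uone]scale1r.
  exact: (asymptotic_norm1 FF sN0 1).
rewrite -lerN2 -qN; apply: le_trans (qp _) _; rewrite -scaleN1r.
by have := asymptotic_norm1 FF sN0 (-1); rewrite rmorphN rmorph1.
Qed.

Definition cstate x : R[i] := Complex (q x) (- q ('i *: x)).

Lemma cstate_linear k x y : cstate (k *: x + y) = k * cstate x + cstate y.
Proof.
have e (a b : R) z : Complex a b *: z = a%:C *: z + b%:C *: ('i *: z).
  rewrite scalerA -scalerDl; congr (_ *: _).
  by apply/eqP; rewrite eq_complex /=; apply/andP; split; apply/eqP; ring.
have ii z : 'i *: ('i *: z) = - z by rewrite scalerA -expr2 sqr_i scaleN1r.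
case: k => a b; have -> : Complex a b *: x + y = a%:C *: x + b%:C *: ('i *: x) + y.
  by rewrite e.
rewrite /cstate.
have -> : 'i *: (a%:C *: x + b%:C *: ('i *: x) + y) =
    a%:C *: ('i *: x) - b%:C *: x + 'i *: y.
  rewrite !scalerDr !scalerA ![_%:C * 'i]mulrC !['i * _]mulrC -!scalerA ii.
  by rewrite scalerN.
apply/eqP; rewrite eq_complex /= !qD !qZ qN qZ.
by apply/andP; split; apply/eqP; ring.
Qed.

Lemma cstate_star x : cstate (ustar x) = (cstate x)^*.
Proof.
have qs z : q (ustar z) = q z by apply: state_eq => i v; exact: uform_star.
apply/eqP; rewrite eq_complex /= qs eqxx /= opprK.
have -> : 'i *: ustar x = - ustar ('i *: x).
  have := ustar_lin 'i x 0; rewrite addr0 => ->.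
  have -> : ustar 0 = 0 :> E by congr pair; rewrite /= ?star0 // rmorph0.
  rewrite addr0 -scaleNr; congr (_ *: _).
  by apply/eqP; rewrite eq_complex /= oppr0 opprK !eqxx.
by rewrite qN qs opprK.
Qed.

Definition gns_form x y : R[i] := cstate (umul (ustar y) x).

Lemma gns_formPl k x y z : gns_form (k *: x + y) z = k * gns_form x z + gns_form y z.
Proof. by rewrite /gns_form umul_linr cstate_linear. Qed.

Lemma gns_formC x y : gns_form y x = (gns_form x y)^*.
Proof. by rewrite /gns_form -cstate_star ustarM ustarK. Qed.

Lemma gns_form_ge0 x : 0 <= cre (gns_form x x).
Proof.
rewrite /cre /= -oppr_le0 -qN; apply: state_le0 => i v.
by rewrite uformN uform_square oppr_le0 sqr_ge0.
Qed.

Definition gns_ip := SemiIp gns_formPl gns_formC gns_form_ge0.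
Definition gns_space : hilbertType R := completion gns_ip.
Implicit Types (u v w : gns_space).

(** The inequality y* x* x y <= (ubound x)^2 y* y holds in every [s i], and [state_le0] transfers it
    to the state. *)
Lemma snorm_umul x y : snorm gns_ip (umul x y) <= ubound x * snorm gns_ip y.
Proof.
rewrite -(@ler_pXn2r _ 2) ?nnegrE ?mulr_ge0 ?snorm_ge0 ?ubound_ge0 //.
rewrite exprMn !sqr_snorm /cre /= -subr_le0 -qZ -qN -qD.
apply: state_le0 => i v; rewrite uformD uformN uformZ !uform_square uextM.
rewrite subr_le0 -exprMn ler_pXn2r ?nnegrE ?mulr_ge0 ?rnorm_ge0 ?ubound_ge0 //.
exact: uext_bound.
Qed.

Lemma gns_map_subproof x u (e : R) : 0 < e ->
  exists z, forall y,
    cre `|u (umul (ustar x) y) - gns_ip z y| <= e * snorm gns_ip y.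
Proof.
move=> e0; have x1 : 0 < ubound (ustar x) + 1 by rewrite ltr_wpDl ?ubound_ge0.
have [|z zu] := cfunP u (e := e / (ubound (ustar x) + 1)); first by rewrite divr_gt0.
exists (umul x z) => y.
have -> : gns_ip (umul x z) y = gns_ip z (umul (ustar x) y).
  by rewrite /= /gns_form ustarM ustarK umulA.
apply: (le_trans (zu _)); rewrite mulrAC ler_pdivrMr // -mulrA.
rewrite ler_wpM2l ?(ltW e0) // (le_trans (snorm_umul _ _)) // mulrC.
by rewrite ler_wpM2l ?snorm_ge0 // lerDl.
Qed.

(** Left multiplication by [x], written on functionals by moving the adjoint to the argument; this
    avoids an extension by continuity. *)
Definition gns_map x u : gns_space := Completion (gns_map_subproof x u).

Lemma gns_mapE x u y : cfun (gns_map x u) y = cfun u (umul (ustar x) y).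
Proof. by []. Qed.

Lemma cfun_ip u y : cfun u y = ip u (embed gns_ip y : gns_space).
Proof. by rewrite -[RHS]/(completion_ip _ _) completion_ip_embed. Qed.

Lemma gns_map_embed x y : gns_map x (embed gns_ip y) = embed gns_ip (umul x y).
Proof.
by apply: completion_eq => z; rewrite gns_mapE /= /gns_form ustarM ustarK umulA.
Qed.

Lemma gns_map_linear x : linear (gns_map x).
Proof.
move=> k u v; apply: completion_eq => y.
by rewrite gns_mapE !cfunD !cfunZ !gns_mapE.
Qed.

Lemma gns_map_lin k x y u :
  gns_map (k *: x + y) u = k *: gns_map x u + gns_map y u.
Proof.
apply: completion_eq => z; rewrite cfunD cfunZ !gns_mapE ustar_lin umul_linl.
by rewrite !cfun_ip embed_linear ip_Dr ip_Zr conjcKK.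
Qed.

Lemma gns_mapM x y u : gns_map (umul x y) u = gns_map x (gns_map y u).
Proof. by apply: completion_eq => z; rewrite !gns_mapE ustarM umulA. Qed.

Lemma gns_map_bound x u : rnorm (gns_map x u) <= ubound (ustar x) * rnorm u.
Proof.
apply: completion_norm_le => [|y]; first by rewrite mulr_ge0 ?ubound_ge0 ?rnorm_ge0.
rewrite gns_mapE (le_trans (cfun_le _ _)) // -mulrA mulrCA.
by rewrite ler_wpM2l ?rnorm_ge0 // snorm_umul.
Qed.

Lemma ubound_star x : ubound (ustar x) = ubound x.
Proof. by congr (_ + _); [exact: rnorm_star|exact: cre_normJ]. Qed.

Lemma gns_approx u : exists y : nat -> E,
  forall n, rnorm (u - embed gns_ip (y n) : gns_space) <= invn n.
Proof. exact: embed_approx. Qed.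

Lemma gns_map_star x u v : ip (gns_map x u) v = ip u (gns_map (ustar x) v).
Proof.
have emb y : ip (gns_map x (embed gns_ip y)) v =
    ip (embed gns_ip y : gns_space) (gns_map (ustar x) v).
  by rewrite gns_map_embed ip_C [RHS]ip_C -!cfun_ip gns_mapE ustarK.
apply/eqP; rewrite -subr_eq0; apply/eqP/cre_norm_eq0/eqP.
rewrite eq_le cre_norm_ge0 andbT; have [y yu] := gns_approx u.
pose C := 2 * (ubound x * rnorm v).
apply: (@le_invn _ _ _ C) => [|n].
  by rewrite /C !mulr_ge0 ?ubound_ge0 ?rnorm_ge0.
rewrite add0r; set d := u - embed gns_ip (y n).
have -> : ip (gns_map x u) v - ip u (gns_map (ustar x) v) =
    ip (gns_map x d) v - ip d (gns_map (ustar x) v).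
  have -> : gns_map x d = gns_map x u - gns_map x (embed gns_ip (y n)).
    exact: linB (gns_map_linear x).
  by rewrite !ip_Bl emb; ring.
rewrite (le_trans (cre_normD _ _)) // cre_normN /C mulr_natl mulr2n mulrDl.
have dn : rnorm (d : gns_space) <= invn n := yu n.
have x0 := ubound_ge0 x; have v0 := rnorm_ge0 v.
rewrite lerD //.
  rewrite (le_trans (ip_bound _ _)) //.
  rewrite (le_trans (ler_wpM2r v0 (gns_map_bound _ _))) // ubound_star.
  by rewrite mulrAC ler_wpM2l ?mulr_ge0.
rewrite (le_trans (ip_bound _ _)) // mulrC.
have := gns_map_bound (ustar x) v; rewrite ustarK => xv.
by rewrite ler_pM ?rnorm_ge0.
Qed.

Definition gns_vector : gns_space := embed gns_ip uone.

Lemma gns_map_vector x : gns_map x gns_vector = embed gns_ip x.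
Proof. by rewrite gns_map_embed umulx1. Qed.

Lemma gns_state x : cre (ip (gns_map x gns_vector) gns_vector) = q x.
Proof.
rewrite gns_map_vector -cfun_ip /= /gns_form ustar1.
have -> : umul uone x = x; last by [].
by case: x => a k; congr pair; rewrite /= ?mul1r // cmul0l scaler0 addr0 add0r scale1r.
Qed.

(** On an embedded vector y the value is q (y* x y), which [asymptotic_norm_conj] makes nonnegative;
    density does the rest. *)
Lemma gns_positive x u : p (- x) <= 0 -> 0 <= cre (ip (gns_map x u) u).
Proof.
move=> x0; have emb y : 0 <= cre (ip (gns_map x (embed gns_ip y)) (embed gns_ip y)).
  rewrite gns_map_embed -cfun_ip /= /gns_form /cre /= -oppr_le0 -qN.
  exact: le_trans (qp _) (asymptotic_norm_conj FF sN0 _ x0).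
have [y yu] := gns_approx u.
pose C := 3 * ubound x * (2 * rnorm u + 1).
rewrite -oppr_le0; apply: (@le_invn _ _ _ C) => [|n].
  by rewrite /C !mulr_ge0 ?ubound_ge0 // addr_ge0 ?mulr_ge0 ?rnorm_ge0.
rewrite add0r; set e := embed gns_ip (y n) : gns_space; set d := u - e : gns_space.
have dn : rnorm d <= invn n := yu n.
have n1 : invn n <= 1 :> R by rewrite invf_le1 ?ltr0n // ler1n.
have en : rnorm e <= rnorm u + 1.
  rewrite -(subrK u e) (le_trans (rnormD _ _)) // addrC lerD2l.
  by rewrite rnormBC (le_trans dn).
have -> : ip (gns_map x u) u =
    ip (gns_map x e) e + (ip (gns_map x d) u + ip (gns_map x e) d).
  have -> : gns_map x d = gns_map x u - gns_map x e.
    exact: linB (gns_map_linear x).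
  by rewrite ip_Bl ip_Br; ring.
have h1 : cre (- ip (gns_map x d) u) <= ubound x * invn n * rnorm u.
  rewrite (le_trans (cre_le_norm _)) // cre_normN (le_trans (ip_bound _ _)) //.
  rewrite ler_wpM2r ?rnorm_ge0 // (le_trans (gns_map_bound _ _)) // ubound_star.
  by rewrite ler_wpM2l ?ubound_ge0.
have h2 : cre (- ip (gns_map x e) d) <= ubound x * (rnorm u + 1) * invn n.
  rewrite (le_trans (cre_le_norm _)) // cre_normN (le_trans (ip_bound _ _)) //.
  rewrite ler_pM ?rnorm_ge0 // (le_trans (gns_map_bound _ _)) // ubound_star.
  by rewrite ler_wpM2l ?ubound_ge0.
have := emb (y n); rewrite -/e => h3; move: h1 h2; rewrite !creD !creN /C.
have := @invn_gt0 R n; have := ubound_ge0 x; have := rnorm_ge0 u.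
move: (ubound x) (rnorm u) (invn n) => X U N U0 X0 N0 h1 h2.
have : 0 <= X * N * U by rewrite !mulr_ge0 // ltW.
have : 0 <= X * N by rewrite !mulr_ge0 // ltW.
lra.
Qed.

Definition gns_rep (b : B) : gns_space -> gns_space := gns_map (b, 0).

Lemma gns_repP : representation gns_rep.
Proof.
split=> [b|b|k a b u|a b u|a u v].
- exact: gns_map_linear.
- exact: (bounded_continuous (gns_map_linear _) (gns_map_bound _)).
- rewrite /gns_rep -gns_map_lin; congr gns_map; congr pair.
  by rewrite -[RHS]/(k * 0 + 0) mulr0 addr0.
- rewrite /gns_rep -gns_mapM; congr gns_map; congr pair; rewrite /= ?mul0r //.
  by rewrite !scale0r !addr0.
by rewrite /gns_rep gns_map_star; congr (ip u (gns_map _ v)); congr pair; rewrite /= rmorph0.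
Qed.

Lemma gns_invariant (W : set gns_space) x u :
  invariant_subspace gns_rep W -> W u -> W (gns_map x u).
Proof.
move=> [W0 WZ Wa] Wu; have -> : gns_map x u = x.2 *: u + gns_rep x.1 u.
  rewrite /gns_rep; have -> : x = x.2 *: uone + (x.1, 0).
    by case: x => a k; congr pair; rewrite /= ?scaler0 ?add0r // addr0 [RHS]mulr1.
  rewrite gns_map_lin /= scaler0 add0r addr0 [X in X *: u]mulr1.
  congr (_ *: _ + _); apply: completion_eq => y; rewrite gns_mapE ustar1.
  congr (cfun u _); case: y => a k; congr pair; rewrite /= ?mul1r //.
  by rewrite cmul0l scaler0 addr0 add0r scale1r.
by apply: WZ => //; exact: Wa.
Qed.

Hypothesis q_extreme : forall f g, real_linear f -> real_linear g ->
  dominated p f -> dominated p g -> (forall x, f x + g x = 2 * q x) -> f =1 q.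

(** Projecting the cyclic vector onto [W] splits [q] into two positive functionals. Extremality
    makes each a multiple of [q], so the projection is a multiple of the cyclic vector, and [W] is
    zero or everything. *)
Lemma gns_irreducible (W : set gns_space) : closed W ->
  invariant_subspace gns_rep W -> W = [set 0] \/ W = setT.
Proof.
move=> Wcl Winv; have [W0 WZ Wa] := Winv.
have [xi1 Wxi1 xi2W] := orthogonal_projection gns_vector Wcl (conj W0 WZ).
set xi2 := gns_vector - xi1 in xi2W.
have xi12 : gns_vector = xi1 + xi2 by rewrite /xi2 addrC subrK.
clearbody xi2.
pose g u x := cre (ip (gns_map x u) u).
have gl u : real_linear (g u).
  split=> [x y|r x]; rewrite /g.
    by have := gns_map_lin 1 x y u; rewrite !scale1r => ->; rewrite ip_Dl creD.
  have := gns_map_lin r%:C x 0 u; rewrite addr0 => ->.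
  have -> : gns_map 0 u = 0.
    have := gns_map_lin (-1) 0 0 u.
    by rewrite !scaleN1r oppr0 addr0 addNr.
  by rewrite addr0 ip_Zl creZ.
have g1 u : g u uone = rnorm u ^+ 2.
  rewrite /g -cre_ip_norm; congr (cre (ip _ u)); apply: completion_eq => y.
  rewrite gns_mapE ustar1; congr (cfun u _); case: y => a k.
  by congr pair; rewrite /= ?mul1r // cmul0l scaler0 addr0 add0r scale1r.
have cross x : ip (gns_map x xi1) xi2 = 0 /\ ip (gns_map x xi2) xi1 = 0.
  have Wx y : W (gns_map y xi1) := gns_invariant y Winv Wxi1.
  split; first by rewrite ip_C (xi2W _ (Wx x)) rmorph0.
  by rewrite gns_map_star (xi2W _ (Wx _)).
have qg x : q x = g xi1 x + g xi2 x.
  rewrite -gns_state xi12 /g (linD _ _ (gns_map_linear x)) !ip_Dl !ip_Dr.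
  by have [-> ->] := cross x; rewrite addr0 add0r creD.
have gpos u x : p (- x) <= 0 -> 0 <= g u x by exact: gns_positive.
have qpos x : p (- x) <= 0 -> 0 <= q x by move=> /gns_positive; rewrite -gns_state.
pose la := rnorm xi1 ^+ 2; pose mu := rnorm xi2 ^+ 2.
have lamu : la + mu = 1 by rewrite /la /mu -!g1 -qg state1.
have la0 : 0 <= la := sqr_ge0 _; have mu0 : 0 <= mu := sqr_ge0 _.
have lin (r : R) u : real_linear (fun x => r * q x + g u x).
  have [gD gZ] := gl u.
  by split=> [x y|t x]; rewrite ?qD ?gD ?qZ ?gZ; ring.
(* Adding [mu * q] to [g xi1] and [la * q] to [g xi2] gives both the value 1 at the unit, without a
   division by [la] or [mu], and their sum is 2 q. *)
have qla x : g xi1 x = la * q x.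
  have -> : la = 1 - mu by rewrite -lamu addrK.
  suff /(_ x) /= e : (fun y => mu * q y + g xi1 y) =1 q.
    by rewrite mulrBl mul1r -{1}e addrAC subrr add0r.
  apply: (q_extreme (lin mu xi1) (lin la xi2)) => [||y].
  - apply: (asymptotic_dominated FF sN0 (lin _ _)) => [|y y0].
      by rewrite g1 state1 mulr1 addrC.
    by rewrite addr_ge0 ?gpos // mulr_ge0 ?qpos.
  - apply: (asymptotic_dominated FF sN0 (lin _ _)) => [|y y0].
      by rewrite g1 state1 mulr1.
    by rewrite addr_ge0 ?gpos // mulr_ge0 ?qpos.
  by rewrite addrACA -mulrDl -qg [mu + la]addrC lamu; ring.
have xi1E : xi1 = la%:C *: gns_vector.
  apply/eqP; rewrite -subr_eq0; apply/eqP.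
  set d := xi1 - la%:C *: gns_vector.
  have d0 x : cre (ip d (gns_map x gns_vector)) = 0.
    rewrite -{1}(ustarK x) -gns_map_star /d.
    have -> : gns_map (ustar x) (xi1 - la%:C *: gns_vector) =
        gns_map (ustar x) xi1 - la%:C *: gns_map (ustar x) gns_vector.
      rewrite (linB _ _ (gns_map_linear _)); congr (_ - _).
      exact: linZ (gns_map_linear _).
    rewrite ip_Bl ip_Zl creB creZ gns_state {1}xi12 ip_Dr.
    by have [-> _] := cross (ustar x); rewrite addr0 -qla subrr.
  apply: completion_eq => y; rewrite [RHS]sip0l; apply: eqc_re.
    by rewrite cre0 cfun_ip -gns_map_vector d0.
  rewrite mulr0 cre0 cfun_ip -[LHS]opprK -creN -mulNr.
  have -> : - 'i = 'i^* :> R[i].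
    by apply/eqP; rewrite eq_complex /= oppr0 !eqxx.
  rewrite -ip_Zr; have -> : 'i *: (embed gns_ip y : gns_space) = embed gns_ip ('i *: y).
    have := embed_linear gns_ip 'i y 0; rewrite addr0 => ->.
    by rewrite -[LHS]addr0.
  by rewrite -gns_map_vector d0 oppr0.
have [la_0|la_n0] := eqVneq la 0.
  left; apply/seteqP; split=> [w Ww|_ ->] //=.
  apply: completion_eq => y; rewrite [RHS]sip0l cfun_ip -gns_map_vector.
  rewrite -(ustarK y) -gns_map_star xi12 xi1E la_0 scale0r add0r ip_C.
  by rewrite (xi2W _ (gns_invariant _ Winv Ww)) rmorph0.
right; apply/seteqP; split=> // w _.
have Wxi : W gns_vector.
  have -> : gns_vector = la^-1%:C *: xi1 + 0.
    by rewrite addr0 [in RHS]xi1E scalerA -rmorphM mulVf // rmorph1 scale1r.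
  exact: WZ.
move/closed_rnormP: Wcl; apply => e e0.
have [|y yw] := embed_dense w (e := e / 2); first by rewrite divr_gt0.
exists (embed gns_ip y); first by rewrite -gns_map_vector; exact: gns_invariant.
by rewrite (le_lt_trans yw) // ltr_pdivrMr // mulr_natr mulr2n ltrDr.
Qed.

End gns.

(* Limits of vector states along F, made extreme, give primitive ideals in the
   closure of the kernels of the s i; this is the compactness of sets
   of primitive ideals on which an element is bounded away from zero. *)
Lemma primitive_cluster (R : realType) (B : cstarAlgType R) (I : Type)
    (F : set_system I) (s : I -> bundled_rep B) (h : B) (eps : R) :
  ProperFilter F -> 0 < eps ->
  (forall i, exists2 v : rep_space (s i), v != 0 &
    eps * rnorm v ^+ 2 <= cre (ip (s i h v) v)) ->
  exists Q : prim B, ~ prim_set Q h /\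
    forall S, F S -> forall b, (forall i, S i -> forall v, s i b v = 0) ->
      prim_set Q b.
Proof.
move=> FF eps0 hh.
have sN0 i : exists v : rep_space (s i), v != 0 by have [v v0 _] := hh i; exists v.
have ps := asymptotic_norm_sublinear FF sN0.
(* Maximizing in the direction of [h] gives [q] a value at least [eps] there, which keeps [h] out of
   the kernel. *)
have [q [ql qp qh q_ext]] := extreme_functional (h, 0) ps.
have qh0 : 0 < q (h, 0).
  rewrite qh (lt_le_trans eps0) //; apply: (asymptotic_norm_ge FF sN0) => t ht.
  apply: (asymptotic_bound_ge FF ht) => i; have [v v0 hv] := hh i; exists v => //.
  by rewrite /uform /uext /= scale0r addr0.
pose pi := @gns_rep _ _ _ _ FF _ sN0 q ql qp.
have rpi : representation pi := gns_repP FF sN0 ql qp.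
have hN0 : pi h (gns_vector FF sN0 ql qp) <> 0.
  move=> h0; have := gns_state FF sN0 ql qp (h, 0).
  rewrite (_ : gns_map _ _ = 0); last exact: h0.
  by rewrite ip_0l cre0 => q0; move: qh0; rewrite -q0 ltxx.
have irr : irreducible_rep pi.
  split=> //; last by move=> W; apply: gns_irreducible.
  by exists h, (gns_vector FF sN0 ql qp); apply/eqP.
exists (Prim (ex_intro _ _ (ex_intro _ pi (conj irr erefl)))); split => /=.
  by move=> h0; apply: hN0; exact: h0.
move=> S FS b b0 u.
(* The squared length of this vector is q (y* b* b y), which is at most 0 because [b] vanishes in
   [s i] for every [i] in [S]. *)
have emb y : pi b (embed _ y) = 0.
  rewrite /pi /gns_rep gns_map_embed; apply: rnorm_eq0; apply/eqP.
  rewrite rnorm_embed -sqrf_eq0 sqr_snorm eq_le sip_ge0 andbT.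
  rewrite /cre /=; apply: le_trans (qp _) _; apply: (asymptotic_norm_le FF sN0).
  exists S => // i Si v; rewrite uform_square uextM /uext /= b0 // scale0r addr0.
  by rewrite rnorm0 expr0n /= mul0r.
apply: rnorm_le0 => e e0.
have b1 : 0 < rnorm b + 1 by rewrite ltr_wpDl ?rnorm_ge0.
have [|y yu] := embed_dense u (e := e / (rnorm b + 1)); first by rewrite divr_gt0.
rewrite -[pi b u]subr0 -(emb y) -(repBr rpi).
rewrite (le_trans (rep_contractive rpi _ _)) //.
move: yu; rewrite ler_pdivlMr // => yu.
by have := rnorm_ge0 (u - embed _ y); nra.
Qed.

(** * Multipliers and irreducible representations *)

Lemma cvgn_unique (R : realType) (V : normedModType R[i]) (v : nat -> V) (x y : V) :
  v @ \oo --> x -> v @ \oo --> y -> x = y.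
Proof.
move=> /cvgn_rnormP vx vy; apply/eqP; rewrite -subr_eq0; apply/eqP/rnorm_le0 => e e0.
rewrite rnormBC; have [N Nv] := vx e e0.
apply: (cvgn_rnorm_le vy (N := N)) => n /Nv vn.
by rewrite rnormBC ltW.
Qed.

Section irreducible_multiplier_extension.
Context {R : realType} {A : cstarAlgType R}.
Variable u : nat -> A.
Hypothesis u1 : forall n, rnorm (u n) <= 1.
Hypothesis ul : forall a, u n ** a @[n --> \oo] --> a.
Hypothesis ur : forall a, a ** u n @[n --> \oo] --> a.
Implicit Types (a b : A) (m p : multiplier A).

Section one_representation.
Context {H : hilbertType R}.
Variables (pi : A -> H -> H) (irr : irreducible_rep pi).
Implicit Types (x y z : H).

Let rpi : representation pi. Proof. by have [] := irr. Qed.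

(** The vectors with this convergence form a closed subspace containing the range of [pi]. *)
Lemma irreducible_approximate_unit x : pi (u n) x @[n --> \oo] --> x.
Proof.
suff WT : [set y | pi (u n) y @[n --> \oo] --> y] = setT.
  by have : [set y | pi (u n) y @[n --> \oo] --> y] x by rewrite WT.
apply: (irreducible_ind irr) => [||a y /=].
- apply/closed_rnormP => y yW; apply/cvgn_rnormP => e e0.
  have [|w /cvgn_rnormP Ww yw] := yW (e / 3); first by rewrite divr_gt0.
  have [|N Nw] := Ww (e / 3); first by rewrite divr_gt0.
  exists N => n /Nw wn.
  rewrite (_ : y - _ = (y - w) + (w - pi (u n) w) - pi (u n) (y - w)); last first.
    by rewrite (repBr rpi); zmodule.
  have : rnorm (pi (u n) (y - w)) <= rnorm (y - w).
    rewrite (le_trans (rep_contractive rpi _ _)) // -[leRHS]mul1r.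
    by rewrite ler_wpM2r ?rnorm_ge0.
  have := rnormB (y - w + (w - pi (u n) w)) (pi (u n) (y - w)).
  have := rnormD (y - w) (w - pi (u n) w); lra.
- split=> [|k y z /cvgn_rnormP Wy /cvgn_rnormP Wz] /=.
    by apply/cvgn_rnormP => e e0; exists 0%N => n _; rewrite (rep0r rpi) subr0 rnorm0.
  apply/cvgn_rnormP => e e0; have k0 := cre_norm_ge0 k.
  have k1 : 0 < 2 * (cre `|k| + 1) by rewrite mulr_gt0 // ltr_wpDl.
  have [|N Ny] := Wy (e / (2 * (cre `|k| + 1))); first by rewrite divr_gt0.
  have [|N' Nz] := Wz (e / 2); first by rewrite divr_gt0.
  exists (maxn N N') => n; rewrite geq_max => /andP[/Ny yn /Nz zn].
  rewrite (rep_linear rpi) opprD addrACA -scalerBr (le_lt_trans (rnormD _ _)) //.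
  rewrite rnormZ -/(cre _); move: yn; rewrite ltr_pdivlMr // => yn.
  have := rnorm_ge0 (y - pi (u n) y); nra.
have -> : (fun n => pi (u n) (pi a y)) = (fun n => pi (u n ** a) y).
  by apply/funext => n; rewrite (rep_mul rpi).
exact: (rep_cvg rpi).
Qed.

(* The range of pi is dense, so a bound on the distance to it is a bound by 0. *)
Lemma irreducible_dense (t C : R) x : 0 <= C ->
  (forall a y, t <= C * rnorm (x - pi a y)) -> t <= 0.
Proof.
move=> C0 tC; apply/ler_addgt0Pr => e e0; rewrite add0r.
have C1 : 0 < C + 1 by rewrite ltr_wpDl.
have /cvgn_rnormP/(_ (e / (C + 1))) := irreducible_approximate_unit (x := x).
case=> [|N /(_ N (leqnn N))]; first by rewrite divr_gt0.
rewrite ltr_pdivlMr // => xN; have := tC (u N) x.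
by have := rnorm_ge0 (x - pi (u N) x); nra.
Qed.

Lemma rnorm_lmul m a : rnorm (lmul m a) <= rnorm m * rnorm a.
Proof. exact: lmulP. Qed.

Lemma rep_lmul_bound m k x : rnorm (pi (lmul m (u k)) x) <= rnorm m * rnorm x.
Proof.
rewrite (le_trans (rep_contractive rpi _ _)) // ler_wpM2r ?rnorm_ge0 //.
rewrite (le_trans (rnorm_lmul _ _)) // -[leRHS]mulr1.
by rewrite ler_wpM2l ?rnorm_ge0.
Qed.

Lemma rep_lmul_cvg m a x : pi (lmul m (u n)) (pi a x) @[n --> \oo] --> pi (lmul m a) x.
Proof.
have -> : (fun n => pi (lmul m (u n)) (pi a x)) = (fun n => pi (lmul m (u n ** a)) x).
  by apply/funext => n; rewrite -(rep_mul rpi) lmulM.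
apply: (rep_cvg rpi); apply/cvgn_rnormP => e e0.
have m1 : 0 < rnorm m + 1 by rewrite ltr_wpDl ?rnorm_ge0.
have /cvgn_rnormP/(_ (e / (rnorm m + 1))) := @ul a.
case=> [|N Na]; first by rewrite divr_gt0.
exists N => n /Na; rewrite ltr_pdivlMr // => an.
rewrite -(linB _ _ (lmul_linear m)) (le_lt_trans (rnorm_lmul _ _)) //.
by have := rnorm_ge0 (a - u n ** a); nra.
Qed.

(** Split [x] as d + pi (u K) x with d small. On the second part the limit exists by [rep_lmul_cvg];
    the first contributes at most |m| |d| for every n. The limits define the extension of [pi] to
    the multipliers. *)
Lemma multiplier_limit_ex m x : exists y : H, pi (lmul m (u n)) x @[n --> \oo] --> y.
Proof.
apply: cauchyn_rnorm => e e0; have m0 := rnorm_ge0 m.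
have m1 : 0 < 3 * (rnorm m + 1) by rewrite mulr_gt0 // ltr_wpDl.
have /cvgn_rnormP/(_ (e / (3 * (rnorm m + 1)))) := irreducible_approximate_unit (x := x).
case=> [|K /(_ K (leqnn K))]; first by rewrite divr_gt0.
rewrite ltr_pdivlMr // => xK; set d := x - pi (u K) x in xK.
have /cvgn_rnormP/(_ (e / 6)) := rep_lmul_cvg (m := m) (a := u K) (x := x).
case=> [|N Nx]; first by rewrite divr_gt0.
exists N => n k /Nx xn /Nx xk.
rewrite -(rnormN (_ - _)) in xk.
have -> : pi (lmul m (u n)) x - pi (lmul m (u k)) x =
    (pi (lmul m (u n)) d - pi (lmul m (u k)) d) +
    - (pi (lmul m (u K)) x - pi (lmul m (u n)) (pi (u K) x)) +
    (pi (lmul m (u K)) x - pi (lmul m (u k)) (pi (u K) x)).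
  by rewrite /d !(repBr rpi); zmodule.
have h1 := rep_lmul_bound m n d; have h2 := rep_lmul_bound m k d.
rewrite rnormN in xk.
rewrite (le_lt_trans (rnormD _ _)) // (le_lt_trans (lerD (rnormD _ _) (lexx _))) //.
rewrite rnormN (le_lt_trans (lerD (lerD (rnormB _ _) (lexx _)) (lexx _))) //.
by have := rnorm_ge0 d; lra.
Qed.

Definition multiplier_rep m x : H := projT1 (cid (multiplier_limit_ex m x)).

Lemma multiplier_rep_cvg m x :
  pi (lmul m (u n)) x @[n --> \oo] --> multiplier_rep m x.
Proof. by rewrite /multiplier_rep; case: cid. Qed.

Lemma multiplier_repE m a x : multiplier_rep m (pi a x) = pi (lmul m a) x.
Proof. exact: cvgn_unique (@multiplier_rep_cvg m _) (@rep_lmul_cvg m a x). Qed.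

Lemma rep_multiplier m a x : pi a (multiplier_rep m x) = pi (rmul m a) x.
Proof.
apply: (@cvgn_unique _ _ (fun n => pi (rmul m a ** u n) x)); last exact: (rep_cvg rpi).
have -> : (fun n => pi (rmul m a ** u n) x) = (fun n => pi a (pi (lmul m (u n)) x)).
  by apply/funext => n; rewrite rmul_lmul (rep_mul rpi).
have /cvgn_rnormP h := @multiplier_rep_cvg m x; apply/cvgn_rnormP => e e0.
have a1 : 0 < rnorm a + 1 by rewrite ltr_wpDl ?rnorm_ge0.
have [|N Nx] := h (e / (rnorm a + 1)); first by rewrite divr_gt0.
exists N => n /Nx; rewrite ltr_pdivlMr // -(repBr rpi) => xn.
rewrite (le_lt_trans (rep_contractive rpi _ _)) //.
by have := rnorm_ge0 (multiplier_rep m x - pi (lmul m (u n)) x); nra.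
Qed.

(** By nondegeneracy a vector is determined by its images under [pi a], so the algebraic laws of the
    extension are checked after applying [pi a]. *)
Lemma multiplier_rep_unique m x y :
  (forall a, pi a y = pi (rmul m a) x) -> multiplier_rep m x = y.
Proof.
move=> ya; apply/eqP; rewrite -subr_eq0; apply/eqP.
apply: (irreducible_nondegenerate irr) => a.
by rewrite (repBr rpi) rep_multiplier ya subrr.
Qed.

Lemma multiplier_rep_bound m x : rnorm (multiplier_rep m x) <= rnorm m * rnorm x.
Proof.
rewrite -[multiplier_rep _ _]subr0; apply: (cvgn_rnorm_le (@multiplier_rep_cvg m x) (N := 0)).
by move=> n _; rewrite subr0 rep_lmul_bound.
Qed.

Lemma multiplier_rep_linear m : linear (multiplier_rep m).
Proof.
move=> k x y; apply: multiplier_rep_unique => a.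
by rewrite !(rep_linear rpi) !rep_multiplier.
Qed.

Lemma multiplier_repP : representation multiplier_rep.
Proof.
split=> [m|m|k m n x|m n x|m x y].
- exact: multiplier_rep_linear.
- exact: (bounded_continuous (@multiplier_rep_linear m) (multiplier_rep_bound m)).
- apply: multiplier_rep_unique => a.
  by rewrite (rep_linear rpi) !rep_multiplier /= (rep_linear_alg rpi).
- by apply: multiplier_rep_unique => a; rewrite !rep_multiplier.
apply/eqP; rewrite -subr_eq0; apply/eqP/cre_norm_eq0/eqP.
rewrite eq_le cre_norm_ge0 andbT.
(* The defect of the adjoint relation is linear and bounded in [x], and it vanishes on the range of
   [pi]. *)
apply: (@irreducible_dense _ (rnorm m * rnorm y + rnorm (star m) * rnorm y) x).
  by rewrite addr_ge0 ?mulr_ge0 ?rnorm_ge0.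
move=> a z; set d := x - pi a z.
have -> : ip (multiplier_rep m x) y - ip x (multiplier_rep (star m) y) =
    ip (multiplier_rep m d) y - ip d (multiplier_rep (star m) y).
  rewrite /d (linB _ _ (multiplier_rep_linear m)) !ip_Bl multiplier_repE.
  rewrite (rep_star rpi) (rep_star rpi a) rep_multiplier /= starK; ring.
rewrite (le_trans (cre_normD _ _)) // cre_normN mulrDl lerD //.
  rewrite (le_trans (ip_bound _ _)) // mulrAC ler_wpM2r ?rnorm_ge0 //.
  exact: multiplier_rep_bound.
rewrite (le_trans (ip_bound _ _)) // mulrC ler_wpM2r ?rnorm_ge0 //.
exact: multiplier_rep_bound.
Qed.

Lemma multiplier_rep_irreducible : irreducible_rep multiplier_rep.
Proof.
have [_ [a [x pax]] W_irr] := irr.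
have tom b y : multiplier_rep (to_multiplier b) y = pi b y.
  by apply: multiplier_rep_unique => c; rewrite -(rep_mul rpi).
split; first exact: multiplier_repP.
  by exists (to_multiplier a), x; rewrite tom.
move=> W Wcl [W0 WZ Wm]; apply: W_irr => //; split=> // b y Wy.
by rewrite -tom; exact: Wm.
Qed.

Lemma multiplier_rep_ker m : (forall x, multiplier_rep m x = 0) <->
  tilde [set a | forall x, pi a x = 0] m.
Proof.
split=> [m0 a|m0 x].
  by split=> x; rewrite -?multiplier_repE -?rep_multiplier m0 ?(rep0r rpi).
apply: multiplier_rep_unique => a; rewrite (rep0r rpi).
by have [_ /(_ x) /= ->] := m0 a.
Qed.

End one_representation.

Lemma prim_tilde (P : prim A) : exists Q : prim (multiplier A),
  prim_set Q = tilde (prim_set P).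
Proof.
case: P => P [H [pi [irr PE]]] /=.
exists (Prim (ex_intro _ H (ex_intro _ _ (conj (multiplier_rep_irreducible irr) erefl)))).
rewrite /= PE; apply/seteqP; split=> m /=.
  by move=> /multiplier_rep_ker.
by move=> mt; apply/multiplier_rep_ker.
Qed.

End irreducible_multiplier_extension.

(** * Restriction of primitive ideals of the multiplier algebra *)

Section restriction.
Context {R : realType} {A : cstarAlgType R}.
Implicit Types (a b : A) (m : multiplier A).

Lemma to_multiplier_linear (k : R[i]) a b :
  to_multiplier (k *: a + b) = k *: to_multiplier a + to_multiplier b.
Proof. by apply: multiplier_eq => c /=; rewrite cmulPl. Qed.

Lemma to_multiplierM a b : to_multiplier (a ** b) = to_multiplier a ** to_multiplier b.
Proof. by apply: multiplier_eq => c /=; rewrite cmulA. Qed.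

Lemma to_multiplier_star a : to_multiplier (star a) = star (to_multiplier a).
Proof. by apply: multiplier_eq => c /=; rewrite starM starK. Qed.

(** A is an ideal of M(A), so for a closed A-invariant subspace W the vectors that A maps into W
    form a closed M(A)-invariant subspace; this carries irreducibility down to A. *)
Lemma prim_restrict (Q : prim (multiplier A)) :
  (exists a, ~ prim_set Q (to_multiplier a)) ->
  exists P : prim A, prim_set Q = tilde (prim_set P) /\
    forall a, prim_set P a <-> prim_set Q (to_multiplier a).
Proof.
move=> [a0 Qa0]; have [H [s [irr QE]]] := primP Q; have [rs _ W_irr] := irr.
pose pi a := s (to_multiplier a).
have rpi : representation pi.
  split=> [a|a|k a b x|a b x|a x y].
  - exact: (rep_linear rs).
  - exact: (rep_continuous rs).
  - by rewrite /pi to_multiplier_linear (rep_linear_alg rs).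
  - by rewrite /pi to_multiplierM (rep_mul rs).
  - by rewrite /pi to_multiplier_star (rep_star rs).
have [x0 pix0] : exists x, pi a0 x != 0.
  apply: contrapT => h; apply: Qa0; apply/QE => x; apply/eqP/negPn/negP => x0.
  by apply: h; exists x.
have pi_s a m x : pi a (s m x) = pi (rmul m a) x.
  by rewrite /pi -(rep_mul rs) multiplier_mulr.
have s_pi a m x : s m (pi a x) = pi (lmul m a) x.
  by rewrite /pi -(rep_mul rs) multiplier_mull.
have rep_closed a (W : set H) : closed W -> closed [set x | W (pi a x)].
  move=> /closed_rnormP Wcl; apply/closed_rnormP => x xW; apply: Wcl => e e0.
  have a1 : 0 < rnorm a + 1 by rewrite ltr_wpDl ?rnorm_ge0.
  have [|w Ww xw] := xW (e / (rnorm a + 1)); first by rewrite divr_gt0.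
  exists (pi a w) => //; rewrite -(repBr rpi) (le_lt_trans (rep_contractive rpi _ _)) //.
  by move: xw; rewrite ltr_pdivlMr // => xw; have := rnorm_ge0 (x - w); nra.
have full (W : set H) : closed W -> subspace W ->
    (forall a x, W x -> W (pi a x)) -> (exists2 x, W x & x != 0) ->
    forall a x, W (pi a x).
  move=> Wcl [W0 WZ] Wpi [w Ww w0] a x.
  pose V := \bigcap_(a in setT) [set x | W (pi a x)].
  suff VT : V = setT by have Vx : V x; [rewrite VT|exact: (Vx a I)].
  apply: (irreducible_full (x := w) irr) => //.
  - by apply: closed_bigI => b _; exact: rep_closed.
  - split=> [b _|k y z Vy Vz b _|m y Vy b _] /=; first by rewrite (rep0r rpi).
      by rewrite (rep_linear rpi); apply: WZ; [exact: (Vy b I)|exact: (Vz b I)].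
    by rewrite pi_s; exact: (Vy _ I).
  by move=> b _; exact: Wpi.
have nondeg x : (forall a, pi a x = 0) -> x = 0.
  move=> x0'; apply/eqP; apply: contra_neqT pix0 => xn0.
  have c0 : closed [set 0 : H].
    apply/closed_rnormP => y yW /=; apply: rnorm_le0 => e /yW[_ -> ].
    by rewrite subr0 => /ltW.
  suff VT : \bigcap_(a in setT) [set x | [set 0] (pi a x)] = setT.
    have : (\bigcap_(a in setT) [set x | [set 0] (pi a x)]) x0 by rewrite VT.
    by move=> /(_ a0 I).
  apply: (irreducible_full (x := x) irr) => //.
  - by apply: closed_bigI => b _; exact: rep_closed.
  - split=> [b _|k y z Vy Vz b _|m y Vy b _] /=; first by rewrite (rep0r rpi).
      by rewrite (rep_linear rpi) (Vy b I) (Vz b I) scaler0 addr0.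
    by rewrite pi_s (Vy _ I).
  by move=> b _; exact: x0'.
have irrpi : irreducible_rep pi.
  split=> //; first by exists a0, x0.
  move=> W Wcl [W0 WZ Wpi]; have [WN|WN] := pselect (exists2 x, W x & x != 0).
    right; apply/seteqP; split=> // x _.
    have Wax := full W Wcl (conj W0 WZ) Wpi WN.
    (* Since every [pi (star a) y] lies in [W], it is orthogonal to [x - p]; hence A kills
       [x - p]. *)
    have [p Wp pW] := orthogonal_projection x Wcl (conj W0 WZ).
    suff /eqP : x - p = 0 by rewrite subr_eq0 => /eqP ->.
    apply: nondeg => a; apply: ip_eq0 => y.
    by rewrite (rep_star rpi) pW.
  left; apply/seteqP; split=> [x Wx|_ ->] //=.
  by apply/eqP; apply: contrapT => /negP x0'; apply: WN; exists x.
exists (Prim (ex_intro _ H (ex_intro _ pi (conj irrpi erefl)))); split => /=.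
  apply/seteqP; split=> m.
    by move=> /QE m0 a; split=> x /=; rewrite -?s_pi -?pi_s m0 ?(rep0r rpi).
  move=> mP; apply/QE => x; apply: nondeg => a; rewrite pi_s.
  by have [_ /= ->] := mP a.
by move=> a; split=> [a0'|/QE //]; apply/QE.
Qed.

End restriction.

(** * Localized elements *)

Section almost_orthogonality.
Context {R : realType} {A : cstarAlgType R}.
Implicit Types (a b c S : A).

Lemma invn_exp2 n : (2 ^+ n)^-1 <= invn n :> R.
Proof.
rewrite /invn lef_pV2 ?posrE ?exprn_gt0 ?ltr0n //.
by rewrite -natrX ler_nat; apply: ltn_expl.
Qed.

(** Replacing S and c by their squares keeps the hypotheses and costs 2 e in the expansion of (S +
    c)^2. Induction gives the bound 1 + 2 e + 2^-n, starting from |S + c| <= 2. *)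
Lemma almost_orthogonal_unit S c (e : R) :
  star S = S -> star c = c -> rnorm S <= 1 -> rnorm c <= 1 ->
  rnorm (S ** c) <= e -> rnorm (S + c) <= 1 + 2 * e.
Proof.
move=> sS sc S1 c1 Sce; apply: (@le_invn _ _ _ 1) => // n; rewrite mul1r.
rewrite -lerBlDl; apply: le_trans (invn_exp2 n).
elim: n S c sS sc S1 c1 Sce => [|n IH] S c sS sc S1 c1 Sce.
  have e0 : 0 <= e := le_trans (rnorm_ge0 _) Sce.
  by rewrite expr0 invr1; have := rnormD S c; lra.
have sq b : rnorm b <= 1 -> rnorm (b ** b) <= 1.
  by move=> b1; rewrite (le_trans (rnormM _ _)) // mulr_ile1 ?rnorm_ge0.
have h1 : rnorm (S ** S ** (c ** c)) <= e.
  rewrite -cmulA (cmulA S c c) (le_trans (rnormM _ _)) //.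
  have := rnormM (S ** c) c; have := rnorm_ge0 S; have := rnorm_ge0 c.
  have := rnorm_ge0 (S ** c); have := rnorm_ge0 (S ** c ** c); nra.
have := IH _ _ _ _ (sq S S1) (sq c c1) h1; rewrite !starM sS sc.
move=> /(_ erefl erefl) h2.
have h3 : rnorm (S + c) ^+ 2 <= rnorm (S ** S + c ** c) + 2 * e.
  rewrite -rnorm_star_mul starD sS sc.
  have -> : (S + c) ** (S + c) = (S ** S + c ** c) + (S ** c + c ** S).
    by rewrite cmulDl !cmulDr; zmodule.
  have h4 : rnorm (c ** S) <= e by rewrite -rnorm_star starM sS sc.
  rewrite (le_trans (rnormD _ _)) // lerD2l (le_trans (rnormD _ _)) //.
  by rewrite mulr_natl mulr2n lerD.
have p0 : 0 < (2 ^+ n)^-1 :> R by rewrite invr_gt0 exprn_gt0.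
rewrite exprS invfM; move: ((2 ^+ n)^-1) p0 h2 => d p0 h2.
(* For t = |S + c| one has t^2 <= 1 + 4 e + 2^-n and 2 t - 1 <= t^2, so the excess over 1 + 2 e is
   halved. *)
by have := sqr_ge0 (rnorm (S + c) - 1); lra.
Qed.

Lemma almost_orthogonal S c (M e : R) :
  star S = S -> star c = c -> 1 <= M -> rnorm S <= M -> rnorm c <= M ->
  rnorm (S ** c) <= e -> rnorm (S + c) <= M + 2 * e.
Proof.
move=> sS sc M1 SM cM Sce; have M0 : 0 < M by lra.
have Mi0 : 0 < M^-1 by rewrite invr_gt0.
have sc' b : star b = b -> star (M^-1%:C *: b) = M^-1%:C *: b.
  by move=> sb; rewrite starZ sb conjcR.
have n1 b : rnorm b <= M -> rnorm (M^-1%:C *: b) <= 1.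
  by move=> bM; rewrite rnormZr gtr0_norm // ler_pdivrMl // mulr1.
have e' : rnorm (M^-1%:C *: S ** (M^-1%:C *: c)) <= M^-1 * M^-1 * e.
  rewrite cmulZl cmulZr scalerA -rmorphM rnormZr gtr0_norm ?mulr_gt0 //.
  by rewrite ler_wpM2l // ltW // mulr_gt0.
have := almost_orthogonal_unit (sc' _ sS) (sc' _ sc) (n1 _ SM) (n1 _ cM) e'.
rewrite -scalerDr rnormZr gtr0_norm // ler_pdivrMl // => /le_trans; apply.
rewrite mulrDr mulr1 lerD2l mulrCA ler_wpM2l // mulrA mulrA mulfV ?gt_eqF // mul1r.
have e0 : 0 <= e := le_trans (rnorm_ge0 _) Sce.
by rewrite ler_piMl // invf_le1.
Qed.

End almost_orthogonality.

Section ideals.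
Context {R : realType} {A : cstarAlgType R}.
Implicit Types (a b e k : A).

Definition star_ideal (I : set A) :=
  [/\ I 0, forall (t : R[i]) a b, I a -> I b -> I (t *: a + b),
      forall a b, I b -> I (a ** b) /\ I (b ** a) & forall a, I a -> I (star a)].

Lemma ker_star_ideal (V : set (prim A)) : star_ideal (ker V).
Proof.
split=> [P _|t a b Ia Ib P VP|a b Ib|a Ia P VP].
- exact: prim0.
- by apply: prim_linear; [exact: Ia|exact: Ib].
- by split=> P VP; have [] := primM a (Ib P VP).
by apply: prim_star; exact: Ia.
Qed.

Lemma star_idealD (I : set A) a b : star_ideal I -> I a -> I b -> I (a + b).
Proof. by move=> [_ IZ _ _] Ia Ib; rewrite -[a]scale1r; exact: IZ. Qed.

Lemma star_idealZ (I : set A) (t : R[i]) a : star_ideal I -> I a -> I (t *: a).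
Proof. by move=> [I0 IZ _ _] Ia; rewrite -[_ *: _]addr0; exact: IZ. Qed.

Lemma star_idealB (I : set A) a b : star_ideal I -> I a -> I b -> I (a - b).
Proof.
by move=> sI Ia Ib; apply: star_idealD => //; rewrite -scaleN1r; exact: star_idealZ.
Qed.

(* In the unitization, 1 - bump k n = (1 - k ^ 2) ^ n. *)
Fixpoint bump k n : A :=
  if n is n'.+1 then bump k n' + k ** k - k ** k ** bump k n' else 0.

Lemma bump_comm k c n : c ** k = k ** c -> c ** bump k n = bump k n ** c.
Proof.
move=> ck; have ckk : c ** (k ** k) = k ** k ** c by rewrite cmulA ck -cmulA ck cmulA.
elim: n => [|n IH] /=; first by rewrite cmul0l cmul0r.
by rewrite cmulBr cmulBl cmulDr cmulDl IH ckk cmulA ckk -!cmulA IH.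
Qed.

Lemma bump_star k n : star k = k -> star (bump k n) = bump k n.
Proof.
move=> sk; elim: n => [|n IH] /=; first exact: star0.
rewrite starB starD !starM sk IH; congr (_ - _).
by rewrite -bump_comm // cmulA.
Qed.

Lemma bump_sub k n a :
  a - bump k n.+1 ** a = (a - bump k n ** a) - k ** k ** (a - bump k n ** a).
Proof. by rewrite /= cmulBl cmulDl cmulBr cmulA; zmodule. Qed.

(** In the unitization 1 - b = (1 - k^2)^n is a contraction, and b^2 = b - (1 - b) b gives |b|^2 <=
    2 |b|. *)
Lemma bump_norm k n : star k = k -> rnorm k <= 1 -> rnorm (bump k n) <= 2.
Proof.
move=> sk k1; have sub a : rnorm (a - bump k n ** a) <= rnorm a.
  elim: n => [|n IH]; first by rewrite /= cmul0l subr0.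
  by rewrite bump_sub (le_trans (rnorm_sub_sqr _ sk k1)).
have := sub (bump k n); set b := bump k n => bb.
have [->|b0] := eqVneq b 0; first by rewrite rnorm0.
rewrite -(ler_pM2r (rnorm_gt0 b0)) -expr2 -rnorm_star_mul bump_star // -/b.
have := rnormB b (b - b ** b); rewrite subKr; lra.
Qed.

Lemma bump_ideal (I : set A) k n : star_ideal I -> I k -> I (bump k n).
Proof.
move=> sI Ik; have [I0 _ IM _] := sI; elim: n => //= n IH.
apply: star_idealB => //; last by have [] := IM (k ** k) _ IH.
by apply: star_idealD => //; have [] := IM k _ Ik.
Qed.

(** With y n = (1 - k^2)^n x one has |y (n+1)|^2 <= |y n|^2 - |k y n|^2, and k y n is the vector in
    question; its norm cannot stay bounded below. *)
Lemma bump_vector (H : hilbertType R) (pi : A -> H -> H) k (x : H) (d : R) :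
  representation pi -> star k = k -> rnorm k <= 1 -> 0 < d ->
  exists n, rnorm (pi k x - pi (bump k n) (pi k x)) ^+ 2 < d.
Proof.
move=> rpi sk k1 d0; apply: contrapT => h.
have {}h n : d <= rnorm (pi k x - pi (bump k n) (pi k x)) ^+ 2.
  by rewrite leNgt; apply/negP => hn; apply: h; exists n.
pose y n := x - pi (bump k n) x.
have contr v : rnorm (pi k v) <= rnorm v.
  rewrite (le_trans (rep_contractive rpi _ _)) // -[leRHS]mul1r.
  by rewrite ler_wpM2r ?rnorm_ge0.
have step n : rnorm (y n.+1) ^+ 2 <= rnorm (y n) ^+ 2 - d.
  have -> : y n.+1 = y n - pi (k ** k) (y n).
    rewrite /y /= (repBl rpi) (repDl rpi) (repBr rpi) (rep_mul rpi (k ** k)).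
    by zmodule.
  have yn : d <= rnorm (pi k (y n)) ^+ 2.
    by have := h n; rewrite -!(rep_mul rpi) -bump_comm // (rep_mul rpi) -(repBr rpi).
  rewrite sqr_rnormB cre_ip_C -{1}sk (rep_cre_star rpi) (rep_mul rpi).
  have := contr (pi k (y n)); have := rnorm_ge0 (pi k (pi k (y n))); nra.
have bound n : d * n%:R <= rnorm (y 0%N) ^+ 2.
  suff : rnorm (y n) ^+ 2 <= rnorm (y 0%N) ^+ 2 - d * n%:R.
    by have := sqr_ge0 (rnorm (y n)); lra.
  elim: n => [|n IH]; first by rewrite mulr0 subr0.
  by rewrite -natr1; have := step n; lra.
have c0 : 0 <= rnorm (y 0%N) ^+ 2 / d by rewrite divr_ge0 ?sqr_ge0 // ltW.
have := archi_boundP c0; rewrite ltr_pdivrMr // mulrC.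
by rewrite ltNge bound.
Qed.

End ideals.

Section one_step.
Context {R : realType} {A : cstarAlgType R} {H : hilbertType R}.
Variables (pi : A -> H -> H) (irr : irreducible_rep pi).
Implicit Types (a b c e k w F G z : A) (x y v : H).

Let rpi : representation pi. Proof. by have [] := irr. Qed.

Lemma rep_ip_le a x : cre (ip (pi a x) x) <= rnorm a * rnorm x ^+ 2.
Proof.
rewrite (le_trans (cre_ip_le _ _)) // expr2 mulrA ler_wpM2r ?rnorm_ge0 //.
exact: (rep_contractive rpi).
Qed.

Lemma rep_neq0_star a x : pi a x != 0 -> exists y, pi (star a) y != 0.
Proof.
move=> ax; exists (pi a x); apply: contra_neq ax => ax0.
by apply/rnorm_eq0/eqP; rewrite -sqrf_eq0 -(rep_cre_star rpi) (rep_mul rpi) ax0 ip_0l.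
Qed.

(** Primeness of the kernel: if g J acted as 0, the vectors killed by all [g ** c] would form a
    nonzero closed invariant subspace, so g A and then its adjoint A g* would act as 0. *)
Lemma rep_neq0_mul (J : set A) g i x y : star_ideal J -> J i ->
  pi i x != 0 -> pi g y != 0 -> exists e v, J e /\ pi (g ** e) v != 0.
Proof.
move=> [_ _ JM _] Ji ix gy; apply: contrapT => h.
have {}h e v : J e -> pi (g ** e) v = 0.
  by move=> Je; apply/eqP/negPn/negP => ge; apply: h; exists e, v.
pose W := \bigcap_(c in setT) [set v | pi (g ** c) v = 0].
have WT : W = setT.
  apply: (irreducible_full (x := pi i x) irr) => //.
  - apply: closed_bigI => c _; apply/closed_rnormP => v vW /=.
    apply: rnorm_le0 => d d0; have g1 : 0 < rnorm (g ** c) + 1 by rewrite ltr_wpDl ?rnorm_ge0.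
    have [|v' /= gv vv'] := vW (d / (rnorm (g ** c) + 1)); first by rewrite divr_gt0.
    rewrite -[pi _ v]subr0 -gv -(repBr rpi) (le_trans (rep_contractive rpi _ _)) //.
    by move: vv'; rewrite ltr_pdivlMr // => vv'; have := rnorm_ge0 (v - v'); nra.
  - split=> [c _|t v v' Wv Wv' c _|b v Wv c _] /=; first exact: (rep0r rpi).
      by rewrite (rep_linear rpi) (Wv c I) (Wv' c I) scaler0 addr0.
    by rewrite -(rep_mul rpi) -cmulA; exact: (Wv _ I).
  by move=> c _ /=; rewrite -(rep_mul rpi) -cmulA h //; have [] := JM c _ Ji.
have gc c v : pi (g ** c) v = 0.
  by have Wv : W v; [rewrite WT|exact: (Wv c I)].
have [y' gy'] := rep_neq0_star gy; move: gy'; rewrite (_ : pi _ _ = 0) ?eqxx //.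
apply: (irreducible_nondegenerate irr) => c; rewrite -(rep_mul rpi).
rewrite -[c]starK -starM; apply: ip_eq0 => v.
by rewrite (rep_star rpi) starK gc ip_0r.
Qed.

(** G annihilates the range of 2 - F, so F - G agrees there with G + F = 4 w^2, whose form is
    therefore at most 2 |v|^2. *)
Lemma cutoff_vector w F G a x : star w = w -> rnorm w <= 1 ->
  G + F = w ** w + w ** w + (w ** w + w ** w) -> rnorm (F - G) <= 2 ->
  G ** F = G + G -> rnorm (pi w (pi (a + a - F ** a) x)) ^+ 2 <=
    2^-1 * rnorm (pi (a + a - F ** a) x) ^+ 2.
Proof.
move=> sw w1 GFE FG GF; set v := pi _ x.
have Gv : pi G v = 0.
  by rewrite -(rep_mul rpi) cmulBr cmulDr cmulA GF cmulDl subrr (rep0l rpi).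
have := rep_ip_le (F - G) v; have := rep_cre_star rpi w v; rewrite sw => <-.
rewrite (repBl rpi) Gv subr0.
have -> : pi F v = pi (G + F) v by rewrite (repDl rpi) Gv add0r.
rewrite GFE !(repDl rpi) !ip_Dl !creD.
by have := sqr_ge0 (rnorm v); nra.
Qed.

(* The element c is concentrated in the directions where w ** w is at most 1/2,
   which is why it is small on the range of w and still keeps a definite norm. *)
Lemma localized_positive (I : set A) w F G a i x y : star_ideal I -> I i ->
  pi i x != 0 -> star w = w -> rnorm w <= 1 ->
  G + F = w ** w + w ** w + (w ** w + w ** w) -> rnorm (F - G) <= 2 ->
  G ** F = G + G -> pi (a + a - F ** a) y != 0 ->
  exists c z v, [/\ I c, c = 16^-1%:C *: (star z ** z), rnorm c <= 1,
    (forall b, rnorm (c ** b) <= rnorm (b - w ** b)) &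
    v != 0 /\ rnorm v ^+ 2 <= 32 ^+ 2 * cre (ip (pi c v) v)].
Proof.
move=> sI Ii ix sw w1 GFE FG GF; set g := a + a - F ** a => gy.
have [I0 IZ IM Is] := sI.
(* The factor [e0] localizes in [I], while [g] confines vectors to the part where w^2 is at most
   1/2. Below, [k] is g e0 e0* g* normalized, so it lies in [I] and its range lies in that of
   [g]. *)
have [e0 [x0 [Ie0 ge0]]] := rep_neq0_mul sI Ii ix gy.
set x1 := g ** e0 in ge0; have [y1 sx1] := rep_neq0_star ge0.
pose k0 := x1 ** star x1; have sk0 : star k0 = k0 by rewrite starM starK.
have k0y : pi k0 y1 != 0.
  apply/eqP => k0y; have := rep_cre_star rpi (star x1) y1.
  rewrite starK k0y ip_0l cre0 => /esym/eqP; rewrite sqrf_eq0 => /eqP/rnorm_eq0 e.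
  by rewrite e eqxx in sx1.
have k00 : k0 != 0 by apply: contra_neq k0y => ->; exact: (rep0l rpi).
have k0pos := rnorm_gt0 k00; pose t := (rnorm k0)^-1.
have t0 : 0 < t by rewrite invr_gt0.
pose k := t%:C *: k0; have sk : star k = k by rewrite starZ sk0 conjcR.
have k1 : rnorm k <= 1 by rewrite rnormZr gtr0_norm // mulVf ?gt_eqF.
have Ik : I k.
  by apply: star_idealZ => //; have [_] := IM (star x1) _ (IM g _ Ie0).1.
set eta := pi k y1.
have eta0 : eta != 0.
  rewrite /eta (repZl rpi) scaler_eq0 negb_or k0y andbT.
  by apply/eqP => /complexI t0'; rewrite t0' ltxx in t0.
have etag : exists x2, eta = pi g x2.
  exists (pi (t%:C *: (e0 ** star x1)) y1).
  by rewrite -(rep_mul rpi) cmulZr cmulA.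
(* With |w eta| <= 3/4 |eta|, as 3/4 exceeds sqrt (1/2), the tolerance 1/16 leaves |v| >= (1 - 3/4 -
   2/16) |eta| = |eta| / 8. *)
have etapos := rnorm_gt0 eta0; have d0 : 0 < (rnorm eta / 16) ^+ 2.
  by rewrite exprn_gt0 // divr_gt0.
have [n] := bump_vector y1 rpi sk k1 d0.
rewrite ltr_pXn2r ?nnegrE ?rnorm_ge0 ?divr_ge0 ?rnorm_ge0 // -/eta.
have := bump_norm n sk k1; have := bump_ideal n sI Ik.
have := bump_star n sk; set e := bump k n => se Ie en ee.
pose z := e - e ** w; have sz : star z = e - w ** e by rewrite starB starM se sw.
have zb b : rnorm (z ** b) <= 2 * rnorm (b - w ** b).
  rewrite cmulBl -cmulA -cmulBr (le_trans (rnormM _ _)) //.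
  by rewrite ler_wpM2r ?rnorm_ge0.
(* This bound is the origin of the factor 1/16, which makes [c] a contraction. *)
have zn : rnorm z <= 4.
  rewrite (le_trans (rnormB _ _)) //; have := rnormM e w.
  have := rnorm_ge0 e; have := rnorm_ge0 w; nra.
pose c := 16^-1%:C *: (star z ** z); pose v := pi (star z) eta.
have we : rnorm (pi w eta) <= 3 / 4 * rnorm eta.
  have [x2 ->] := etag; have := cutoff_vector a x2 sw w1 GFE FG GF.
  have := rnorm_ge0 (pi w (pi g x2)); have := rnorm_ge0 (pi g x2); rewrite -/g.
  move: (rnorm (pi w _)) (rnorm (pi g _)) => p q q0 p0 pq.
  have h : p ^+ 2 <= (3 / 4 * q) ^+ 2 by rewrite exprMn; have := sqr_ge0 q; lra.
  have q1 : 0 <= 3 / 4 * q by lra.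
  by move: h; rewrite ler_pXn2r ?nnegrE.
have vE : v = eta - pi w eta - ((eta - pi e eta) - pi w (eta - pi e eta)).
  rewrite /v sz (repBl rpi) (rep_mul rpi) (repBr rpi w); zmodule.
have vlow : rnorm eta <= 8 * rnorm v.
  set r := eta - pi e eta in ee vE.
  have h1 : rnorm (pi w r) <= rnorm r.
    rewrite (le_trans (rep_contractive rpi _ _)) // -[leRHS]mul1r.
    by rewrite ler_wpM2r ?rnorm_ge0.
  have h2 : rnorm eta <= rnorm v + rnorm (pi w eta) + (rnorm r + rnorm (pi w r)).
    have -> : eta = v + pi w eta + (r - pi w r) by rewrite vE; zmodule.
    rewrite (le_trans (rnormD _ _)) // lerD ?rnormB // ?rnormD //.
    rewrite (_ : v + pi w eta + (r - pi w r) = eta); last by rewrite vE; zmodule.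
    exact: rnormD.
  by move: ee; rewrite ltr_pdivlMr //; lra.
have v0 : v != 0.
  apply/eqP => v0; move: vlow; rewrite v0 rnorm0 mulr0.
  by rewrite leNgt etapos.
have vpos := rnorm_gt0 v0.
(* Since v = z* eta, |v|^2 = <z v, eta> <= 8 |z v| |v|. As |z v|^2 = 16 <c v, v>, the final constant
   is 64 * 16 = 32^2. *)
have zv : rnorm v <= 8 * rnorm (pi z v).
  have := cre_ip_le (pi z v) eta.
  rewrite (rep_star rpi) -/v cre_ip_norm => h.
  have := rnorm_ge0 (pi z v); nra.
exists c, z, v; split=> //.
- have Iz : I z by apply: star_idealB => //; have [_] := IM w _ Ie.
  by apply: star_idealZ => //; have [] := IM (star z) z Iz.
- rewrite rnormZr rnorm_star_mul ger0_norm ?invr_ge0 //.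
  by rewrite ler_pdivrMl //; have := rnorm_ge0 z; nra.
- move=> b; rewrite cmulZl rnormZr ger0_norm ?invr_ge0 // ler_pdivrMl //.
  rewrite -cmulA (le_trans (rnormM _ _)) // rnorm_star.
  have := zb b; have := rnorm_ge0 z; have := rnorm_ge0 (b - w ** b).
  by have := rnorm_ge0 (z ** b); nra.
split=> //; rewrite (repZl rpi) ip_Zl creZ (rep_cre_star rpi).
by have := rnorm_ge0 (pi z v); nra.
Qed.

End one_step.

(** * Cutoffs and the hull-kernel topology *)

Section primitive_topology.
Context {R : realType} {A : cstarAlgType R}.
Implicit Types (a b w F G : A) (P Q : prim A).

Lemma open_notin_prim a : open [set Q : prim A | ~ prim_set Q a].
Proof.
have /closed_openC : closed [set Q : prim A | prim_set Q a].
  by apply/prim_closedE => P; apply => Q.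
by [].
Qed.

Lemma ker_not_sub (F : set (prim A)) Q : closed F -> ~ F Q ->
  exists2 b, ker F b & ~ prim_set Q b.
Proof.
move=> /prim_closedE Fcl nFQ; apply: contrapT => h; apply: nFQ; apply: Fcl => b Fb.
by apply: contrapT => nQb; apply: h; exists b.
Qed.

Lemma cluster_open (P : nat -> prim A) (S : set nat) Q (V : set (prim A)) :
  (forall b, (forall n, S n -> prim_set (P n) b) -> prim_set Q b) ->
  open V -> V Q -> exists2 n, S n & V (P n).
Proof.
move=> SQ /open_closedC /prim_closedE Vcl VQ; apply: contrapT => h.
apply: (Vcl Q _ VQ) => b Vb; apply: SQ => n Sn; apply: Vb => VPn.
by apply: h; exists n.
Qed.

Definition cutoff_of w F G := [/\ star F = F,
  G + F = w ** w + w ** w + (w ** w + w ** w), rnorm (F - G) <= 2,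
  G ** F = G + G & F ** G = G + G].

Lemma cutoff_of_ex w : star w = w -> rnorm w <= 1 -> exists F G, cutoff_of w F G.
Proof. by move=> sw /(cutoff sw)[G [F c]]; exists F, G. Qed.

(** F acts as 2 on the range of G. The bound on F - G then makes the form of G nonnegative at v, and
    that of 4 w^2 = G + F at least 2 |v|^2. *)
Lemma cutoff_large w F G (H : hilbertType R) (pi : A -> H -> H) (x : H) :
  representation pi -> cutoff_of w F G ->
  rnorm (pi G x) ^+ 2 <= 2 * cre (ip (pi (w ** w) (pi G x)) (pi G x)).
Proof.
move=> rpi [_ GFE FG _ FG2]; set v := pi G x.
have Fv : pi F v = v + v by rewrite -(rep_mul rpi) FG2 (repDl rpi).
have h : cre (ip (pi (F - G) v) v) <= 2 * rnorm v ^+ 2.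
  rewrite (le_trans (cre_ip_le _ _)) // expr2 mulrA ler_wpM2r ?rnorm_ge0 //.
  rewrite (le_trans (rep_contractive rpi _ _)) //.
  by rewrite ler_wpM2r ?rnorm_ge0.
have : cre (ip (pi (G + F) v) v) = 4 * cre (ip (pi (w ** w) v) v).
  by rewrite GFE !(repDl rpi) !ip_Dl !creD; lra.
move: h; rewrite (repBl rpi) (repDl rpi) Fv ip_Bl !ip_Dl !creD creN.
by rewrite cre_ip_norm; lra.
Qed.

(** If 2 - F acted as 0 at all these ideals, F/2 would be a left unit of the quotient, and by
    adjoints a right unit. The set of ideals missing a given element is open, which allows a choice
    outside [U] and not merely outside its interior. *)
Lemma not_unital_pick (U W : set (prim A)) w F G : star w = w ->
  cutoff_of w F G -> open W -> ~ quotient_unital (ker (W `\` U°)) ->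
  exists Q, [/\ W Q, ~ U Q & exists a, ~ prim_set Q (a + a - F ** a)].
Proof.
move=> sw [sF _ _ _ _] oW nu; apply: contrapT => h; apply: nu.
have {}h Q a : (W `\` U°) Q -> prim_set Q (a + a - F ** a).
  move=> [WQ UQ]; apply: contrapT => nQ; apply: UQ.
  exists (W `&` [set Q' | ~ prim_set Q' (a + a - F ** a)]); split.
    - by apply: openI => //; exact: open_notin_prim.
    - by split.
  move=> Q' [WQ' nQ']; apply: contrapT => nU; apply: h; exists Q'.
  by split=> //; exists a.
have hs (b : A) : 2^-1%:C *: (b + b) = b.
  rewrite scalerDr -scalerDl -rmorphD.
  have -> : 2^-1 + 2^-1 = 1 :> R by lra.
  by rewrite rmorph1 scale1r.
exists (2^-1%:C *: F) => a; split=> Q WQ.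
  have -> : (2^-1%:C *: F) ** a - a = - (2^-1%:C *: (a + a - F ** a)).
    by rewrite cmulZl scalerBr hs opprB.
  apply: primN; rewrite -[_ *: _]addr0; apply: prim_linear (prim0 _); exact: h.
have -> : a ** (2^-1%:C *: F) - a = - star (2^-1%:C *: (star a + star a - F ** star a)).
  by rewrite starZ conjcR starB starD starM !starK sF scalerBr hs opprB cmulZr.
apply: primN; apply: prim_star; rewrite -[_ *: _]addr0.
by apply: prim_linear (prim0 _); exact: h.
Qed.

End primitive_topology.

Lemma dependent_sequence (T : Type) (P : nat -> T -> Prop)
    (Rl : nat -> T -> T -> Prop) (t0 : T) : P 0%N t0 ->
  (forall n t, P n t -> exists t', P n.+1 t' /\ Rl n t t') ->
  exists f : nat -> T, f 0%N = t0 /\ forall n, P n (f n) /\ Rl n (f n) (f n.+1).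
Proof.
move=> P0 step.
have /choice[g gP] (nt : nat * T) : exists t', P nt.1 nt.2 ->
    P nt.1.+1 t' /\ Rl nt.1 nt.2 t'.
  have [/step[t' ?]|h] := pselect (P nt.1 nt.2); first by exists t'.
  by exists t0.
pose f := fix f n := if n is n'.+1 then g (n', f n') else t0.
have Pf n : P n (f n) by elim: n => // n IH; have [] := gP (n, f n) IH.
by exists f; split=> // n; split=> //; have [] := gP (n, f n) (Pf n).
Qed.

(* The positive element c has norm at least 1/1024 modulo Q; the representation
   with kernel Q is kept as the witness. *)
Definition large_at (R : realType) (A : cstarAlgType R) (Q : prim A) (c : A) :=
  exists (H : hilbertType R) (pi : A -> H -> H) (v : H),
    [/\ irreducible_rep pi, forall a, prim_set Q a <-> forall x, pi a x = 0,
        v != 0 & rnorm v ^+ 2 <= 32 ^+ 2 * cre (ip (pi c v) v)].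

(** * Inductive choice of the localized elements *)

Section localized_sequence.
Context {R : realType} {A : cstarAlgType R} {X : topologicalType}.
Variables (phi : prim A -> X) (x : X) (u : nat -> A).
Hypothesis hX : hausdorff_space X.
Hypothesis cphi : continuous phi.
Hypothesis u1 : forall n, rnorm (u n) <= 1.
Hypothesis us : forall n, star (u n) = u n.
Hypothesis ul : forall a, u n ** a @[n --> \oo] --> a.
Variable P0 : prim A.
Hypothesis phiP0 : phi P0 = x.
Hypothesis not_unital : forall W, open W -> W P0 ->
  ~ quotient_unital (ker (W `\` (phi @^-1` [set x])°)).
Implicit Types (N M : set X) (S c a : A) (Q : prim A).

Lemma localized_step N (W : set (prim A)) S n (e : R) :
  open N -> N x -> open W -> W P0 -> 0 < e ->
  exists Q c M N', [/\ [/\ open M, M (phi Q), open N', N' x & N' `<=` N],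
    [/\ N' `&` M = set0, N (phi Q) & W Q],
    [/\ ker (phi @^-1` ~` M) c, exists z, c = 16^-1%:C *: (star z ** z) & large_at Q c]
    & [/\ rnorm c <= 1, rnorm (c ** S) <= e
      & forall j, (j <= n)%N -> rnorm (c ** u j) <= e]].
Proof.
move=> oN Nx oW WP0 e0.
have small a : exists K, forall k, (K <= k)%N -> rnorm (a - u k ** a) <= e.
  have /cvgn_rnormP/(_ e e0)[K Ka] := @ul a.
  by exists K => k /Ka/ltW.
have [K1 K1S] := small S.
have [K2 K2u] : exists K, forall k, (K <= k)%N -> forall j, (j <= n)%N ->
    rnorm (u j - u k ** u j) <= e.
  elim: n => [|n [K Ku]].
    have [K Ku] := small (u 0%N); exists K => k /Ku h j.
    by rewrite leqn0 => /eqP ->.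
  have [K' Ku'] := small (u n.+1); exists (maxn K K') => k.
  rewrite geq_max => /andP[/Ku h /Ku' h'] j; rewrite leq_eqVlt ltnS.
  by case/predU1P => [->|/h].
(* By construction |c b| <= |b - u k b|, so smallness of [c] on [S] and on the [u j] only asks that
   [u k] nearly fix these finitely many elements. *)
pose k := maxn K1 K2.
have [F [G FG]] := cutoff_of_ex (us k) (u1 k).
have oWN : open (W `&` phi @^-1` N).
  by apply: openI => //; apply: open_comp.
have [|Q [[WQ NQ] nxQ [a nQa]]] := not_unital_pick (us k) FG oWN (not_unital oWN _).
  by split=> //=; rewrite phiP0.
have xQ : x != phi Q by apply/eqP => xQ; apply: nxQ; rewrite /= xQ.
(* The element [c] will live over [M], and all later choices are confined to a neighbourhood of [x]
   inside [N1], disjoint from [M]. *)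
move: (hX); rewrite open_hausdorff => /(_ _ _ xQ)[[N1 M] /=].
move=> [/set_mem N1x /set_mem MQ] [oN1 oM /eqP N1M].
have [H [pi [irr QE]]] := primP Q; have [rpi _ _] := irr.
have clM : closed (phi @^-1` ~` M).
  by rewrite preimage_setC; apply: open_closedC; apply: open_comp.
have [i Ii nQi] : exists2 b, ker (phi @^-1` ~` M) b & ~ prim_set Q b.
  by apply: ker_not_sub => //=; apply.
have neq0 b : ~ prim_set Q b -> exists y, pi b y != 0.
  move=> nQb; apply: contrapT => h; apply: nQb; apply/QE => y.
  by apply/eqP/negPn/negP => by0; apply: h; exists y.
have [y iy] := neq0 _ nQi; have [y' gy'] := neq0 _ nQa.
have [_ GFE FGn GF _] := FG.
have [c [z [v [Ic cE c1 cb [v0 cv]]]]] := localized_positive irr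
  (ker_star_ideal _) Ii iy (us k) (u1 k) GFE FGn GF gy'.
exists Q, c, M, (N `&` N1); split; split=> //.
- exact: openI.
- by apply/seteqP; split=> t //= [[_ N1t] Mt]; have : (N1 `&` M) t by []; rewrite N1M.
- by exists z.
- by exists H, pi, v.
- by rewrite (le_trans (cb _)) // K1S // leq_maxl.
by move=> j jn; rewrite (le_trans (cb _)) // K2u // leq_maxr.
Qed.

Variable W : nat -> set (prim A).
Hypothesis oW : forall n, open (W n).
Hypothesis WP0 : forall n, W n P0.

Definition pow2 (n : nat) : R := (2 ^+ n)^-1.

Lemma pow2_gt0 n : 0 < pow2 n.
Proof. by rewrite invr_gt0 exprn_gt0. Qed.

Lemma pow2S n : pow2 n = 2 * pow2 n.+1.
Proof. by rewrite /pow2 exprS invfM mulrA mulfV ?pnatr_eq0 // mul1r. Qed.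

Lemma localized_sequence : exists (Q : nat -> prim A) (c S : nat -> A)
    (M N : nat -> set X),
  [/\ [/\ forall n, open (M n), forall n, W n (Q n), forall n, N n (phi (Q n)),
        forall n, N n.+1 `<=` N n & forall n, N n.+1 `&` M n = set0],
    [/\ forall n, ker (phi @^-1` ~` M n) (c n),
        forall n, exists z, c n = 16^-1%:C *: (star z ** z)
      & forall n, large_at (Q n) (c n)]
    & [/\ S 0%N = 0, forall n, S n.+1 = S n + c n, forall n, rnorm (S n) <= 2
      & forall n j, (j <= n)%N -> rnorm (c n ** u j) <= pow2 n]].
Proof.
pose T := (set X * A * (prim A * A * set X))%type.
(* The slack [pow2 n] pays for all later errors: step n adds 2 * pow2 n.+2 = pow2 n.+1. The bound is
   at least 1, as [almost_orthogonal] requires. *)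
pose inv (n : nat) (t : T) := [/\ open t.1.1, t.1.1 x, star t.1.2 = t.1.2
  & rnorm t.1.2 <= 2 - pow2 n].
pose rel (n : nat) (t t' : T) :=
  let N := t.1.1 in let S := t.1.2 in let N' := t'.1.1 in let S' := t'.1.2 in
  let Q := t'.2.1.1 in let c := t'.2.1.2 in let M := t'.2.2 in
  [/\ [/\ open M, W n Q, N (phi Q), N' `<=` N & N' `&` M = set0],
    [/\ ker (phi @^-1` ~` M) c, exists z, c = 16^-1%:C *: (star z ** z)
      & large_at Q c]
    & S' = S + c /\ forall j, (j <= n)%N -> rnorm (c ** u j) <= pow2 n].
have [||f [f0 fP]] := @dependent_sequence T inv rel (setT, 0, (P0, 0, setT)).
- split; rewrite /= ?star0 ?rnorm0 //; first exact: openT.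
  by rewrite /pow2 expr0 invr1 subr_ge0 ler1n.
- move=> n [[N S] o] [/= oN Nx sS Sn].
  have [Q [c [M [N' [[oM MQ oN' N'x N'N] [N'M NQ WQ] [Mc cz lc] [c1 cS cu]]]]]] :=
    localized_step S n oN Nx (oW (n:=n)) (WP0 n) (pow2_gt0 n.+2).
  exists (N', S + c, (Q, c, M)); split.
    have sc : star c = c.
      by have [z ->] := cz; rewrite starZ conjcR starM starK.
    split=> //=; first by rewrite starD sS sc.
    have M1 : 1 <= 2 - pow2 n.
      have : pow2 n <= 1 by rewrite invf_le1 ?exprn_gt0 // exprn_ege1 // ler1n.
      lra.
    have cS' : rnorm (S ** c) <= pow2 n.+2 by rewrite -rnorm_star starM sS sc.
    have := almost_orthogonal sS sc M1 Sn (le_trans c1 M1) cS'.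
    by have := pow2S n; have := pow2S n.+1; lra.
  split; split=> //= j /cu /le_trans; apply.
  by have := pow2S n; have := pow2S n.+1; have := pow2_gt0 n.+2; lra.
(* Stage n + 1 stores the ideal, the element and the open set chosen at step n; those of stage 0 are
   dummies. *)
exists (fun n => (f n.+1).2.1.1), (fun n => (f n.+1).2.1.2), (fun n => (f n).1.2).
exists (fun n => (f n.+1).2.2), (fun n => (f n).1.1).
split; split; try by move=> n; have [_ [[? ? ? ? ?] [? ? ?] [? ?]]] := fP n.
  by rewrite f0.
move=> n; have [[_ _ _ Sn] _] := fP n.
by rewrite (le_trans Sn) // gerBl ltW // pow2_gt0.
Qed.

End localized_sequence.

(** * Strict sums *)

Lemma pow2_small (R : realType) (e : R) : 0 < e ->
  exists N, forall n, (N <= n)%N -> pow2 n < e.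
Proof.
move=> e0; have [N Ne] := @invn_small R e e0; exists N => n /Ne.
by apply: le_lt_trans; exact: invn_exp2.
Qed.

Section strict_sum.
Context {R : realType} {A : cstarAlgType R}.
Variables (u c S : nat -> A).
Hypothesis u1 : forall n, rnorm (u n) <= 1.
Hypothesis ul : forall a, u n ** a @[n --> \oo] --> a.
Hypothesis ur : forall a, a ** u n @[n --> \oo] --> a.
Hypothesis S0 : S 0%N = 0.
Hypothesis SS : forall n, S n.+1 = S n + c n.
Hypothesis S2 : forall n, rnorm (S n) <= 2.
Hypothesis cu : forall n j, (j <= n)%N -> rnorm (c n ** u j) <= pow2 n.
Hypothesis c_square : forall n, exists z, c n = 16^-1%:C *: (star z ** z).
Implicit Types (a b : A) (m : multiplier A) (P : prim A).

Lemma partial_sum_tail n k j : (j <= n)%N ->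
  rnorm ((S (n + k) - S n) ** u j) <= 2 * (pow2 n - pow2 (n + k)).
Proof.
move=> jn; elim: k => [|k IH]; first by rewrite addn0 !subrr cmul0l rnorm0 mulr0.
rewrite addnS SS addrAC cmulDl (le_trans (rnormD _ _)) //.
have := cu (leq_trans jn (leq_addr k n)); have := @pow2S R (n + k); lra.
Qed.

(** As |S n| <= 2, [a] may be replaced by [u K ** a], on which the tail past K is geometric. *)
Lemma partial_sum_cauchy a : exists l : A, S n ** a @[n --> \oo] --> l.
Proof.
apply: cauchyn_rnorm => e e0.
have [|K /(_ K (leqnn K)) aK] := (cvgn_rnormP _ _).1 (@ul a) (e / 16).
  by rewrite divr_gt0.
have a1 : 0 < 8 * (rnorm a + 1) by rewrite mulr_gt0 // ltr_wpDl ?rnorm_ge0.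
have [|N' N'e] := @pow2_small R (e / (8 * (rnorm a + 1))); first by rewrite divr_gt0.
pose N := maxn K N'.
have le n : (N <= n)%N -> rnorm ((S n - S N) ** a) < e / 2.
  move=> /subnKC <-; set k := (n - N)%N.
  have -> : (S (N + k) - S N) ** a =
      (S (N + k) - S N) ** (a - u K ** a) + (S (N + k) - S N) ** u K ** a.
    by rewrite -cmulA -cmulDr subrK.
  have h1 : rnorm ((S (N + k) - S N) ** (a - u K ** a)) <= 4 * rnorm (a - u K ** a).
    rewrite (le_trans (rnormM _ _)) // ler_wpM2r ?rnorm_ge0 //.
    by rewrite (le_trans (rnormB _ _)) //; have := S2 (N + k); have := S2 N; lra.
  have h2 : rnorm ((S (N + k) - S N) ** u K ** a) <= 2 * pow2 N * rnorm a.
    rewrite (le_trans (rnormM _ _)) // ler_wpM2r ?rnorm_ge0 //.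
    rewrite (le_trans (partial_sum_tail k (leq_maxl K N'))) //.
    by have := @pow2_gt0 R (N + k); lra.
  have := N'e N (leq_maxr K N'); rewrite ltr_pdivlMr // => h3.
  rewrite (le_lt_trans (rnormD _ _)) //.
  by have := @pow2_gt0 R N; have := rnorm_ge0 a; lra.
exists N => n k /le h1 /le h2; rewrite -cmulBl -(subrKA (S N)) cmulDl.
by rewrite (le_lt_trans (rnormD _ _)) // -(opprB (S k)) cmulNl rnormN; lra.
Qed.

Lemma partial_sum_star n : star (S n) = S n.
Proof.
elim: n => [|n IH]; first by rewrite S0 star0.
by rewrite SS starD IH; have [z ->] := c_square n; rewrite starZ conjcR starM starK.
Qed.

(** The S n are self-adjoint, so the right action is the left one conjugated by [star]; both sides
    of the centralizer identity are the limit of a (S n) b. *)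
Lemma strict_sum : exists m, forall a, S n ** a @[n --> \oo] --> lmul m a.
Proof.
have [L LP] := choice partial_sum_cauchy.
have L2 a : rnorm (L a) <= 2 * rnorm a.
  rewrite -[L a]subr0; apply: (cvgn_rnorm_le (LP a) (N := 0)) => n _.
  by rewrite subr0 (le_trans (rnormM _ _)) // ler_wpM2r ?rnorm_ge0.
have bL : bounded_op L by exists 2.
have bR : bounded_op (fun a => star (L (star a))).
  by exists 2 => a; rewrite rnorm_star (le_trans (L2 _)) // rnorm_star.
have SL a b : star (L (star a)) ** b = a ** L b.
  apply: (@cvgn_unique _ _ (fun n => a ** (S n ** b))); apply/cvgn_rnormP => e e0.
    have b1 : 0 < rnorm b + 1 by rewrite ltr_wpDl ?rnorm_ge0.
    have [|N Ne] := (cvgn_rnormP _ _).1 (LP (star a)) (e / (rnorm b + 1)).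
      by rewrite divr_gt0.
    exists N => n /Ne; rewrite ltr_pdivlMr // => h.
    have -> : a ** (S n ** b) = star (S n ** star a) ** b.
      by rewrite starM starK partial_sum_star cmulA.
    rewrite -cmulBl -starB (le_lt_trans (rnormM _ _)) // rnorm_star.
    by have := rnorm_ge0 (L (star a) - S n ** star a); nra.
  have a1 : 0 < rnorm a + 1 by rewrite ltr_wpDl ?rnorm_ge0.
  have [|N Ne] := (cvgn_rnormP _ _).1 (LP b) (e / (rnorm a + 1)).
    by rewrite divr_gt0.
  exists N => n /Ne; rewrite ltr_pdivlMr // => h.
  rewrite -cmulBr (le_lt_trans (rnormM _ _)) //.
  by have := rnorm_ge0 (L b - S n ** b); nra.
by exists (mkMultiplier bL bR SL).
Qed.

Lemma tilde_lmul P m : (forall a, prim_set P (lmul m a)) -> tilde (prim_set P) m.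
Proof.
move=> Pm a; split=> //; apply: (closed_cvgn (@prim_closed _ _ P) (@ur (rmul m a))) => n.
by rewrite rmul_lmul; exact: (primM _ (Pm _)).2.
Qed.

Variable m : multiplier A.
Hypothesis mP : forall a, S n ** a @[n --> \oo] --> lmul m a.

Lemma tilde_strict_sum P : (forall n, prim_set P (c n)) -> tilde (prim_set P) m.
Proof.
move=> Pc; apply: tilde_lmul => a.
apply: (closed_cvgn (@prim_closed _ _ P) (@mP a)) => n.
apply: (primM _ _).1; elim: n => [|n IH]; first by rewrite S0; exact: prim0.
by rewrite SS; exact: primD.
Qed.

Section one_representation.
Context {H : hilbertType R} (pi : A -> H -> H) (irr : irreducible_rep pi).
Local Notation rho := (multiplier_rep u1 ul irr).

Let rpi : representation pi. Proof. by have [] := irr. Qed.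

Lemma partial_sum_incr n k (y : H) : cre (ip (pi (S n) y) y) <= cre (ip (pi (S (n + k)) y) y).
Proof.
elim: k => [|k IH]; first by rewrite addn0.
rewrite addnS SS (repDl rpi) ip_Dl creD.
have [z ->] := c_square (n + k); rewrite (repZl rpi) ip_Zl creZ (rep_cre_star rpi).
by have := sqr_ge0 (rnorm (pi z y)); lra.
Qed.

(** Strict convergence controls S k w for w in the range of [pi], where S k >= c n for k > n gives
    the inequality. It extends to [y] through w = pi (u N) y, by boundedness of the difference. *)
Lemma strict_sum_ge n (y : H) : cre (ip (pi (c n) y) y) <= cre (ip (rho m y) y).
Proof.
have ge0 k (z : H) : 0 <= cre (ip (pi (S k) z) z).
  by have := partial_sum_incr 0 k z; rewrite S0 (rep0l rpi) ip_0l cre0.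
have le_sum k (z : H) : (n < k)%N -> cre (ip (pi (c n) z) z) <= cre (ip (pi (S k) z) z).
  move=> /subnKC <-; apply: le_trans (partial_sum_incr _ _ _).
  by rewrite SS (repDl rpi) ip_Dl creD lerDr.
pose T z := rho m z - pi (c n) z; pose K := rnorm m + rnorm (c n).
have TB z w : T (z - w) = T z - T w.
  rewrite /T (linB _ _ (multiplier_rep_linear u1 ul ur irr m)) (repBr rpi).
  by zmodule.
have TK z : rnorm (T z) <= K * rnorm z.
  rewrite (le_trans (rnormB _ _)) // mulrDl lerD ?multiplier_rep_bound //.
  exact: (rep_contractive rpi).
have T_range a z : 0 <= cre (ip (T (pi a z)) (pi a z)).
  set w := pi a z; rewrite /T ip_Bl creB subr_ge0; apply/ler_addgt0Pr => e e0.
  have w1 : 0 < rnorm w + 1 by rewrite ltr_wpDl ?rnorm_ge0.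
  have [|N Ne] := (cvgn_rnormP _ _).1 (rep_cvg rpi (x := z) (@mP a)) (e / (rnorm w + 1)).
    by rewrite divr_gt0.
  have := Ne (N + n.+1)%N (leq_addr _ _); have := le_sum (N + n.+1)%N w (leq_addl _ _).
  rewrite multiplier_repE (rep_mul rpi) -/w; set k := (N + n.+1)%N.
  rewrite rnormBC ltr_pdivlMr // => h1 h2.
  have := cre_ip_le (pi (S k) w - pi (lmul m a) z) w; rewrite ip_Bl creB.
  have := rnorm_ge0 (pi (S k) w - pi (lmul m a) z); lra.
rewrite -subr_ge0 -creB -ip_Bl -/(T y) -oppr_le0.
apply/ler_addgt0Pr => e e0; rewrite add0r.
have K0 : 0 <= K by rewrite addr_ge0 ?rnorm_ge0.
have k1 : 0 < 2 * K * rnorm y + 1 by rewrite ltr_wpDl // !mulr_ge0 ?rnorm_ge0.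
have [|N /(_ N (leqnn N))] := (cvgn_rnormP _ _).1
    (irreducible_approximate_unit u1 ul irr (x := y)) (e / (2 * K * rnorm y + 1)).
  by rewrite divr_gt0.
rewrite ltr_pdivlMr // => yN; have := T_range (u N) y; set w := pi (u N) y in yN *.
have wy : rnorm w <= rnorm y.
  rewrite (le_trans (rep_contractive rpi _ _)) // -[leRHS]mul1r.
  by rewrite ler_wpM2r ?rnorm_ge0.
have -> : ip (T w) w = ip (T y) y - (ip (T (y - w)) w + ip (T y) (y - w)).
  by rewrite TB ip_Bl ip_Br; ring.
rewrite creB creD.
have h1 : - cre (ip (T (y - w)) w) <= K * rnorm (y - w) * rnorm y.
  rewrite -creN -mulN1r -ip_Zl scaleN1r (le_trans (cre_ip_le _ _)) // rnormN.
  by rewrite ler_pM ?rnorm_ge0.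
have h2 : - cre (ip (T y) (y - w)) <= K * rnorm y * rnorm (y - w).
  rewrite -creN -mulN1r -ip_Zl scaleN1r (le_trans (cre_ip_le _ _)) // rnormN.
  by rewrite ler_wpM2r ?rnorm_ge0.
have := rnorm_ge0 (y - w); lra.
Qed.

End one_representation.
End strict_sum.

(** * A multiplier with peaks accumulating at a point of Z *)

Section numerical_lower_bound.
Context {R : realType} {B : cstarAlgType R} {H : hilbertType R}.
Variables (pi : B -> H -> H) (rpi : representation pi) (I : set B).
Hypotheses (I0 : I 0) (Ipi : forall b, I b -> forall x, pi b x = 0).

Lemma quotient_norm_ge b (v : H) (eps : R) : v != 0 ->
  eps * rnorm v ^+ 2 <= cre (ip (pi b v) v) -> eps <= quotient_norm I b.
Proof.
move=> v0 bv; apply: lb_le_inf; first by exists (rnorm (b + 0)), 0.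
move=> _ [d Id <-]; rewrite -(@ler_pM2r _ (rnorm v ^+ 2)) ?exprn_gt0 ?rnorm_gt0 //.
apply: (le_trans bv); rewrite -[pi b v]addr0 -(Ipi Id v) -(repDl rpi).
rewrite (le_trans (cre_ip_le _ _)) // expr2 mulrA ler_wpM2r ?rnorm_ge0 //.
exact: (rep_contractive rpi).
Qed.

End numerical_lower_bound.

(** Points of [X] are closed, so a boundary point of the fibre belongs to the fibre. *)
Lemma not_locally_modular_point (R : realType) (A : cstarAlgType R) (X : topologicalType)
    (phi : prim A -> X) (x : X) :
  hausdorff_space X -> continuous phi -> ~ locally_modular phi x ->
  exists2 P, phi P = x & forall W, open W -> W P ->
    ~ quotient_unital (ker (W `\` (phi @^-1` [set x])°)).
Proof.
move=> hX cphi nlm; apply: contrapT => nP; apply: nlm => H P [HP _].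
have {}HP : phi P = x.
  have : closed H.
    apply: closed_comp => [? _|]; first exact: cphi.
    by apply: accessible_closed_set1; exact: hausdorff_accessible.
  by apply.
apply: contrapT => nW; apply: nP; exists P => // W oW WP qu.
by apply: nW; exists W.
Qed.

(** If every G acted as 0 at P, then 4 |u k v|^2 = <(F - G) v, v> <= 2 |v|^2, which fails once |u k
    v| >= 3/4 |v|. *)
Lemma approximate_unit_cutoff (R : realType) (A : cstarAlgType R) (u : nat -> A) (P : prim A) :
  (forall n, rnorm (u n) <= 1) -> (forall n, star (u n) = u n) ->
  (forall a, u n ** a @[n --> \oo] --> a) ->
  exists k F G, cutoff_of (u k) F G /\ ~ prim_set P G.
Proof.
move=> u1 us ul; apply: contrapT => h.
have [H [pi [irr PE]]] := primP P; have [rpi [a [x pax]] _] := irr.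
set v := pi a x in pax; have v0 := rnorm_gt0 pax.
have [|N /(_ N (leqnn N)) vN] := (cvgn_rnormP _ _).1
    (irreducible_approximate_unit u1 ul irr (x := v)) (rnorm v / 4).
  by rewrite divr_gt0.
have [F [G FG]] := cutoff_of_ex (us N) (u1 N).
have Gv : pi G v = 0.
  apply: (PE G).1; apply: contrapT => nPG; apply: h.
  by exists N, F, G.
have [_ GFE FG2 _ _] := FG.
have : cre (ip (pi (F - G) v) v) <= 2 * rnorm v ^+ 2.
  rewrite (le_trans (cre_ip_le _ _)) // expr2 mulrA ler_wpM2r ?rnorm_ge0 //.
  by rewrite (le_trans (rep_contractive rpi _ _)) // ler_wpM2r ?rnorm_ge0.
have -> : pi (F - G) v = pi (G + F) v by rewrite (repBl rpi) (repDl rpi) Gv subr0 add0r.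
rewrite GFE !(repDl rpi) !ip_Dl !creD -{1 3 5 7}us rep_cre_star //.
have := rnormD (v - pi (u N) v) (pi (u N) v); rewrite subrK; nra.
Qed.

Lemma continuous_within_comp (T X Y : topologicalType) (phi : T -> X) (h : X -> Y) :
  continuous phi -> {within range phi, continuous h} -> continuous (h \o phi).
Proof.
move=> cphi ch t U hU.
have rt : range phi (phi t) by exists t.
have := ch (phi t) U hU; rewrite /nbhs /= -(nbhs_subspace_in rt) => /cphi.
rewrite /nbhs /=; apply: filterS => s /=; apply.
by exists s.
Qed.

(** A lower bound for [c] modulo the ideal, in the form that [primitive_cluster] and
    [quotient_norm_ge] consume. *)
Definition peaks (R : realType) (A : cstarAlgType R) (c : multiplier A) (eps : R)
    (P : prim A) :=
  exists2 s : bundled_rep (multiplier A), forall b, tilde (prim_set P) b -> forall v, s b v = 0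
    & exists2 v : rep_space s, v != 0 & eps * rnorm v ^+ 2 <= cre (ip (s c v) v).

(** Where G is nonzero, [cutoff_large] gives a vector at which the form of w^2 is at least 1/2, a
    bound uniform in n. Quantifying over [S] puts [Qoo] in the closure of every tail. *)
Lemma localized_cluster_point (R : realType) (A : cstarAlgType R) (w F G : A)
    (Q : nat -> prim A) : cutoff_of w F G ->
  (forall n, ~ prim_set (Q n) G) ->
  exists Qoo : prim A, forall S, \oo S -> forall b, (forall n, S n -> prim_set (Q n) b) ->
    prim_set Qoo b.
Proof.
move=> FG QG.
pose large (P : prim A) (s : bundled_rep A) :=
  (forall b, prim_set P b -> forall v, s b v = 0) /\
  exists2 v : rep_space s, v != 0 & 2^-1 * rnorm v ^+ 2 <= cre (ip (s (w ** w) v) v).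
have /choice[s sQ] n : exists s, large (Q n) s.
  have [H [pi [[rpi _ _] QE]]] := primP (Q n).
  exists (BundledRep rpi); split=> [b /QE //|/=].
  have [x Gx] : exists x, pi G x != 0.
    apply: contrapT => h; apply: (QG n); apply/QE => x.
    by apply/eqP/negPn/negP => Gx; apply: h; exists x.
  exists (pi G x) => //; have := cutoff_large x rpi FG; lra.
have h n : exists2 v : rep_space (s n), v != 0 &
    2^-1 * rnorm v ^+ 2 <= cre (ip (s n (w ** w) v) v) by have [] := sQ n.
have [|Qoo [_ QooP]] := primitive_cluster (@eventually_filter) _ h.
  by rewrite invr_gt0.
exists Qoo => S FS b Sb; apply: (QooP S FS) => n Sn v.
by have [sb _] := sQ n; apply: sb; exact: Sb.
Qed.

Section approximate_unit.
Context {R : realType} {A : cstarAlgType R} (u : nat -> A).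
Hypothesis u1 : forall n, rnorm (u n) <= 1.
Hypothesis ul : forall a, u n ** a @[n --> \oo] --> a.
Hypothesis ur : forall a, a ** u n @[n --> \oo] --> a.

Lemma peaks_of_large_at (c S : nat -> A) (m : multiplier A) n (P : prim A) :
  S 0%N = 0 -> (forall n, S n.+1 = S n + c n) ->
  (forall n, exists z, c n = 16^-1%:C *: (star z ** z)) ->
  (forall a, S n ** a @[n --> \oo] --> lmul m a) ->
  large_at P (c n) -> peaks m (32 ^+ 2)^-1 P.
Proof.
move=> S0 SS cz mP [H [pi [v [irr PE v0 cv]]]].
exists (BundledRep (multiplier_repP u1 ul ur irr)) => /= [b Pb|].
  apply/(multiplier_rep_ker u1 ul ur irr).
  rewrite (_ : [set a | _] = prim_set P) //.
  by apply/seteqP; split=> a /PE.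
exists v => //; rewrite ler_pdivrMl ?exprn_gt0 // (le_trans cv) //.
by rewrite ler_wpM2l ?sqr_ge0 // (strict_sum_ge u1 ul ur S0 SS cz mP).
Qed.

End approximate_unit.

Lemma peak_multiplier (R : realType) (A : cstarAlgType R) (X : topologicalType)
    (phi : prim A -> X) (x : X) (Z : set X) (u : nat -> A) :
  (forall n, rnorm (u n) <= 1) -> (forall n, star (u n) = u n) ->
  (forall a, u n ** a @[n --> \oo] --> a) -> (forall a, a ** u n @[n --> \oo] --> a) ->
  hausdorff_space X -> continuous phi -> zero_set R (range phi) Z -> Z x ->
  ~ locally_modular phi x ->
  exists (c : multiplier A) (Qoo : prim A) (Q : nat -> prim A),
    [/\ Z (phi Qoo), tilde (fiber_ideal phi (phi Qoo)) c,
        forall n, peaks c (32 ^+ 2)^-1 (Q n)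
      & forall b, (forall n, prim_set (Q n) b) -> prim_set Qoo b].
Proof.
move=> u1 us ul ur hX cphi [h ch ->] [_ /= hx0] nlm.
have [P0 phiP0 nu] := not_locally_modular_point hX cphi nlm.
have [k [F [G [FG P0G]]]] := approximate_unit_cutoff P0 u1 us ul.
have chp : continuous (fun Q => `|h (phi Q)|).
  move=> Q; apply: continuous_comp; last exact: norm_continuous.
  exact: (continuous_within_comp cphi ch).
(* Avoiding [G] will produce the cluster point; the bound on h will force it into the zero set. *)
pose W n := [set Q : prim A | ~ prim_set Q G] `&` [set Q | `|h (phi Q)| < invn n].
have oW n : open (W n).
  apply: openI; first exact: open_notin_prim.
  apply: (open_comp (f := fun Q => `|h (phi Q)|) (D := [set t | t < invn n])) => [Q _|].
    exact: chp.
  exact: open_lt.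
have WP0 n : W n P0 by split=> //=; rewrite phiP0 hx0 normr0 invn_gt0.
have [Q [c [S [M [N]]]]] := localized_sequence hX cphi u1 us ul phiP0 nu oW WP0.
move=> [[oM WQ NQ Nsub NM] [Mc cz Qc] [S0 SS S2 cu]].
have [m mP] := strict_sum ul S0 SS S2 cu cz.
have [Qoo QooP] := localized_cluster_point FG (fun n => (WQ n).1).
have near n : \oo [set k | (n <= k)%N] by exists n.
have Nle n i : (n <= i)%N -> N i `<=` N n.
  by move=> /subnKC <-; elim: (i - n)%N => [|j IH]; rewrite ?addn0 ?addnS // => t /Nsub /IH.
exists m, Qoo, Q; split.
- split; first by exists Qoo.
  apply/eqP; rewrite -normr_eq0 eq_le normr_ge0 andbT.
  apply/ler_addgt0Pr => e e0; rewrite add0r.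
  rewrite leNgt; apply/negP => he.
  have [n0 n0e] := invn_small e0.
  have oV : open [set P : prim A | e < `|h (phi P)|].
    apply: (open_comp (f := fun Q => `|h (phi Q)|) (D := [set t | e < t])) => [Q' _|].
      exact: chp.
    exact: open_gt.
  have [n /= n0n] := cluster_open (QooP _ (near n0)) oV he.
  by rewrite ltNge ltW // (lt_trans (WQ n).2) // n0e.
(* All [Q i] with i > n lie over [N n.+1], which is disjoint from the open set [M n]; so their
   cluster point is not over [M n], and [c n] vanishes on its fibre. *)
- have nM n : ~ M n (phi Qoo).
    move=> MQ; have oV : open (phi @^-1` M n) by apply: open_comp.
    have [i /= ni Mi] := cluster_open (QooP _ (near n.+1)) oV MQ.
    by have : (N n.+1 `&` M n) (phi (Q i)) by [split=> //; apply: Nle ni _ (NQ i)]; rewrite NM.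
  have mt (P : prim A) : phi P = phi Qoo -> tilde (prim_set P) m.
    move=> PQ; apply: (tilde_strict_sum ur S0 SS mP) => n; apply: (Mc n) => /=.
    by rewrite PQ.
  by move=> a; split=> P /= PQ; have [] := mt P PQ a.
- by move=> n; exact: (peaks_of_large_at u1 ul ur S0 SS cz mP (Qc n)).
by move=> b Qb; apply: (QooP setT) => //; exact: filterT.
Qed.

(** * Strict closedness *)

(** Complete regularity separates points by functions into [0, 1]. Injectivity lets an equality of
    values in the compactification be read back in [X]. *)
Lemma to_stone_cech_inj (R : realType) (X : topologicalType) :
  locally_compact [set: X] -> hausdorff_space X -> injective (@to_stone_cech R X).
Proof.
move=> lcX hX y z /(congr1 set_val) /= yz; apply: contrapT => nyz.
have z1 : closed [set z] by apply: accessible_closed_set1; exact: hausdorff_accessible.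
have /(uniform_separatorP (R := R))[f [cf f01 fy fz]] :=
  @locally_compact_completely_regular _ R lcX hX _ _ z1 nyz.
have f1 t : 0 <= f t <= 1 by have := f01 (f t); rewrite /= in_itv; apply; exists t.
have := congr1 (fun e => e (exist _ f (conj cf f1))) yz.
have ev t : set_val (to_stone_cech R t) = evaluation t by [].
rewrite !ev /evaluation /= (fy (f y)); last by exists y.
by rewrite (fz (f z)); [move/eqP; rewrite eq_sym oner_eq0|exists z].
Qed.

Section strict_topology.
Context {R : realType} {A : cstarAlgType R} (u : nat -> A).
Hypothesis ul : forall a, u n ** a @[n --> \oo] --> a.
Hypothesis ur : forall a, a ** u n @[n --> \oo] --> a.

Lemma strict_map_cvg (c : multiplier A) :
  strict_map (to_multiplier (lmul c (u n))) @[n --> \oo] --> strict_map c.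
Proof.
apply/cvg_sup => a U [_ [[W oW <-] Wc] WU].
have lc : lmul c (u n) ** a @[n --> \oo] --> lmul c a.
  apply/cvgn_rnormP => e e0.
  have c1 : 0 < rnorm c + 1 by rewrite ltr_wpDl ?rnorm_ge0.
  have [|N Na] := (cvgn_rnormP _ _).1 (@ul a) (e / (rnorm c + 1)).
    by rewrite divr_gt0.
  exists N => n /Na; rewrite ltr_pdivlMr // => an.
  rewrite -lmulM -(linB _ _ (lmul_linear c)) (le_lt_trans (rnorm_lmul _ _)) //.
  by have := rnorm_ge0 (a - u n ** a); nra.
have rc : a ** lmul c (u n) @[n --> \oo] --> rmul c a.
  rewrite (_ : (fun n => _) = (fun n => rmul c a ** u n)); first exact: ur.
  by apply/funext => n; rewrite rmul_lmul.
have nW : nbhs (lmul c a, rmul c a) W by exact: open_nbhs_nbhs.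
have Wn : \forall n \near \oo, W (lmul c (u n) ** a, a ** lmul c (u n)).
  exact: (cvg_pair lc rc nW).
by apply: filterS Wn => n Wn; exact: WU.
Qed.

Lemma strictly_closed_cvg (S : set (multiplier A)) c : strictly_closed S ->
  (forall n, S (to_multiplier (lmul c (u n)))) -> S c.
Proof.
move=> Scl Su; apply: Scl => U [_ [[D oD <-] Dc] DU].
have [N _ /(_ N (leqnn N)) /= DN] : \forall n \near \oo, D (strict_map (to_multiplier (lmul c (u n)))).
  by apply: strict_map_cvg; exact: open_nbhs_nbhs.
by exists (to_multiplier (lmul c (u N))); split=> //; apply: DU.
Qed.

End strict_topology.

Section cluster_in_multipliers.
Context {R : realType} {A : cstarAlgType R} {X : topologicalType}.
Variables (phi : prim A -> X) (phibar : prim (multiplier A) -> stone_cech R X).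
Hypothesis cphi : continuous phi.
Hypothesis ext : base_map_extension phi phibar.
Variables (u : nat -> A) (c : multiplier A) (eps : R) (Qoo : prim A) (Q : nat -> prim A).
Hypothesis u1 : forall n, rnorm (u n) <= 1.
Hypothesis ul : forall a, u n ** a @[n --> \oo] --> a.
Hypothesis ur : forall a, a ** u n @[n --> \oo] --> a.
Hypothesis eps0 : 0 < eps.
Hypothesis Qc : forall n, peaks c eps (Q n).
Hypothesis QooP : forall b, (forall n, prim_set (Q n) b) -> prim_set Qoo b.
Local Notation y := (phi Qoo).

(** Generated by the sets of n with phi (Q n) in a neighbourhood of y: a limit along the cofinite
    filter need not lie over y, while one along this filter does. It is proper because [Qoo] is in
    the closure of the [Q n]. *)
Let F : set_system nat := [set S | nbhs y [set z | forall n, phi (Q n) = z -> S n]].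

Let FF : ProperFilter F.
Proof.
split.
  rewrite /F /= nbhsE => -[V [oV Vy] V0].
  have oW : open (phi @^-1` V) by apply: open_comp.
  have [|n _ Vn] := @cluster_open _ _ Q setT Qoo _ _ oW Vy.
    by move=> b h; apply: QooP => n; exact: h.
  exact: (V0 _ Vn n).
split=> [|S T FS FT|S T ST]; rewrite /F /=.
- by apply: filterS filterT => z _ n.
- move: FS FT; apply: (@filterS2 _ (nbhs y)) => z h1 h2 n nz; split; [exact: h1|exact: h2].
- by apply: filterS => z h n /h /ST.
Qed.

Lemma peak_in_fiber : exists2 Qhat : prim (multiplier A),
  phibar Qhat = to_stone_cech R y & ~ prim_set Qhat c.
Proof.
have [s sQ sc] : exists2 s : nat -> bundled_rep (multiplier A),
    forall n b, tilde (prim_set (Q n)) b -> forall v, s n b v = 0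
  & forall n, exists2 v : rep_space (s n), v != 0 & eps * rnorm v ^+ 2 <= cre (ip (s n c v) v).
  by exists (fun n => s2val (cid2 (Qc n))) => n; case: cid2.
have [Qt QtE] := choice (fun n => prim_tilde u1 ul ur (Q n)).
have [Qhat [Qhat_c QhatP]] := primitive_cluster FF eps0 sc.
exists Qhat => //; apply: val_inj; apply/funext => f /=.
have [cphibar phibarE] := ext.
pose g (P : prim (multiplier A)) : R := set_val (phibar P) f.
have cg : continuous g.
  move=> P; apply: (@continuous_comp _ _ _ (fun P => set_val (phibar P)) (fun e => e f)).
    apply: continuous_comp; first exact: cphibar.
    exact: initial_continuous.
  have /cvg_sup/(_ f) h : nbhs (set_val (phibar P)) --> set_val (phibar P) by [].
  by move=> U nU; apply: h; exact: initial_continuous.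
(* Points of the compactification are compared by coordinates. A coordinate with the wrong value
   would be separated from the right one by open sets, and [O2] yields a member of the filter on
   which [O1] is avoided. *)
apply: contrapT => gy.
have /eqP {}gy : g Qhat <> sval f y by [].
have := @norm_hausdorff R R; rewrite open_hausdorff => /(_ _ _ gy)[[O1 O2] /=].
move=> [/set_mem O1g /set_mem O2y] [oO1 oO2 /eqP O12].
pose S := [set n | O2 (sval f (phi (Q n)))].
have FS : F S.
  have : nbhs y (sval f @^-1` O2).
    by apply: (svalP f).1; exact: open_nbhs_nbhs.
  by apply: (@filterS _ (nbhs y)) => z /= O2z n nz; rewrite /S /= nz.
have oV : open (g @^-1` O1) by apply: open_comp.
have [|n Sn /= O1n] := @cluster_open _ _ Qt S Qhat _ _ oV O1g.
  by move=> b Sb; apply: (QhatP S FS) => n Sn; apply: sQ; rewrite -QtE; exact: Sb.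
have : (O1 `&` O2) (g (Qt n)).
  by split=> //; rewrite /g (phibarE _ _ (QtE n)).
by rewrite O12.
Qed.

Lemma peak_not_strictly_closed : locally_compact [set: X] -> hausdorff_space X ->
  tilde (fiber_ideal phi y) c -> ~ strictly_closed (fiber_ideal phibar (to_stone_cech R y)).
Proof.
move=> lcX hX cy Hcl; have [Qhat Qy] := peak_in_fiber; apply.
apply: (strictly_closed_cvg ul ur Hcl) (Qy) => n P Py.
(* A primitive ideal over y that misses this element of A restricts to an ideal of A over y, which
   contains [lmul c (u n)] by the choice of [c]. *)
apply: contrapT => nP; have [|P' [PE P'E]] := @prim_restrict _ _ P.
  by exists (lmul c (u n)).
apply: nP; apply/P'E; apply: (cy (u n)).1 => /=.
by apply: (to_stone_cech_inj (R := R) lcX hX); rewrite -(ext.2 _ _ PE).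
Qed.

End cluster_in_multipliers.

Theorem theorem3p6 (R : realType) (A : cstarAlgType R) (X : topologicalType)
    (phi : prim A -> X) (phibar : prim (multiplier A) -> stone_cech R X)
    (x : X) (Z : set X) :
  locally_compact [set: X] -> hausdorff_space X ->
  continuous phi -> base_map_extension phi phibar ->
  sigma_unital A ->
  range phi x -> zero_set R (range phi) Z -> Z x ->
  ~ locally_modular phi x ->
  exists y : X, [/\ Z y,
    exists (c : multiplier A) (eps : R),
      [/\ tilde (fiber_ideal phi y) c, 0 < eps
        & ~ exists V : set (prim A),
            [/\ open V, phi @^-1` [set y] `<=` V
              & forall P : prim A, V P ->
                  quotient_norm (tilde (prim_set P)) c < eps]]
    & ~ strictly_closed (fiber_ideal phibar (to_stone_cech R y))].
Proof.
move=> lcX hX cphi ext [u [u_pos _ ul ur]] _ Zzero Zx nlm.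
have u1 n : rnorm (u n) <= 1 by have [_] := u_pos n; rewrite rnormE lecR.
have us n : star (u n) = u n by have [[b ->] _] := u_pos n; rewrite starM starK.
have [c [Qoo [Q [ZQ cQ Qc QooP]]]] := peak_multiplier u1 us ul ur hX cphi Zzero Zx nlm.
have eps0 : 0 < (32 ^+ 2)^-1 :> R by rewrite invr_gt0 exprn_gt0.
exists (phi Qoo); split=> //; last first.
  exact: (peak_not_strictly_closed cphi ext u1 ul ur eps0 Qc QooP).
exists c, (32 ^+ 2)^-1; split=> // -[V [oV HV Vc]].
(* [V] is a neighbourhood of [Qoo], so it contains some [Q n], where the peak contradicts the bound
   on the quotient norm. *)
have [|n _ Vn] := @cluster_open _ _ Q setT Qoo _ _ oV (HV _ erefl).
  by move=> b Qb; apply: QooP => n; exact: Qb.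
have := Vc _ Vn; rewrite ltNge => /negP; apply.
have [s sQ [v v0 cv]] := Qc n.
apply: (quotient_norm_ge (rep_mapP s) _ sQ v0 cv) => a /=.
by split; exact: prim0.
Qed.
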